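(* Let $f$ be a $C^r$ random dynamical system on $\mathbb{T}^2$ over $(\Omega,\mathcal{F},P,T)$, $r\ge 1$. Let $\mu$ be an $f$-invariant ergodic measure of full support on $\Omega\times\mathbb{T}^2$. Suppose that $f$ has $\tau$-polynomial growth of the derivative ($\tau>0$). Then $\tau\geq1$ and $f$ is algebraically conjugate to a random skew product of the form $$\hat f_\omega(x_1,x_2)=(F_\omega(x_1),\,x_2+\varphi_\omega(x_1)),$$ where $F:\Omega\times\mathbb{T}\to\mathbb{T}$ is a $C^r$ random diffeomorphism of the circle and $\varphi:\Omega\times\mathbb{T}\to\mathbb{T}$ is a random function. Moreover, if $f$ preserves orientation (i.e. $f_\omega$ preserves orientation for $P$-a.e. $\omega$), then there exist a random homeomorphism of the circle $\xi:\Omega\times\mathbb{T}\to\mathbb{T}$ and a measurable function $\alpha:\Omega\to\mathbb{T}$ such that for $P$-a.e. $\omega\in\Omega$ $$\xi_{T\omega}\circ F_\omega(x)=\xi_\omega(x)+\alpha_\omega\quad\text{for all }x\in\mathbb{T},$$ and consequently $f$ is topologically conjugate to the random skew product $$\mathbb{T}^2\ni(x_1,x_2)\longmapsto(x_1+\alpha_\omega,\,x_2+\varphi_\omega\circ\xi_\omega^{-1}(x_1))\in\mathbb{T}^2 .$$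
   Context: $\mathbb{T}^d=\mathbb{R}^d/\mathbb{Z}^d$. $(\Omega,\mathcal{F},P)$ is a Lebesgue (standard) probability space and $T$ is an ergodic measure-preserving automorphism of it. A $C^r$ random dynamical system (RDS) $f$ on a compact manifold $M$ over $(\Omega,\mathcal{F},P,T)$ is a measurable map $\mathbb{Z}\times\Omega\times M\ni(n,\omega,x)\mapsto f^n_\omega x\in M$ such that for $P$-a.e. $\omega$: $f^0_\omega=\mathrm{Id}_M$, $f^{m+n}_\omega=f^m_{T^n\omega}\circ f^n_\omega$ for all $m,n\in\mathbb{Z}$, and each $f^n_\omega:M\to M$ is of class $C^r$; write $f_\omega=f^1_\omega$. Let $T_f(\omega,x)=(T\omega,f_\omega x)$ on $\Omega\times M$ (with the product of $\mathcal{F}$ and the Borel $\sigma$-algebra). A probability measure $\mu$ on $\Omega\times M$ is $f$-invariant if it is $T_f$-invariant and has marginal $P$ on $\Omega$; it is ergodic if $T_f$ is ergodic for $\mu$; with disintegration $\mu_\omega$ over $P$, it has full support if $\operatorname{supp}(\mu_\omega)=M$ for $P$-a.e. $\omega$. An RDS $f$ on $\mathbb{T}^d$ has $\tau$-polynomial growth of the derivative (with respect to $\mu$) if $n^{-\tau}Df^n_\omega(x)\to g(\omega,x)$ for $\mu$-a.e. $(\omega,x)$, where $g:\Omega\times\mathbb{T}^d\to M_d(\mathbb{R})$ is $\mu$ non-zero, i.e. non-zero on a set of positive $\mu$-measure. Two RDS $f,g$ on $\mathbb{T}^2$ over $(\Omega,\mathcal{F},P,T)$ are algebraically conjugate if there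 is a group automorphism $A:\mathbb{T}^2\to\mathbb{T}^2$ (not depending on $\omega$) with $f_\omega\circ A=A\circ g_\omega$ for $P$-a.e. $\omega$; they are topologically conjugate if there is a random homeomorphism $\Theta_\omega$ of $\mathbb{T}^2$ with $\Theta_{T\omega}\circ f_\omega=g_\omega\circ\Theta_\omega$ for $P$-a.e. $\omega$. A random function (resp. $C^r$ random diffeomorphism, random homeomorphism) of the circle is a measurable map $\Omega\times\mathbb{T}\to\mathbb{T}$, $(\omega,x)\mapsto F_\omega(x)$ (with $F_\omega$ a $C^r$-diffeomorphism, resp. a homeomorphism, of $\mathbb{T}$ for $P$-a.e. $\omega$). *)

(* Defs.v *)
From HB Require Import structures.
From mathcomp Require Import all_boot all_order all_algebra.
From mathcomp Require Import all_classical all_reals all_analysis.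
Set Implicit Arguments.
Unset Strict Implicit.
Unset Printing Implicit Defensive.
Import Order.TTheory GRing.Theory Num.Theory.
Import numFieldNormedType.Exports.
Local Open Scope classical_set_scope.
Local Open Scope ring_scope.

(* The subgroup Z of R; [int_num_subdef] is the predicate underlying [Num.int]. *)
Definition integers (R : realType) : zmodClosed R :=
  Algebra.ZmodClosed.clone _ (Num.int_num_subdef : pred R) _.

(* The circle R/Z: the quotient group of R by its subgroup of integers, with
   the quotient topology and the Borel sigma-algebra. *)
Definition circle (R : realType) : Type := {ideal_quot (integers R)}.

(* The group structure is rebuilt on top of the topological quotient, whose
   choice structure differs from the one of the algebraic quotient. *)
HB.instance Definition _ (R : realType) := Topological.copy (circle R)
  (quotient_topology {ideal_quot (integers R)}).
HB.instance Definition _ (R : realType) := GRing.isZmodule.Build (circle R)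
  (@Quotient.addqA R (integers R)) (@Quotient.addqC R (integers R))
  (@Quotient.add0q R (integers R)) (@Quotient.addNq R (integers R)).
HB.instance Definition _ (R : realType) := isPointed.Build (circle R) 0.

Section borel_circle.
Variable R : realType.
Let op : set (set (circle R)) := open.

HB.instance Definition _ := @isMeasurable.Build (sigma_display op)
  (circle R) <<s op >> (@sigma_algebra0 _ setT op)
  (@sigma_algebraC _ op) (@sigma_algebra_bigcup _ setT op).
End borel_circle.

(* T^2 = R^2/Z^2, as a product of topological groups.  As the circle is second
   countable, the product sigma-algebra is the Borel one. *)
Notation torus2 R := (circle R * circle R)%type.

(* Standard charts.  [circle_exp] and [torus_exp] are the projections R -> R/Z
   and R^2 -> R^2/Z^2; [circle_log] and [torus_log] choose the representative
   with coordinates in [-1/2, 1/2[, hence invert the projections near 0. *)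
Definition circle_exp (R : realType) (t : R) : circle R :=
  (\pi_({ideal_quot (integers R)}) t)%qT.

Definition circle_log (R : realType) (x : circle R) : R :=
  let t := repr (x : {ideal_quot (integers R)}) in
  t - (Num.floor (t + 2^-1))%:~R.

Definition torus_exp (R : realType) (v : 'rV[R]_2) : torus2 R :=
  (circle_exp (v ord0 ord0), circle_exp (v ord0 ord_max)).

Definition torus_log (R : realType) (x : torus2 R) : 'rV[R]_2 :=
  \row_(j < 2) (if j == ord0 then circle_log x.1 else circle_log x.2).

(* h read in the charts centred at x and at h x. *)
Definition circle_local (R : realType) (h : circle R -> circle R)
    (x : circle R) : R -> R :=
  fun t => circle_log (h (x + circle_exp t) - h x).

Definition torus_local (R : realType) (h : torus2 R -> torus2 R)
    (x : torus2 R) : 'rV[R]_2 -> 'rV[R]_2 :=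
  fun v => torus_log (h (x + torus_exp v) - h x).

(* h is of class C^k on some neighbourhood of x. *)
Fixpoint Ck_near (R : realType) (V W : normedModType R) (k : nat)
    (h : V -> W) (x : V) : Prop :=
  match k with
  | 0%N => \forall y \near x, {for y, continuous h}
  | k'.+1 => (\forall y \near x, differentiable h y) /\
             forall v : V, Ck_near k' (fun y => 'D_v h y) x
  end.

(* Regularity classes C^r, r in {0, 1, 2, ...} or r = oo ([None]). *)
Definition le_reg (k : nat) (r : option nat) : bool :=
  if r is Some m then (k <= m)%N else true.

Definition circle_Cr (R : realType) (r : option nat)
    (h : circle R -> circle R) : Prop :=
  forall k, le_reg k r -> forall x, Ck_near k (circle_local h x) 0.

Definition torus_Cr (R : realType) (r : option nat)
    (h : torus2 R -> torus2 R) : Prop :=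
  forall k, le_reg k r -> forall x, Ck_near k (torus_local h x) 0.

Definition circle_Cr_diffeo (R : realType) (r : option nat)
    (h : circle R -> circle R) : Prop :=
  exists h', [/\ cancel h h', cancel h' h, circle_Cr r h & circle_Cr r h'].

Definition homeomorphism (X Y : topologicalType) (h : X -> Y) : Prop :=
  exists h', [/\ cancel h h', cancel h' h, continuous h & continuous h'].

(* The derivative Dh(x) in the canonical trivialization of the tangent bundle;
   the transposition is because [jacobian] acts on row vectors. *)
Definition torus_D (R : realType) (h : torus2 R -> torus2 R)
    (x : torus2 R) : 'M[R]_2 :=
  (jacobian (torus_local h x) 0)^T.

(* For a C^1 diffeomorphism of the torus. *)
Definition orientation_preserving (R : realType) (h : torus2 R -> torus2 R) :
    Prop :=
  forall x, 0 < \det (torus_D h x).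

(* Rokhlin's Lebesgue spaces: phi, psi are mutually inverse isomorphisms mod 0
   between (Omega, P) and the sum of the interval [0, a] with Lebesgue measure
   and of atoms of mass w k placed at the points k + 2.  The last clause is the
   measurability of psi with respect to the completion of the Borel
   sigma-algebra, so that P itself may or may not be complete. *)
Definition lebesgue_space (R : realType) (d : measure_display)
    (Omega : measurableType d) (P : probability Omega R) : Prop :=
  exists (a : R) (w : nat -> R) (phi : Omega -> R) (psi : R -> Omega),
  let Q (B : set R) :=
    (lebesgue_measure (B `&` `[0%R, a]) +
     \sum_(0 <= k <oo) ((w k)%:E * \d_(k.+2%:R : R)%R B))%E in
  [/\ 0 <= a /\ (forall k, 0 <= w k),
      measurable_fun setT phi,
      forall B, measurable B -> P (phi @^-1` B) = Q B,
      {ae P, forall omega, psi (phi omega) = omega} &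
      forall A, measurable A -> exists B1 B2 : set R,
        [/\ measurable B1, measurable B2, B1 `<=` psi @^-1` A,
            psi @^-1` A `<=` B2 & Q (B2 `\` B1) = 0%E]].

Definition measure_preserving (R : realType) (d : measure_display)
    (X : measurableType d) (P : probability X R) (S : X -> X) : Prop :=
  measurable_fun setT S /\ forall A, measurable A -> P (S @^-1` A) = P A.

(* An automorphism mod 0. *)
Record automorphism (R : realType) (d : measure_display)
    (Omega : measurableType d) (P : probability Omega R) := Automorphism {
  aut_fun :> Omega -> Omega;
  aut_inv : Omega -> Omega;
  aut_fun_mp : measure_preserving P aut_fun;
  aut_inv_mp : measure_preserving P aut_inv;
  aut_funK : {ae P, forall omega, aut_inv (aut_fun omega) = omega};
  aut_invK : {ae P, forall omega, aut_fun (aut_inv omega) = omega} }.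

Definition aut_iter (R : realType) (d : measure_display)
    (Omega : measurableType d) (P : probability Omega R)
    (T : automorphism P) (n : int) : Omega -> Omega :=
  match n with
  | Posz m => iter m T
  | Negz m => iter m.+1 (aut_inv T)
  end.

Definition ergodic (R : realType) (d : measure_display)
    (X : measurableType d) (P : probability X R) (S : X -> X) : Prop :=
  forall A, measurable A -> S @^-1` A = A -> P A = 0%E \/ P A = 1%E.

Section random.
Variables (R : realType) (d : measure_display) (Omega : measurableType d).
Variable P : probability Omega R.
Implicit Types (T : automorphism P) (f g : int -> Omega -> torus2 R -> torus2 R).

(* C^r random dynamical systems on the 2-torus over (Omega, P, T);
   f n omega x stands for f^n_omega x.  As Z is discrete, joint measurability
   in (n, omega, x) is measurability in (omega, x) for every n. *)
Definition is_rds (r : option nat) T f : Prop :=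
  (forall n : int, measurable_fun setT
     (fun z : Omega * torus2 R => f n z.1 z.2)) /\
  {ae P, forall omega,
    [/\ f 0 omega = id,
        forall m n : int,
          f (m + n) omega = f m (aut_iter T n omega) \o f n omega &
        forall n : int, torus_Cr r (f n omega)]}.

Definition skew_map T f (z : Omega * torus2 R) : Omega * torus2 R :=
  (T z.1, f 1 z.1 z.2).

Definition invariant_measure T f
    (mu : probability (Omega * torus2 R)%type R) : Prop :=
  measure_preserving mu (skew_map T f) /\
  forall B, measurable B -> mu (B `*` setT) = P B.

Definition measure_support (m : {measure set (torus2 R) -> \bar R}) :
    set (torus2 R) :=
  [set x | forall U, open_nbhs x U -> (0 < m U)%E].

Definition disintegration (mu : probability (Omega * torus2 R)%type R)
    (k : R.-pker Omega ~> torus2 R) : Prop :=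
  forall A, measurable A -> mu A = (\int[P]_omega k omega (xsection A omega))%E.

Definition full_support (mu : probability (Omega * torus2 R)%type R) : Prop :=
  exists k : R.-pker Omega ~> torus2 R, disintegration mu k /\
    {ae P, forall omega, measure_support (k omega) = setT}.

Definition polynomial_growth (tau : R) f
    (mu : probability (Omega * torus2 R)%type R) : Prop :=
  exists g : Omega * torus2 R -> 'M[R]_2,
    {ae mu, forall z,
      (fun n : nat => (n%:R `^ (- tau)) *: torus_D (f n%:Z z.1) z.2) @ \oo
        --> g z} /\
    exists A, [/\ measurable A, (0 < mu A)%E & forall z, A z -> g z <> 0].

Definition algebraically_conjugate f g : Prop :=
  exists A : torus2 R -> torus2 R,
    [/\ {morph A : x y / x + y}, homeomorphism A &
        {ae P, forall omega, f 1 omega \o A = A \o g 1 omega}].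

Definition random_circle_map (F : Omega -> circle R -> circle R) : Prop :=
  measurable_fun setT (fun z : Omega * circle R => F z.1 z.2).

Definition random_circle_diffeo (r : option nat)
    (F : Omega -> circle R -> circle R) : Prop :=
  random_circle_map F /\ {ae P, forall omega, circle_Cr_diffeo r (F omega)}.

Definition random_circle_homeo (F : Omega -> circle R -> circle R) : Prop :=
  random_circle_map F /\ {ae P, forall omega, homeomorphism (F omega)}.

Definition random_torus_homeo (Theta : Omega -> torus2 R -> torus2 R) : Prop :=
  measurable_fun setT (fun z : Omega * torus2 R => Theta z.1 z.2) /\
  {ae P, forall omega, homeomorphism (Theta omega)}.

Definition topologically_conjugate T f g : Prop :=
  exists Theta, random_torus_homeo Theta /\
    {ae P, forall omega, Theta (T omega) \o f 1 omega = g 1 omega \o Theta omega}.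

(* f is generated by the skew products (x1, x2) |-> (F x1, x2 + phi x1). *)
Definition is_skew_product f (F phi : Omega -> circle R -> circle R) : Prop :=
  {ae P, forall omega, forall x1 x2 : circle R,
    f 1 omega (x1, x2) = (F omega x1, x2 + phi omega x1)}.

End random.

(* Main.v *)
(** Almost every orbit brings the derivative arbitrarily close to almost every
value that it takes, so one can pass to the limit in
[n^-tau D f^(n+1) = (D f o T_f^n) (n^-tau D f^n)] along suitable times and get
[D f(y) g(z) = g(z)] for almost all y and z.  A non-zero column of g is thus a
vector c independent of the point, and by full support it is fixed by every
derivative of f_omega; hence f_omega commutes with the translations along the
line R c.  If this line were irrational, Dirichlet approximations would give
arbitrarily small vertical translations commuting with f_omega, so the
derivative would be the identity everywhere and could not grow.  So c is
proportional to a primitive integer vector, and an element of SL_2(Z) mapping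
the vertical direction to it conjugates f to a skew product.

In a basis starting with c the derivative cocycle is triangular.  Comparing its
off-diagonal entry at the times n and 2n yields [2^tau = 2], hence tau = 1.

The projections of the disintegration mu_omega to the base circle are
equivariant under F and have full support.  They have no atoms: by ergodicity
almost every point would lie over an atom of mass at least some e > 0, and full
support would give infinitely many of these over a single omega.  Their
distribution functions are therefore random homeomorphisms, which conjugate the
orientation-preserving F_omega to rotations. *)

Require Import Defs.
From HB Require Import structures.
From mathcomp Require Import all_boot all_order all_algebra.
From mathcomp Require Import all_classical all_reals all_analysis.
From mathcomp Require Import measurable_realfun.
From mathcomp Require Import ring lra zify.
Import Order.TTheory GRing.Theory Num.Theory.
Import numFieldNormedType.Exports.
Local Open Scope classical_set_scope.
Local Open Scope ring_scope.
Set Implicit Arguments.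
Unset Strict Implicit.
Unset Printing Implicit Defensive.

(** * The circle *)

(** Two difficulties shape the proof. First, the growth hypothesis gives limits along orbits without
    any rate, while the point [S^n z] at which the cocycle is restarted moves with n. The exponent
    is therefore found by comparing limits in measure, not pointwise. Second, everything is known
    only almost everywhere, so each uncountable family of conditions is reduced to a countable one:
    rational boxes for the values of the derivative, rays with rational end for the measures on the
    circle, integers for the powers of T. In the other direction, a relation true almost everywhere
    becomes true at every point of a fibre by full support and the continuity of the derivative.

    The rotation numbers appear because the uniformizing map measures an arc by its mass. An
    orientation-preserving F_omega maps arcs to arcs and transports the mass, so the uniformized
    lengths of an arc and of its image agree. Hence the difference of [xi_(T omega)] at F_omega(x)
    and of [xi_omega] at x does not depend on x. *)

Section circle_group.
Variable R : realType.
Implicit Types (s t : R) (x y : circle R) (n : int).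

Lemma circle_expD s t : circle_exp (s + t) = circle_exp s + circle_exp t.
Proof. exact: (@Quotient.pi_add R (integers R)). Qed.

Lemma circle_expN t : circle_exp (- t) = - circle_exp t.
Proof. exact: (@Quotient.pi_opp R (integers R)). Qed.

Lemma circle_expB s t : circle_exp (s - t) = circle_exp s - circle_exp t.
Proof. by rewrite circle_expD circle_expN. Qed.

Lemma circle_exp0 : circle_exp 0 = 0 :> circle R.
Proof. by apply: (addrI (circle_exp 0)); rewrite -circle_expD !addr0. Qed.

Lemma circle_exp_eq s t :
  circle_exp s = circle_exp t <-> exists n, s = t + n%:~R.
Proof.
split.
  move=> /eqmodP /=; rewrite /Quotient.equiv => /intrP[n hn].
  by exists n; rewrite -hn addrC subrK.
move=> [n ->]; apply/eqmodP; rewrite /= /Quotient.equiv addrAC subrr add0r.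
exact: intr_int.
Qed.

Lemma circle_exp_int n : circle_exp n%:~R = 0 :> circle R.
Proof. by rewrite -circle_exp0; apply/circle_exp_eq; exists n; rewrite add0r. Qed.

Lemma circle_logK x : circle_exp (circle_log x) = x.
Proof.
rewrite /circle_log -[RHS](@reprK R {ideal_quot (integers R)} x).
by apply/circle_exp_eq; eexists (- _); rewrite rmorphN.
Qed.

Lemma circle_log_itv x : - 2^-1 <= circle_log x < 2^-1.
Proof.
rewrite /circle_log; set t := repr _.
have /andP[] := Num.Theory.floor_itv (t + 2^-1).
rewrite intrD1 => h1 h2; lra.
Qed.

Lemma circle_expK t : - 2^-1 <= t < 2^-1 -> circle_log (circle_exp t) = t.
Proof.
move=> ht; have := circle_log_itv (circle_exp t).
have /circle_exp_eq[n ->] := circle_logK (circle_exp t).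
move=> hn; suff -> : n = 0 by rewrite addr0.
have : (n%:~R : R) < 1 by lra.
have : (- 1 : R) < n%:~R by lra.
by rewrite -(intrN _ 1) !ltr_int ltrz1; lia.
Qed.

Lemma circle_expMz t n : circle_exp (t *~ n) = circle_exp t *~ n.
Proof.
have expMn k : circle_exp (t *+ k) = circle_exp t *+ k.
  by elim: k => [|k IHk]; rewrite ?circle_exp0 // !mulrS circle_expD IHk.
by case: n => k; rewrite ?NegzE ?mulrNz ?circle_expN -!pmulrn expMn.
Qed.

End circle_group.

Lemma near0_norm_lt (R : realType) (V : normedModType R) (e : R) :
  0 < e -> \forall v \near (0 : V), `|v| < e.
Proof. by move=> e0; apply/nbhs_norm0P; exists e. Qed.

(** * Topology of the circle *)

Section circle_topology.
Variable R : realType.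
Implicit Types (s t : R) (x y : circle R) (A : set (circle R)).

Lemma circle_openE A : open A = open (@circle_exp R @^-1` A).
Proof. by []. Qed.

Lemma continuous_circle_exp : continuous (@circle_exp R).
Proof. by apply/continuousP => A; rewrite circle_openE. Qed.

Lemma open_circle_exp (U : set R) : open U -> open (@circle_exp R @` U).
Proof.
move=> oU; rewrite circle_openE.
rewrite (_ : _ @^-1` _ = \bigcup_(n : int) ((fun t => t + n%:~R) @^-1` U)).
  apply: bigcup_open => n _; apply: open_comp => // t _.
  exact: cvgD (@cvg_id _ _) (@cvg_cst _ _ _ _ _).
apply/seteqP; split => [t [s Us] /circle_exp_eq[n h]|t [n _ Ut]] /=.
  by exists n => //=; rewrite -h.
by exists (t + n%:~R) => //; apply/circle_exp_eq; exists n.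
Qed.

(** The projection from [R] is continuous and open. This form turns every limit on the circle into a
    limit at 0 in [R]. *)
Lemma nbhs_circle x : nbhs x = (fun t => x + circle_exp t) @ (0 : R).
Proof.
apply/seteqP; split => A.
  have : (fun t => x + circle_exp t) @ (0 : R) --> x; last exact.
  rewrite (_ : (fun _ => _) = @circle_exp R \o (fun t => circle_log x + t)); last first.
    by apply/funext => t; rewrite /= circle_expD circle_logK.
  rewrite -[X in _ --> X]circle_logK -[X in circle_exp X]addr0.
  apply: continuous_comp; last exact: continuous_circle_exp.
  exact: cvgD (@cvg_cst _ _ _ _ _) (@cvg_id _ _).
move=> [e /= e0 eA].
rewrite nbhsE /=; exists (@circle_exp R @` ball (circle_log x) e).
  split; first by apply: open_circle_exp; exact: ball_open.
  by exists (circle_log x); [exact: ballxx|exact: circle_logK].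
move=> _ [t xt <-].
rewrite (_ : circle_exp t = x + circle_exp (t - circle_log x)).
  apply: eA; move: xt; rewrite /ball /= sub0r normrN => xt.
  by rewrite distrC.
by rewrite circle_expB circle_logK addrCA subrr addr0.
Qed.

Lemma circle_log_continuous x :
  circle_log x != - 2^-1 -> {for x, continuous (@circle_log R)}.
Proof.
move=> xh; change (@circle_log R @ x --> circle_log x); rewrite nbhs_circle.
have hx : - 2^-1 < circle_log x < 2^-1.
  by rewrite lt_neqAle eq_sym xh; have := circle_log_itv x; case/andP => -> ->.
apply: (@cvg_trans _ ((fun t => circle_log x + t) @ (0 : R))); last first.
  suff : circle_log x + t @[t --> 0] --> circle_log x + 0 by rewrite addr0.
  exact: cvgD (@cvg_cst _ _ _ _ _) (@cvg_id _ _).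
apply: (@near_eq_cvg _ _ (nbhs (0 : R)) _
  (fun t => circle_log x + t) (fun t => circle_log (x + circle_exp t))).
have e0 : 0 < Num.min (circle_log x + 2^-1) (2^-1 - circle_log x).
  by rewrite lt_min; lra.
near=> t.
rewrite -[X in circle_log (X + _)]circle_logK -circle_expD; rewrite circle_expK //.
have : `|t| < Num.min (circle_log x + 2^-1) (2^-1 - circle_log x).
  near: t. exact: (@near0_norm_lt R R^o).
by rewrite lt_min !ltr_norml; lra.
Unshelve. all: by end_near. Qed.

Lemma circle_log0 : circle_log (0 : circle R) = 0.
Proof. by rewrite -circle_exp0 circle_expK //; lra. Qed.

Lemma circle_hausdorff : hausdorff_space (circle R).
Proof.
move=> x y; rewrite /cluster /= !nbhs_circle => xy.
apply/eqP; rewrite -subr_eq0; apply/eqP; rewrite -[LHS]circle_logK.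
rewrite -circle_exp0; congr circle_exp; apply/eqP; apply/negP => /negP d0.
(* If the arcs of radius [e] about [x] and [y] met, [x - y] would have a representative smaller than
   [2 * e]. A representative that small is the one chosen by [circle_log], whose size is exactly
   [2 * e]. *)
pose e := `|circle_log (x - y)| / 2.
have e0 : 0 < e by rewrite divr_gt0 ?normr_gt0.
have N z : ((fun t => z + circle_exp t) @ (0 : R))
    [set z + circle_exp t | t in [set t | `|t| < e]].
  by apply: filterS (@near0_norm_lt R R^o _ e0) => t te; exists t.
have [z [[s /= se <-] [t /= te st]]] := xy _ _ (N x) (N y).
have xyE : x - y = circle_exp (t - s).
  by rewrite circle_expB -(addrK (circle_exp s) x) -st -(addrA y) (addrC y) addrK.
have := circle_log_itv (x - y); rewrite /e in se te => dh.
have d2 : `|circle_log (x - y)| <= 2^-1 by rewrite ler_norml; lra.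
have ts : `|t - s| < `|circle_log (x - y)|.
  by apply: (le_lt_trans (ler_normB _ _)); lra.
move: (ts); rewrite xyE circle_expK ?ltxx //.
by move: (lt_le_trans ts d2); rewrite ltr_norml; lra.
Unshelve. all: by end_near. Qed.

Lemma circle_compact : compact [set: circle R].
Proof.
rewrite (_ : setT = @circle_exp R @` `[0, 1]).
  apply: continuous_compact; last exact: segment_compact.
  by apply: continuous_subspaceT; exact: continuous_circle_exp.
apply/seteqP; split => // x _.
have hx := circle_log_itv x.
have [x0|x0] := leP 0 (circle_log x).
  by exists (circle_log x); rewrite ?circle_logK //= in_itv /=; lra.
exists (circle_log x + 1); first by rewrite /= in_itv /=; lra.
by rewrite circle_expD circle_logK -[1]/(1%:~R) circle_exp_int addr0.
Qed.

End circle_topology.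

(** * Borel measurability on the circle *)

Section circle_measurable.
Variable R : realType.
Local Notation exp := (@circle_exp R).
Local Notation log := (@circle_log R).

Lemma open_circle_measurable (A : set (circle R)) : open A -> measurable A.
Proof. by move=> oA; exact: sub_sigma_algebra. Qed.

Lemma measurable_circle_exp : measurable_fun setT exp.
Proof.
apply: (measurability (@open (circle R))) => //.
move=> _ [A oA <-]; rewrite setTI; apply: open_measurable.
by apply: open_comp => // t _; exact: continuous_circle_exp.
Qed.

(** The only jump is at the point opposite to 0, where the lower value is taken. So [circle_log] is
    lower semicontinuous and its sets [> a] are open. *)
Lemma measurable_circle_log : measurable_fun setT log.
Proof.
apply: (measurability _ (RGenOInfty.measurableE R)) => _ [_ [a ->] <-].
rewrite setTI; apply: open_circle_measurable.
have [a2|a2] := ltP a (- 2^-1).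
  rewrite (_ : _ @^-1` _ = setT); first exact: openT.
  apply/seteqP; split => // x _ /=; rewrite in_itv /= andbT.
  by have := circle_log_itv x; lra.
rewrite (_ : _ @^-1` _ = exp @` `]a, 2^-1[).
  by apply: open_circle_exp; exact: interval_open.
apply/seteqP; split => [x|_ [t ta <-]] /=; rewrite in_itv /= andbT.
  move=> xa; exists (log x); last exact: circle_logK.
  by rewrite /= in_itv /=; have := circle_log_itv x; lra.
by move: ta; rewrite /= in_itv /= => ta; rewrite circle_expK; lra.
Qed.

Lemma measurable_circleD d (X : measurableType d) (f g : X -> circle R) :
  measurable_fun setT f -> measurable_fun setT g ->
  measurable_fun setT (fun x => f x + g x).
Proof.
move=> mf mg; rewrite (_ : (fun _ => _) =
    exp \o (fun x => log (f x) + log (g x))); last first.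
  by apply/funext => x /=; rewrite circle_expD !circle_logK.
apply: measurableT_comp; first exact: measurable_circle_exp.
by apply: measurable_funD; apply: measurableT_comp => //;
  exact: measurable_circle_log.
Qed.

Lemma measurable_circleMz d (X : measurableType d) (f : X -> circle R) (n : int) :
  measurable_fun setT f -> measurable_fun setT (fun x => f x *~ n).
Proof.
move=> mf; rewrite (_ : (fun _ => _) = exp \o (fun x => n%:~R * log (f x))).
  apply: measurableT_comp; first exact: measurable_circle_exp.
  apply: measurable_funM => //.
  by apply: measurableT_comp => //; exact: measurable_circle_log.
by apply/funext => x /=; rewrite mulrzl circle_expMz circle_logK.
Qed.

End circle_measurable.

(** * Maps of the torus in charts *)

Section germs.
Variable R : realType.
Implicit Types V W : normedModType R.

(** The differential is defined by choice, so a witness must be produced for [g]. The differential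
    of [f] serves, because both remainders have the same germ at [x]. *)
Lemma near_eq_differentiable V W (f g : V -> W) (x : V) :
  {near x, f =1 g} -> differentiable f x -> differentiable g x.
Proof.
move=> fg dfx; apply/diffP.
apply: (@getPex _ (fun df : {linear V -> W} => continuous df /\
  forall y, g y = g (lim (nbhs x)) + df (y - lim (nbhs x))
    +o_(y \near x) (y - lim (nbhs x)))).
exists ('d f x); split; first exact: diff_continuous.
suff /eqaddoP gE : forall e, 0 < e -> \forall y \near x,
    `|(g - (fun y => g (lim (nbhs x)) + 'd f x (y - lim (nbhs x)))) y| <=
    e * `|y - lim (nbhs x)|.
  by move=> y; rewrite [LHS](congr1 (fun h => h y) gE).
move=> e e0.
have := diffE dfx; rewrite lim_id //; set o := the_littleo _ _ _ _ _ => fE.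
have fgx := nbhs_singleton fg.
have := littleoP [littleo of o] e0; apply: filterS2 fg => y fgy.
have -> : (g - (fun y => g x + 'd f x (y - x))) y = o y.
  by rewrite -[LHS]/(g y - (g x + 'd f x (y - x))) -fgy -fgx fE addrC addKr.
by [].
Unshelve. all: by end_near.
Qed.

Lemma near_eq_Ck V W k (f g : V -> W) (x : V) :
  {near x, f =1 g} -> Ck_near k f x -> Ck_near k g x.
Proof.
(* [near_join] yields equal germs at all points near [x], as [Ck_near] constrains the maps there and
   not only at [x]. *)
elim: k f g => [|k IHk] f g /near_join fg /=.
  apply: filterS2 fg => y fgy cf; change (g @ y --> g y).
  rewrite -(nbhs_singleton fgy); apply: cvg_trans cf.
  by apply: near_eq_cvg; apply: filterS fgy.
move=> [df Df]; split.
  by apply: filterS2 fg df => y; exact: near_eq_differentiable.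
move=> v; apply: IHk (Df v); near=> y; apply: near_eq_derive.
by near: y.
Unshelve. all: by end_near. Qed.

(** The derivative of [L \o h \o M] along [v] is [L \o 'D_(M v) h \o M], a map of the same shape, so
    the induction on [k] closes. *)
Lemma Ck_linear V V' W W' (L : {linear W -> W'}) (M : {linear V' -> V}) k
    (h : V -> W) (x : V') :
  continuous L -> continuous M ->
  Ck_near k h (M x) -> Ck_near k (L \o h \o M) x.
Proof.
move=> cL cM; elim: k h => [|k IHk] h /=.
  move=> /(cM x) H; apply: (@filterS _ (nbhs x) _ _ _ _ H) => y hy.
  apply: (@continuous_comp _ _ _ M (L \o h)); first exact: cM.
  by apply: continuous_comp => //; exact: cL.
have dL y : differentiable L y by apply: linear_differentiable.
have dM y : differentiable M y by apply: linear_differentiable.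
move=> [dh Dh]; split.
  move/(cM x): dh => H; apply: (@filterS _ (nbhs x) _ _ _ _ H) => y hy.
  apply: (differentiable_comp (g := L \o h) (dM y)).
  exact: (differentiable_comp (g := L) hy (dL _)).
move=> v; apply: near_eq_Ck (IHk _ (Dh (M v))).
move/(cM x): dh => H; apply: (@filterS _ (nbhs x) _ _ _ _ H) => y hy /=.
have dLh : differentiable (L \o h) (M y).
  exact: (differentiable_comp (g := L) hy (dL _)).
rewrite (deriveE _ hy) (deriveE _ (differentiable_comp (dM y) dLh)).
rewrite (diff_comp (dM y) dLh) (diff_comp hy (dL _)) /=.
by rewrite (diff_lin y cM) (diff_lin _ cL).
Qed.

End germs.

Section torus_charts.
Variable R : realType.
Implicit Types (v w : 'rV[R]_2) (x y : torus2 R) (h : torus2 R -> torus2 R).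
Local Notation i0 := (ord0 : 'I_2).
Local Notation i1 := (ord_max : 'I_2).

Definition rv2 (a b : R) : 'rV[R]_2 := \row_j (if j == ord0 then a else b).

Lemma rv2E0 a b : rv2 a b ord0 i0 = a. Proof. by rewrite mxE. Qed.

Lemma rv2E1 a b : rv2 a b ord0 i1 = b. Proof. by rewrite mxE. Qed.

Lemma rv2_eta v : v = rv2 (v ord0 i0) (v ord0 i1).
Proof.
apply/rowP => j; rewrite mxE; case: (unliftP ord0 j) => [k|] -> //=.
by congr (v _ _); apply/val_inj; case: k => [[|]].
Qed.

Lemma rv2P v w : v ord0 i0 = w ord0 i0 -> v ord0 i1 = w ord0 i1 -> v = w.
Proof. by rewrite [v]rv2_eta [w]rv2_eta !rv2E0 !rv2E1 => -> ->. Qed.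

Lemma near_rv2 (P : R -> R -> Prop) v :
  (\forall a \near v ord0 i0 & b \near v ord0 i1, P a b) ->
  \forall w \near v, P ((w : 'rV[R]_2) ord0 i0) (w ord0 i1).
Proof.
move=> [[A B] /= [nA nB] AB].
apply: (@filterS2 _ (nbhs v) _ _ _ _ _ (@coord_continuous R _ _ ord0 i0 v A nA)
  (@coord_continuous R _ _ ord0 i1 v B nB)) => w ? ?.
exact: (AB (_, _)).
Qed.

Lemma cvg_rv2 (T : Type) (F : set_system T) (FF : Filter F) (f g : T -> R) a b :
  f @ F --> a -> g @ F --> b -> (fun t => rv2 (f t) (g t)) @ F --> rv2 a b.
Proof.
move=> fa gb A [B nB BA].
have nB0 := nB ord0 i0; have nB1 := nB ord0 i1; rewrite rv2E0 in nB0; rewrite rv2E1 in nB1.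
apply: (@filterS2 _ F _ _ _ _ _ (fa _ nB0) (gb _ nB1)) => t ? ?; apply: BA => i j; rewrite ord1 mxE.
case: (unliftP ord0 j) => [k|] -> //=.
by rewrite (_ : lift _ _ = i1) //; apply/val_inj; case: k => [[|]].
Qed.

Lemma torus_expD v w : torus_exp (v + w) = torus_exp v + torus_exp w.
Proof. by rewrite /torus_exp !mxE !circle_expD. Qed.

Lemma torus_expN v : torus_exp (- v) = - torus_exp v.
Proof. by rewrite /torus_exp !mxE !circle_expN. Qed.

Lemma torus_expB v w : torus_exp (v - w) = torus_exp v - torus_exp w.
Proof. by rewrite torus_expD torus_expN. Qed.

Lemma torus_exp0 : torus_exp 0 = 0 :> torus2 R.
Proof. by rewrite /torus_exp !mxE circle_exp0. Qed.

Lemma torus_logK x : torus_exp (torus_log x) = x.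
Proof. by case: x => a b; rewrite /torus_exp rv2E0 rv2E1 !circle_logK. Qed.

Lemma norm_rv2_lt v e : 0 < e ->
  (`|v| < e) = (`|v ord0 i0| < e) && (`|v ord0 i1| < e).
Proof.
move=> e0; rewrite /Num.norm /= mx_normrE.
apply/idP/andP => [/bigmax_ltP [_ /= h]|[h0 h1]].
  by split; [exact: (h (ord0, i0))|exact: (h (ord0, i1))].
apply/bigmax_ltP; split => // -[i j] _ /=; rewrite ord1.
case: (unliftP ord0 j) => [k|] -> //=.
by rewrite (_ : lift _ _ = i1) //; apply/val_inj; case: k => [[|]].
Qed.

Lemma torus_expK v : `|v| < 2^-1 -> torus_log (torus_exp v) = v.
Proof.
rewrite norm_rv2_lt; last lra.
rewrite !ltr_norml => /andP[h0 h1].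
by apply: rv2P; rewrite !mxE /= circle_expK //; lra.
Qed.

Lemma torus_log0 : torus_log (0 : torus2 R) = 0.
Proof. by rewrite -torus_exp0 torus_expK // normr0; lra. Qed.

Lemma nbhs_torus x : nbhs x = (fun v => x + torus_exp v) @ (0 : 'rV[R]_2).
Proof.
apply/seteqP; split => A.
  move=> [[B C] /=]; rewrite !nbhs_circle => -[nB nC] BCA.
  apply: (@near_rv2
    (fun a b => A (x.1 + circle_exp a, x.2 + circle_exp b)) 0).
  rewrite !mxE; exists ([set t | B (x.1 + circle_exp t)],
    [set t | C (x.2 + circle_exp t)]); first by split; [exact: nB|exact: nC].
  by move=> [a b] /= [Ba Cb]; exact: (BCA (_, _)).
move=> [P nP PA]; exists ((fun s => x.1 + circle_exp s) @` P ord0 i0,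
    (fun s => x.2 + circle_exp s) @` P ord0 i1).
  have := nP ord0 i0; have := nP ord0 i1; rewrite !mxE => n1 n0.
  by split; rewrite nbhs_circle; [apply: filterS n0|apply: filterS n1] => t; exists t.
move=> [a b] /= [[s Ps <-] [t Pt <-]].
rewrite (_ : (_, _) = x + torus_exp (rv2 s t)); last first.
  by rewrite /torus_exp rv2E0 rv2E1.
apply: PA => i j; rewrite ord1 mxE.
case: (unliftP ord0 j) => [k|] -> //=.
by rewrite (_ : lift _ _ = i1) //; apply/val_inj; case: k => [[|]].
Qed.

Lemma torus_log0_continuous : {for 0, continuous (@torus_log R)}.
Proof.
change (@torus_log R @ (0 : torus2 R) --> torus_log (0 : torus2 R)).
rewrite nbhs_torus torus_log0 => A nA.
have n0 := @near0_norm_lt R 'rV[R]_2 2^-1 ltac:(lra).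
change (nbhs (0 : 'rV[R]_2) (fun v => A (torus_log (0 + torus_exp v)))).
apply: filterS2 n0 nA => v vh Av.
by rewrite add0r torus_expK.
Qed.

Lemma torus_localE h x v :
  torus_exp (torus_local h x v) = h (x + torus_exp v) - h x.
Proof. exact: torus_logK. Qed.

Lemma torus_local_exp h x v :
  h (x + torus_exp v) = h x + torus_exp (torus_local h x v).
Proof. by rewrite torus_localE subrKC. Qed.

Lemma torus_local0 h x : torus_local h x 0 = 0.
Proof. by rewrite /torus_local torus_exp0 addr0 subrr torus_log0. Qed.

Lemma torus_local_comp h1 h2 x :
  torus_local (h2 \o h1) x = torus_local h2 (h1 x) \o torus_local h1 x.
Proof.
by apply/funext => v; rewrite /= {1}/torus_local /= torus_local_exp.
Qed.

Lemma torus_local_id x : \forall v \near (0 : 'rV[R]_2), torus_local id x v = v.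
Proof.
have h0 : 0 < 2^-1 :> R by lra.
apply: filterS (@near0_norm_lt R 'rV[R]_2 _ h0) => v vh.
by rewrite /torus_local addrAC subrr add0r torus_expK.
Qed.

Lemma torus_continuous_local h x :
  {for x, continuous h} <-> {for 0, continuous (torus_local h x)}.
Proof.
split => hx.
- change (torus_local h x @ (0 : 'rV[R]_2) --> torus_local h x 0).
  rewrite torus_local0 => A nA0.
  have nA : nbhs (0 : torus2 R) [set y | A (torus_log y)].
    by have := @torus_log0_continuous A; rewrite torus_log0; apply.
  have : nbhs (h x) [set y | A (torus_log (y - h x))].
    rewrite nbhs_torus in nA; rewrite nbhs_torus.
    apply: (@filterS _ (nbhs (0 : 'rV[R]_2)) _ _ _ _ nA) => v /=.
    by rewrite add0r addrAC subrr add0r.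
  move/hx => nhx.
  suff : nbhs x [set y | A (torus_log (h y - h x))] by rewrite nbhs_torus.
  exact: nhx.
- change (h @ x --> h x).
  rewrite !nbhs_torus => A nA.
  have : nbhs (torus_local h x 0) [set v | A (h x + torus_exp v)].
    by rewrite torus_local0.
  move/hx => nhA; apply: (@filterS _ (nbhs (0 : 'rV[R]_2)) _ _ _ _ nhA) => v /=.
  by rewrite -torus_local_exp.
Qed.

End torus_charts.

Lemma derive_translate (R : realType) (V W : normedModType R) (f : V -> W) v c :
  'D_c (fun w => f (v + w) - f v) 0 = 'D_c f v.
Proof.
rewrite /derive; set d := (fun _ : R => _); set d' := (fun _ : R => _).
suff -> : d = d' by [].
by apply/funext => t; rewrite /d /d' /= !addr0 subrr subr0 (addrC v).
Qed.

(** * Derivatives of torus maps and changes of chart *)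

Section torus_maps.
Variable R : realType.
Implicit Types (v w : 'rV[R]_2) (x y : torus2 R) (h : torus2 R -> torus2 R).
Implicit Types (r : option nat) (M N : 'M[R]_2).

Lemma le_reg0 r : le_reg 0 r. Proof. by case: r. Qed.

Lemma torus_Cr_continuous_local r h x :
  torus_Cr r h -> {for 0, continuous (torus_local h x)}.
Proof. by move=> /(_ _ (le_reg0 r) x)/nbhs_singleton. Qed.

Lemma torus_Cr_continuous r h : torus_Cr r h -> continuous h.
Proof.
move=> hr x; apply: (torus_continuous_local h x).2. exact: (torus_Cr_continuous_local hr).
Qed.

(** Chart maps at neighbouring points differ by translations. Derivatives of [h] near [x] can thus
    all be read in the single chart at [x], where regularity is expressed. *)
Lemma torus_local_chart h x : {for 0, continuous (torus_local h x)} ->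
  \forall v \near (0 : 'rV[R]_2), \forall w \near (0 : 'rV[R]_2),
    torus_local h (x + torus_exp v) w =
    torus_local h x (v + w) - torus_local h x v.
Proof.
(* Two vectors of norm below 1/4 differ by less than 1/2, the range in which [torus_log] inverts
   [torus_exp]. *)
move=> hx; have q0 : 0 < 4^-1 :> R by lra.
have : \forall v \near (0 : 'rV[R]_2), `|torus_local h x v| < 4^-1.
  have := @near0_norm_lt R 'rV[R]_2 _ q0.
  by rewrite -{1}(torus_local0 h x) => /hx H; exact: H.
move=> /near_join H; apply: (@filterS _ (nbhs (0 : 'rV[R]_2)) _ _ _ _ H) => v nv.
have hv := nbhs_singleton nv.
have /nbhs0P : nbhs v [set u | `|torus_local h x u| < 4^-1] by [].
apply: filterS => w /= hw; rewrite {1}/torus_local.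
have -> : h (x + torus_exp v + torus_exp w) - h (x + torus_exp v) =
    torus_exp (torus_local h x (v + w) - torus_local h x v).
  by rewrite torus_expB !torus_localE -addrA -torus_expD opprB addrA subrK.
rewrite torus_expK //; apply: (le_lt_trans (ler_normB _ _)).
by rewrite (lt_le_trans (ltrD hw hv)) //; lra.
Qed.

Lemma derive_local_chart h x : {for 0, continuous (torus_local h x)} ->
  \forall v \near (0 : 'rV[R]_2), forall c,
    'D_c (torus_local h (x + torus_exp v)) 0 = 'D_c (torus_local h x) v.
Proof.
move=> /torus_local_chart H.
apply: (@filterS _ (nbhs (0 : 'rV[R]_2)) _ _ _ _ H) => v nv c.
by rewrite (near_eq_derive _ nv) derive_translate.
Qed.

(** The class asks for continuity of the chart map on a whole neighbourhood of 0, hence the change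
    of chart. It serves for the final system, which is conjugate to f only by homeomorphisms. *)
Lemma continuous_torus_Cr0 h : continuous h -> torus_Cr (Some 0%N) h.
Proof.
move=> hc [|//] _ x /=.
have := torus_local_chart ((torus_continuous_local h x).1 (hc x)).
apply: filterS => v nv; change {for v, continuous (torus_local h x)}.
rewrite continuous_shift.
have hv := (torus_continuous_local h (x + torus_exp v)).1 (hc _).
change ((torus_local h x \o shift v) @ (0 : 'rV[R]_2) -->
  torus_local h x (0 + v)); rewrite add0r.
have : torus_local h (x + torus_exp v) w + torus_local h x v @[w --> (0 : 'rV[R]_2)] -->
    torus_local h (x + torus_exp v) 0 + torus_local h x v.
  have hv' : torus_local h (x + torus_exp v) @ (0 : 'rV[R]_2) -->
    torus_local h (x + torus_exp v) 0 by exact: hv.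
  exact: (cvgD hv' (@cvg_cst _ _ _ _ _)).
rewrite torus_local0 add0r; apply: cvg_trans.
apply: (@near_eq_cvg _ _ (nbhs (0 : 'rV[R]_2)) _
  (fun w => torus_local h (x + torus_exp v) w + torus_local h x v)).
apply: (@filterS _ (nbhs (0 : 'rV[R]_2)) _ _ _ _ nv) => w ->.
by rewrite /= subrK addrC.
Qed.

Lemma torus_D_derive h x v : differentiable (torus_local h x) 0 ->
  ('D_v (torus_local h x) 0)^T = torus_D h x *m v^T.
Proof. by move=> dh; rewrite deriveEjacobian // trmx_mul. Qed.

Lemma torus_Cr_differentiable r h x : le_reg 1 r -> torus_Cr r h ->
  differentiable (torus_local h x) 0.
Proof. by move=> r1 /(_ _ r1 x)[/nbhs_singleton]. Qed.

Lemma jacobian_comp (f g : 'rV[R]_2 -> 'rV[R]_2) v :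
  differentiable f v -> differentiable g (f v) ->
  jacobian (g \o f) v = jacobian f v *m jacobian g (f v).
Proof.
move=> df dg; have dgf := differentiable_comp df dg.
apply/row_matrixP => i; rewrite !rowE mulmxA; set e := delta_mx _ _.
transitivity ('D_e (g \o f) v); first exact/esym/deriveEjacobian.
transitivity ('D_('D_e f v) g (f v)).
  rewrite (deriveE _ dgf) (deriveE _ dg) (deriveE _ df).
  exact: (congr1 (fun F => F e) (diff_comp df dg)).
rewrite (deriveEjacobian _ dg); congr (_ *m _); exact: deriveEjacobian.
Qed.

Lemma torus_D_comp h1 h2 x :
  differentiable (torus_local h1 x) 0 ->
  differentiable (torus_local h2 (h1 x)) 0 ->
  torus_D (h2 \o h1) x = torus_D h2 (h1 x) *m torus_D h1 x.
Proof.
move=> d1 d2; rewrite /torus_D torus_local_comp -trmx_mul; congr trmx.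
have eq_diff (y z : 'rV[R]_2) (g : 'rV[R]_2 -> 'rV[R]_2) :
  y = z -> differentiable g y -> differentiable g z by move=> ->.
have d2' := eq_diff _ _ _ (esym (torus_local0 h1 x)) d2.
rewrite (jacobian_comp d1 d2'); congr (_ *m jacobian _ _).
exact: torus_local0.
Qed.

Lemma torus_D_id x : torus_D id x = 1%:M.
Proof.
rewrite /torus_D; suff -> : jacobian (torus_local id x) 0 = 1%:M.
  by rewrite trmx1.
apply/row_matrixP => i; rewrite !rowE mulmx1.
have idn : {near (0 : 'rV[R]_2), id =1 torus_local id x}.
  by apply: filterS (torus_local_id x).
rewrite -deriveEjacobian; last exact: near_eq_differentiable idn _.
by rewrite -(near_eq_derive _ idn) derive_id.
Qed.

Lemma mulmx_rv2 v M j :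
  (v *m M) ord0 j = v ord0 ord0 * M ord0 j + v ord0 ord_max * M ord_max j.
Proof.
rewrite mxE !big_ord_recl big_ord0 addr0.
by rewrite (_ : lift ord0 ord0 = ord_max) //; apply/val_inj.
Qed.

Lemma continuous_mulmxr M : continuous (mulmxr M : 'rV[R]_2 -> 'rV[R]_2).
Proof.
move=> v; change ((fun w : 'rV[R]_2 => w *m M) @ v --> v *m M).
rewrite [X in _ --> X]rv2_eta.
have -> : (fun w : 'rV[R]_2 => w *m M) =
    fun w => rv2 ((w *m M) ord0 ord0) ((w *m M) ord0 ord_max).
  by apply/funext => w; exact: rv2_eta.
have coordM j : (w *m M) ord0 j @[w --> v] --> (v *m M) ord0 j.
  have -> : (fun w : 'rV[R]_2 => (w *m M) ord0 j) =
      fun w => w ord0 ord0 * M ord0 j + w ord0 ord_max * M ord_max j.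
    by apply/funext => w; exact: mulmx_rv2.
  rewrite mulmx_rv2.
  have c k : (fun w : 'rV[R]_2 => w ord0 k) @ v --> v ord0 k.
    exact: (@coord_continuous R 1 2 ord0 k v).
  exact: (cvgD (cvgMr_tmp (b := _) (c _)) (cvgMr_tmp (b := _) (c _))).
exact: (cvg_rv2 _ (coordM _) (coordM _)).
Qed.

Definition torus_linear (A : torus2 R -> torus2 R) M :=
  {morph A : x y / x + y} /\ forall v, A (torus_exp v) = torus_exp (v *m M).

Lemma torus_linear_local A M x : torus_linear A M ->
  \forall v \near (0 : 'rV[R]_2), torus_local A x v = v *m M.
Proof.
move=> [AD AM]; have h0 : 0 < 2^-1 :> R by lra.
have H : \forall v \near (0 : 'rV[R]_2), `|v *m M| < 2^-1.
  have := @near0_norm_lt R 'rV[R]_2 _ h0.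
  by rewrite -{1}(mul0mx _ M) => /(@continuous_mulmxr M) H; exact: H.
apply: (@filterS _ (nbhs (0 : 'rV[R]_2)) _ _ _ _ H) => v vM.
by rewrite /torus_local AD addrAC subrr add0r AM torus_expK.
Qed.

Lemma torus_linear_D A M x : torus_linear A M ->
  differentiable (torus_local A x) 0 /\ torus_D A x = M^T.
Proof.
move=> /(torus_linear_local x) nA.
have nA' : {near (0 : 'rV[R]_2), mulmxr M =1 torus_local A x}.
  by apply: filterS nA.
have dA : differentiable (mulmxr M) (0 : 'rV[R]_2).
  by apply: linear_differentiable; exact: continuous_mulmxr.
have dA' := near_eq_differentiable nA' dA.
split => //; congr trmx; apply/row_matrixP => i; rewrite !rowE.
rewrite -deriveEjacobian // -(near_eq_derive _ nA') deriveE // diff_lin //.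
exact: continuous_mulmxr.
Qed.

Lemma torus_linear_continuous A M : torus_linear A M -> continuous A.
Proof.
move=> AM x; apply/torus_continuous_local; apply: differentiable_continuous.
by have [] := torus_linear_D x AM.
Qed.

Lemma torus_Cr_conj r h A B M N : torus_linear A M -> torus_linear B N ->
  torus_Cr r h -> torus_Cr r (B \o h \o A).
Proof.
move=> AM BN hr k kr x.
have hk := hr k kr (A x).
have := @Ck_linear _ _ _ _ _ (mulmxr N) (mulmxr M) k (torus_local h (A x)) 0
  (@continuous_mulmxr N) (@continuous_mulmxr M).
rewrite /= mul0mx => /(_ hk); apply: near_eq_Ck.
have h0 : 0 < 2^-1 :> R by lra.
have nM := torus_linear_local x AM.
have nN := torus_linear_local (h (A x)) BN.
have ch : torus_local h (A x) @ (0 : 'rV[R]_2) --> torus_local h (A x) 0.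
  exact: (torus_Cr_continuous_local hr).
rewrite torus_local0 in ch; move/ch in nN.
have cM : (mulmxr M : 'rV[R]_2 -> 'rV[R]_2) @ (0 : 'rV[R]_2) --> 0 *m M.
  exact: continuous_mulmxr.
rewrite mul0mx in cM; move/cM in nN.
apply: (@filterS2 _ (nbhs (0 : 'rV[R]_2)) _ _ _ _ _ nM nN) => v /= vM vN.
by rewrite torus_local_comp /= torus_local_comp /= vM vN.
Qed.

(** In charts this map is the inclusion of the first axis, then the chart map of [h], then the first
    coordinate, so [Ck_linear] applies. It serves for the base map and for its inverse. *)
Lemma circle_Cr_fst r h : torus_Cr r h -> circle_Cr r (fun a => (h (a, 0)).1).
Proof.
move=> hr k kr a.
have lin_f : linear (fun t : R^o => rv2 t 0).
  by move=> u s t; apply: rv2P; rewrite !mxE //= mulr0 addr0.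
have lin_g : linear (fun v : 'rV[R]_2 => v ord0 ord0 : R^o).
  by move=> u s t; rewrite !mxE.
pose fL := GRing.isLinear.Build _ _ _ _ _ lin_f.
pose gL := GRing.isLinear.Build _ _ _ _ _ lin_g.
pose f : {linear _ -> _} := HB.pack (fun t : R^o => rv2 t 0) fL.
pose g : {linear _ -> _} := HB.pack (fun v : 'rV[R]_2 => v ord0 ord0 : R^o) gL.
have := @Ck_linear _ _ _ _ _ g f k (torus_local h (a, 0)) 0.
rewrite (_ : circle_local _ a = g \o torus_local h (a, 0) \o f).
  apply.
  - by move=> v; exact: (@coord_continuous R 1 2 ord0 ord0 v).
  - move=> t; apply: (cvg_rv2 _ (@cvg_id _ _) (@cvg_cst _ _ _ _ _)).
  - rewrite /= (_ : rv2 0 0 = 0); first exact: hr.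
    by apply: rv2P; rewrite !mxE.
apply/funext => t.
rewrite /circle_local /g /f /= /torus_local /torus_exp !mxE /= circle_exp0.
have -> : (a, 0) + (circle_exp t, 0) = (a + circle_exp t, 0 + 0) :> torus2 R by [].
by rewrite addr0.
Qed.

End torus_maps.

(** * Measure-preserving maps *)

Lemma measurable_preim d d' (X : measurableType d) (Y : measurableType d')
    (f : X -> Y) (A : set Y) :
  measurable_fun setT f -> measurable A -> measurable (f @^-1` A).
Proof. by move=> mf mA; rewrite -[_ @^-1` _]setTI; exact: mf. Qed.

Section almost_everywhere_toolkit.
Context d (X : measurableType d) (R : realType) (mu : probability X R).
Implicit Types (Q : X -> Prop) (A B D : set X) (S : X -> X).

Lemma ae_measurable_set Q : (\forall x \ae mu, Q x) ->
  exists D, [/\ measurable D, mu (~` D) = 0%E & D `<=` Q].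
Proof.
move=> [N [mN N0 QN]]; exists (~` N); split; first exact: measurableC.
  by rewrite setCK.
by move=> x Nx; apply: contrapT => Qx; exact/Nx/QN.
Qed.

Lemma ae_of_set D Q : measurable D -> mu (~` D) = 0%E -> D `<=` Q ->
  \forall x \ae mu, Q x.
Proof.
move=> mD D0 DQ; exists (~` D); split => //; first exact: measurableC.
by move=> x Qx Dx; exact/Qx/DQ.
Qed.

Lemma ae_imp Q Q' : (\forall x \ae mu, Q x) -> (forall x, Q x -> Q' x) ->
  \forall x \ae mu, Q' x.
Proof. by move=> h QQ'; apply: filterS h. Qed.

Lemma ae_and Q Q' : (\forall x \ae mu, Q x) -> (\forall x \ae mu, Q' x) ->
  \forall x \ae mu, Q x /\ Q' x.
Proof. by move=> h h'; apply: filterS2 h h'. Qed.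

Lemma ae_set1 D : measurable D -> mu D = 1%E -> \forall x \ae mu, D x.
Proof.
move=> mD D1; apply: (ae_of_set mD) => //.
by rewrite probability_setC // D1 subee.
Qed.

Lemma ae_ex_in A Q : measurable A -> (0 < mu A)%E -> (\forall x \ae mu, Q x) ->
  exists2 x, A x & Q x.
Proof.
move=> mA A0 /ae_measurable_set[D [mD D0 DQ]].
apply: contrapT => h; suff : (mu A <= 0)%E by rewrite leNgt A0.
rewrite -D0; apply: le_measure; rewrite ?inE //; first exact: measurableC.
by move=> x Ax Dx; apply: h; exists x => //; exact: DQ.
Qed.

Lemma ae_ex Q : (\forall x \ae mu, Q x) -> exists x, Q x.
Proof.
move=> /(ae_ex_in measurableT) []; last by move=> x; exists x.
by rewrite probability_setT.
Qed.

Lemma ae_forall_count (I : countType) (Q : I -> X -> Prop) :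
  (forall i, \forall x \ae mu, Q i x) -> \forall x \ae mu, forall i, Q i x.
Proof.
move=> h; have : \forall x \ae mu, forall n, if unpickle n is Some i then Q i x else True.
  by apply: ae_foralln => n; case: unpickle => [i|]; [exact: h|exact: aeW].
by apply: filterS => x hx i; have := hx (pickle i); rewrite pickleK.
Qed.

Lemma mp_iter S n : measure_preserving mu S -> measure_preserving mu (iter n S).
Proof.
move=> [mS pS]; elim: n => [|n [mSn pSn]]; first by split => //; exact: measurable_id.
split; first exact: measurableT_comp.
move=> A mA; have mSA : measurable (S @^-1` A).
  exact: measurable_preim.
by rewrite -(pS A mA) -(pSn _ mSA).
Qed.

Lemma ae_pullback S Q : measure_preserving mu S -> (\forall x \ae mu, Q x) ->
  \forall x \ae mu, Q (S x).
Proof.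
move=> [mS pS] [N [mN N0 QN]]; exists (S @^-1` N); split.
- exact: measurable_preim.
- by rewrite pS.
- by move=> x Qx; exact: QN.
Qed.

Lemma ae_pullback_iter S Q : measure_preserving mu S -> (\forall x \ae mu, Q x) ->
  \forall x \ae mu, forall n, Q (iter n S x).
Proof.
by move=> mpS hQ; apply: ae_foralln => n; exact: (ae_pullback (mp_iter n mpS)).
Qed.

Let measurable_preim_iter S n A : measure_preserving mu S -> measurable A ->
  measurable (iter n S @^-1` A).
Proof.
by move=> /(mp_iter n)[mS _] mA; exact: measurable_preim.
Qed.

Let visits S A := lim_sup_set (fun n => iter n S @^-1` A).

Let measurable_visits S A : measure_preserving mu S -> measurable A ->
  measurable (visits S A).
Proof.
move=> mpS mA; apply: bigcap_measurable => // n _.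
by apply: bigcup_measurable => k _; exact: measurable_preim_iter.
Qed.

Let visits_inv S A : S @^-1` (visits S A) = visits S A.
Proof.
apply/seteqP; split => x /= h n _.
  have [j /= nj Aj] := h n I; exists j.+1; first exact: leqW.
  by rewrite /= -iterSr in Aj.
have [[//|j] /= nj Aj] := h n.+1 I; exists j => //.
by rewrite /= -iterSr.
Qed.

(** [ergodic] speaks of exactly invariant sets only. The set [visits S A] of points that meet [A]
    infinitely often is exactly invariant, and it agrees with [A] almost everywhere when [A] is
    invariant almost everywhere. *)
Lemma ergodic_zero_one S A : measure_preserving mu S -> ergodic mu S ->
  measurable A -> (\forall x \ae mu, A x <-> A (S x)) ->
  mu A = 0%E \/ mu A = 1%E.
Proof.
move=> mpS eS mA hA.
have AV : \forall x \ae mu, A x <-> visits S A x.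
  apply: filterS (ae_pullback_iter mpS hA) => x hx.
  have An n : A x <-> A (iter n S x).
    by elim: n => [//|n IHn]; rewrite IHn hx.
  split => [Ax n _|h].
    by exists n => //=; exact/An.
  by have [j _ /An] := h 0%N I.
have mV := measurable_visits mpS mA.
suff -> : mu A = mu (visits S A) by apply: eS => //; exact: visits_inv.
have [D [mD D0 DQ]] := ae_measurable_set AV.
have muD B : measurable B -> mu B = mu (B `&` D).
  move=> mB; have Z : mu (B `\` D) = 0%E.
    apply: (subset_measure0 (mu := mu) (B := ~` D)) => //.
    - exact: measurableD.
    - exact: measurableC.
  transitivity (mu (B `\` D) + mu (B `&` D))%E; first exact: measureDI.
  by rewrite Z add0e.
rewrite (muD A mA) (muD (visits S A) mV); congr (mu _); apply/seteqP.
by split => x [? Dx]; split => //; exact/DQ.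
Qed.

(** The measure of [visits S A] is the limit of the measures of the sets visiting [A] after time n.
    Each contains a preimage of [A], so the limit is at least [mu A], and a positive measure must be
    1. *)
Lemma ergodic_recurrence S A : measure_preserving mu S -> ergodic mu S ->
  measurable A -> (0 < mu A)%E ->
  \forall x \ae mu, forall n, exists2 j, (n <= j)%N & A (iter j S x).
Proof.
move=> mpS eS mA A0; have mV := measurable_visits mpS mA.
suff : mu (visits S A) = 1%E.
  move/(ae_set1 mV); apply: filterS => x Vx n.
  by have [j /= nj Aj] := Vx n I; exists j.
have [V0|//] := eS _ mV (visits_inv S A).
have mU n : measurable (\bigcup_(k >= n) (iter k S @^-1` A)).
  by apply: bigcup_measurable => k _; exact: measurable_preim_iter.
have := @lim_sup_set_cvg _ _ _ mu (fun n => iter n S @^-1` A)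
  (fun k => measurable_preim_iter k mpS mA).
have fin : (mu (\bigcup_(k >= 0) (iter k S @^-1` A)) < +oo)%E.
  by rewrite (le_lt_trans (probability_le1 _ (mU 0%N))) ?ltry.
move=> /(_ fin) cv; exfalso.
suff : (mu A <= mu (visits S A))%E by rewrite V0 leNgt A0.
rewrite -(cvg_lim _ cv) //; apply: lime_ge.
  by apply/cvg_ex; exists (mu (visits S A)).
apply: nearW => n; have [_ <- //] := mp_iter n mpS.
apply: le_measure; rewrite ?inE //; first exact: measurable_preim_iter.
by move=> x Ax; exists n => /=.
Qed.

(** Almost everywhere convergence implies convergence in measure: the limsup of the exceptional sets
    is null, and the tail unions decrease to it. This is what allows one time n to be fixed for most
    points. *)
Lemma ae_cvg_measure0 (H : nat -> set X) : (forall n, measurable (H n)) ->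
  (\forall x \ae mu, \forall n \near \oo, ~ H n x) ->
  mu (H n) @[n --> \oo] --> 0%E.
Proof.
move=> mH hH.
have mV : measurable (lim_sup_set H).
  apply: bigcap_measurable => // n _.
  by apply: bigcup_measurable => k _; exact: mH.
have V0 : mu (lim_sup_set H) = 0%E.
  apply/negligibleP => //; apply: negligibleS hH => x Vx [N _ hN].
  by have [j /= Nj Hj] := Vx N I; exact: (hN j).
have mU n : measurable (\bigcup_(k >= n) H k).
  by apply: bigcup_measurable => k _; exact: mH.
have fin : (mu (\bigcup_(k >= 0) H k) < +oo)%E.
  by rewrite (le_lt_trans (probability_le1 _ (mU 0%N))) ?ltry.
have cv : mu (\bigcup_(k >= n) H k) @[n --> \oo] --> 0%E.
  by rewrite -V0; exact: lim_sup_set_cvg.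
apply: squeeze_cvge (@cvg_cst _ (0%E : \bar R) _ _ _) cv.
apply: nearW => n; rewrite measure_ge0 /=.
apply: le_measure; rewrite ?inE //.
by move=> x Hx; exists n => /=.
Qed.

End almost_everywhere_toolkit.

(** * Linear cocycles of polynomial growth *)

Lemma ord2_ind (P : 'I_2 -> Prop) : P ord0 -> P ord_max -> forall i, P i.
Proof.
move=> P0 P1 i; case: (unliftP ord0 i) => [k|] -> //.
by rewrite (_ : lift _ _ = ord_max) //; apply/val_inj; case: k => [[|]].
Qed.

Lemma mulmx2E (R : pzSemiRingType) m n (A : 'M[R]_(m, 2)) (B : 'M[R]_(2, n)) i j :
  (A *m B) i j = A i ord0 * B ord0 j + A i ord_max * B ord_max j.
Proof.
rewrite mxE !big_ord_recl big_ord0 addr0.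
by rewrite (_ : lift ord0 ord0 = ord_max) //; apply/val_inj.
Qed.

Section power_asymptotics.
Variables (R : realType) (tau : R).
Hypothesis tau0 : 0 < tau.

Lemma cvg_powRN_nat0 : (n%:R : R) `^ (- tau) @[n --> \oo] --> 0.
Proof.
apply/cvgr0Pnorm_lt => e e0.
have e1 : 0 <= e^-1 `^ tau^-1 by exact: powR_ge0.
near=> n.
have nb : e^-1 `^ tau^-1 < n%:R.
  near: n; exact: nbhs_infty_gtr.
rewrite ger0_norm ?powR_ge0 // powRN.
have : (e^-1 `^ tau^-1) `^ tau < n%:R `^ tau.
  apply: gt0_ltr_powR => //; rewrite nnegrE //.
rewrite -powRrM mulVf ?gt_eqF // powRr1 ?invr_ge0 ?ltW // => h.
by rewrite invf_plt // ?posrE // (lt_trans _ h) // invr_gt0.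
Unshelve. all: by end_near. Qed.

Lemma powRN_nat_succ n :
  (n%:R : R) `^ (- tau) = (n%:R / n.+1%:R) `^ (- tau) * n.+1%:R `^ (- tau).
Proof. by rewrite -powRM ?divr_ge0 // divfK // pnatr_eq0. Qed.

Lemma cvg_powRN_ratio : (n%:R / n.+1%:R : R) `^ (- tau) @[n --> \oo] --> (1 : R).
Proof.
have d1 : derivable (@powR R ^~ (- tau)) 1 1.
  by apply: derivable_powR; rewrite in_itv /= ltr01.
have c1 : (@powR R ^~ (- tau)) @ (1 : R) --> (1 : R).
  have := differentiable_continuous ((derivable1_diffP _ _).1 d1).
  by rewrite /prop_for /continuous_at powR1.
suff c2 : (n%:R / n.+1%:R : R) @[n --> \oo] --> (1 : R).
  exact: (cvg_comp _ _ c2 c1).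
have -> : (fun n : nat => n%:R / n.+1%:R : R) = (fun n => 1 - n.+1%:R^-1).
  apply/funext => n.
  by rewrite -{1}(addrK 1 n%:R) natr1 mulrBl divff ?pnatr_eq0 // mul1r.
rewrite -[X in _ --> X]subr0; apply: cvgB; first exact: cvg_cst.
exact: (@cvg_harmonic R).
Qed.

End power_asymptotics.

Section linear_cocycle.
Context d (X : measurableType d) (R : realType) (mu : probability X R).
Variables (S : X -> X) (D : X -> 'M[R]_2).
Hypothesis mpS : measure_preserving mu S.
Hypothesis eS : ergodic mu S.
Hypothesis mD : forall i j, measurable_fun setT (fun z => D z i j).

Fixpoint cocycle n z : 'M[R]_2 :=
  if n is m.+1 then D (iter m S z) *m cocycle m z else 1%:M.

Lemma cocycle_add n m z :
  cocycle (n + m) z = cocycle n (iter m S z) *m cocycle m z.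
Proof.
elim: n => [|n IHn] /=; first by rewrite mul1mx.
by rewrite IHn mulmxA iterD.
Qed.

Lemma measurable_cocycle n i j : measurable_fun setT (fun z => cocycle n z i j).
Proof.
elim: n i j => [|n IHn] i j /=; first exact: measurable_cst.
under eq_fun do rewrite mulmx2E.
have [mSn _] := mp_iter n mpS.
by apply: measurable_funD; apply: measurable_funM => //;
  exact: (measurableT_comp (mD _ _) mSn).
Qed.

Let box (q : 'M[rat]_2) (k : nat) : set X :=
  [set y | forall i j, ball (ratr (q i j) : R) k.+1%:R^-1 (D y i j)].

Let measurable_box q k : measurable (box q k).
Proof.
rewrite (_ : box q k = \bigcap_(i : 'I_2) \bigcap_(j : 'I_2)
    ((fun z => D z i j) @^-1` ball (ratr (q i j) : R) k.+1%:R^-1)).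
  apply: fin_bigcap_measurable => // i _; apply: fin_bigcap_measurable => // j _.
  by apply: measurable_preim => //; apply: open_measurable; exact: ball_open.
apply/seteqP; split => y h => [i _ j _|i j]; first exact: h.
exact: (h i I j I).
Qed.

(** The boxes with rational centre are countably many. Almost every orbit visits infinitely often
    each box of positive measure, and almost every [y] avoids all boxes of measure 0. The factor 2
    compares two points of a box through its centre. *)
Lemma orbit_dense_values : \forall z \ae mu, \forall y \ae mu, forall k : nat,
  exists2 n, (k <= n)%N &
    forall i j, `|D y i j - D (iter n S z) i j| < 2 * k.+1%:R^-1.
Proof.
have hz : \forall z \ae mu, forall p : 'M[rat]_2 * nat, (0 < mu (box p.1 p.2))%E ->
    forall n, exists2 j, (n <= j)%N & box p.1 p.2 (iter j S z).
  apply: ae_forall_count => p.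
  have [p0|p0] := ltP 0%E (mu (box p.1 p.2)); last by apply: aeW.
  have := ergodic_recurrence mpS eS (measurable_box p.1 p.2) p0.
  by apply: filterS => z hz _.
have hy : \forall y \ae mu, forall p : 'M[rat]_2 * nat, box p.1 p.2 y ->
    (0 < mu (box p.1 p.2))%E.
  apply: ae_forall_count => p.
  have [p0|p0] := ltP 0%E (mu (box p.1 p.2)); first by apply: aeW.
  apply: (ae_of_set (D := ~` box p.1 p.2)) => //.
  - by apply: measurableC.
  - by rewrite setCK; apply/eqP; rewrite eq_le p0 measure_ge0.
apply: filterS hz => z hz; apply: filterS hy => y hy k.
have k0 : 0 < k.+1%:R^-1 :> R by rewrite invr_gt0.
have /choice[q hq] : forall ij : 'I_2 * 'I_2, exists r : rat,
    ball (ratr r : R) k.+1%:R^-1 (D y ij.1 ij.2).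
  move=> ij; have [|r] := @rat_in_itvoo R (D y ij.1 ij.2) (D y ij.1 ij.2 + k.+1%:R^-1).
    by rewrite ltrDl.
  rewrite in_itv /= => /andP[r1 r2]; exists r.
  rewrite /ball /= ltr_norml; move: k.+1%:R^-1 k0 r1 r2 => e e0 r1 r2; lra.
pose Q : 'M[rat]_2 := \matrix_(i, j) q (i, j).
have By : box Q k y by move=> i j; rewrite mxE; exact: hq (i, j).
have [n kn Bn] := hz (Q, k) (hy (Q, k) By) k.
exists n => // i j; have := By i j; have := Bn i j.
rewrite /ball /= !ltr_norml; move: k.+1%:R^-1 k0 => e e0; lra.
Qed.

Variables (tau : R) (G : X -> 'M[R]_2).
Hypothesis tau0 : 0 < tau.
Hypothesis cvgG : \forall z \ae mu,
  (n%:R `^ (- tau)) *: cocycle n z @[n --> \oo] --> G z.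

Let kap (n : nat) : R := n%:R `^ (- tau).

Let kapM0 (t : R) : kap n * t @[n --> \oo] --> (0 : R).
Proof. by have := cvgMr_tmp (b := t) (cvg_powRN_nat0 tau0); rewrite mul0r => H; exact: H. Qed.

Let cvg_entry z i j : (n%:R `^ (- tau)) *: cocycle n z @[n --> \oo] --> G z ->
  kap n * cocycle n z i j @[n --> \oo] --> G z i j.
Proof.
move=> h; rewrite (_ : (fun n => _) =
    (fun M : 'M[R]_2 => M i j) \o (fun n => kap n *: cocycle n z)).
  by apply: cvg_comp h _; exact: coord_continuous.
by apply/funext => n /=; rewrite mxE.
Qed.

Lemma cocycle_limit_fixed :
  \forall z \ae mu, \forall y \ae mu, D y *m G z = G z.
Proof.
apply: filterS2 orbit_dense_values cvgG => z hz Gz; apply: filterS hz => y hy.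
have {hy}/choice[n hn] : forall k, exists n, (k <= n)%N /\
    forall i j, `|D y i j - D (iter n S z) i j| < 2 * k.+1%:R^-1.
  by move=> k; have [n ? ?] := hy k; exists n.
have noo : n k @[k --> \oo] --> \oo.
  apply/cvgnyPge => A; exists A => // k /= Ak.
  by have [kn _] := hn k; exact: leq_trans Ak kn.
have cD i j : D (iter (n k) S z) i j @[k --> \oo] --> D y i j.
  apply/cvgrPdist_lt => e e0.
  have e2 : 0 < e / 2 by lra.
  have := near_infty_natSinv_lt (PosNum e2); apply: filterS => k /= ke.
  have [_ /(_ i j)/lt_trans] := hn k; apply.
  by move: ke; move: k.+1%:R^-1 => a ae; lra.
apply/matrixP => i l; rewrite mulmx2E.
have l1 : D (iter (n k) S z) i ord0 * (kap (n k) * cocycle (n k) z ord0 l)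
    + D (iter (n k) S z) i ord_max * (kap (n k) * cocycle (n k) z ord_max l)
    @[k --> \oo] --> D y i ord0 * G z ord0 l + D y i ord_max * G z ord_max l.
  apply: cvgD; apply: cvgM => //.
  - exact: (cvg_comp _ _ noo (@cvg_entry z ord0 l Gz)).
  - exact: (cvg_comp _ _ noo (@cvg_entry z ord_max l Gz)).
(* Normalizing time m + 1 by the factor of time m is harmless: the quotient of the two factors tends
   to 1. *)
have l2 : kap m * cocycle m.+1 z i l @[m --> \oo] --> G z i l.
  rewrite -[X in _ --> X]mul1r.
  have -> : (fun m => kap m * cocycle m.+1 z i l) =
    (fun m => (m%:R / m.+1%:R) `^ (- tau) * (kap m.+1 * cocycle m.+1 z i l)).
    by apply/funext => m; rewrite mulrA -powRN_nat_succ.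
  apply: cvgM; first exact: cvg_powRN_ratio.
  by have := @cvg_entry z i l Gz; rewrite -cvg_shiftS.
have {}l2 := cvg_comp _ _ noo l2.
apply: (@cvg_unique _ (@Rhausdorff R) _ _ _ _ l1).
suff -> : (fun k => D (iter (n k) S z) i ord0 * (kap (n k) * cocycle (n k) z ord0 l)
    + D (iter (n k) S z) i ord_max * (kap (n k) * cocycle (n k) z ord_max l)) =
    (fun m => kap m * cocycle m.+1 z i l) \o n by [].
by apply/funext => k /=; rewrite mulmx2E mulrDr !mulrA !(mulrC (kap _)).
Qed.

Variable A : set X.
Hypotheses (mA : measurable A) (A0 : (0 < mu A)%E) (AG : forall z, A z -> G z <> 0).

(** A constant cocycle is killed by [n^-tau], so [G] would vanish almost everywhere. Here [tau > 0]
    is essential. *)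
Lemma cocycle_not_identity : ~ \forall y \ae mu, D y = 1%:M.
Proof.
move=> /(ae_pullback_iter mpS) h.
have h2 : \forall z \ae mu, G z = 0.
  apply: filterS2 h cvgG => z hz Gz.
  have C1 n : cocycle n z = 1%:M.
    by elim: n => [//|n IHn] /=; rewrite IHn hz mulmx1.
  apply/matrixP => i j; rewrite [RHS]mxE.
  apply: (@cvg_unique _ (@Rhausdorff R) _ _ _ _ (@cvg_entry z i j Gz)).
  have -> : (fun n => kap n * cocycle n z i j) =
      (fun n => kap n * (1%:M : 'M[R]_2) i j) by apply/funext => n; rewrite C1.
  exact: kapM0.
by have [z Az Gz] := ae_ex_in mA A0 h2; exact: (AG Az).
Qed.

Lemma cocycle_fixed_vector :
  exists2 c : 'cV[R]_2, c != 0 & \forall y \ae mu, D y *m c = c.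
Proof.
have [z Az hz] := ae_ex_in mA A0 cocycle_limit_fixed.
have [j cj] : exists j, col j (G z) != 0.
  apply: contrapT => h; apply: (AG Az); apply/matrixP => i j.
  have : col j (G z) = 0.
    by apply/eqP; apply: contrapT => /negP cj; apply: h; exists j.
  by move/matrixP => /(_ i ord0); rewrite !mxE.
exists (col j (G z)) => //.
by apply: filterS hz => y hy; rewrite !colE mulmxA hy.
Qed.

(** The columns [b], [c] form a basis and the rows [a], [l] are its dual basis. [b] is [c] turned by
    a right angle and divided by its squared norm. *)
Lemma dual_basis (c : 'cV[R]_2) : c != 0 ->
  exists (a l : 'rV[R]_2) (b : 'cV[R]_2),
    [/\ b *m a + c *m l = 1%:M, a *m c = 0, l *m c = 1%:M & a *m b = 1%:M].
Proof.
move=> c0; pose x := c ord0 ord0; pose y := c ord_max ord0.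
have n0 : x ^+ 2 + y ^+ 2 != 0.
  apply: contraNneq c0 => /eqP.
  rewrite paddr_eq0 ?sqr_ge0 // !sqrf_eq0 => /andP[/eqP x0 /eqP y0].
  by apply/eqP/matrixP => i j; rewrite ord1 mxE; elim/ord2_ind: i.
pose n := x ^+ 2 + y ^+ 2.
exists (rv2 (- y) x), (rv2 (x / n) (y / n)),
  (\col_i (if i == ord0 then - y / n else x / n)).
split; apply/matrixP => i j.
- rewrite [LHS]mxE 2!mxE !big_ord1 !mxE.
  by elim/ord2_ind: i; elim/ord2_ind: j; rewrite /= -?/x -?/y /n; field.
- by rewrite !ord1 mulmx2E !mxE /= -/x -/y; ring.
- by rewrite !ord1 mulmx2E !mxE /= -/x -/y /n; field.
- by rewrite !ord1 mulmx2E !mxE /= -/x -/y /n; field.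
Qed.

(* In a basis starting with c the cocycle is triangular; alpha is its other
   diagonal entry and beta its off-diagonal one, so that
   [beta (n + n) z = beta n (S^n z) * alpha n z + beta n z].  Since
   [G z = h z *: (c *m a)] with [h = (h o S) * alpha 1], dividing by [n^tau] gives
   [n^-tau beta n (S^n z) / h (S^n z) --> 2^tau - 1], whereas
   [n^-tau beta n z / h z --> 1].  As S preserves mu, for n large both ratios
   are near their limits at one and the same point [S^n z]. *)
Lemma growth_exponent_eq1 : tau = 1.
Proof.
have [c c0 hc] := cocycle_fixed_vector.
have [a [l [b [ba ac lc ab]]]] := dual_basis c0.
(* The identity [b *m a + c *m l] is inserted between the factors. When [M] fixes [c], the
   coefficient [u *m M *m c] becomes 0 for [u = a] and 1 for [u = l]. *)
have split_mul (u : 'rV[R]_2) (M N : 'M[R]_2) (v : 'cV[R]_2) :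
    (u *m (M *m N) *m v) ord0 ord0 =
    (u *m M *m b) ord0 ord0 * (a *m N *m v) ord0 ord0 +
    (u *m M *m c) ord0 ord0 * (l *m N *m v) ord0 ord0.
  have -> : u *m (M *m N) *m v =
      (u *m M *m b) *m (a *m N *m v) + (u *m M *m c) *m (l *m N *m v).
    by rewrite -{1}[M]mulmx1 -ba !(mulmxDr, mulmxDl, mulmxA).
  by rewrite mxE; congr (_ + _); rewrite mxE big_ord1.
pose alpha n z := (a *m cocycle n z *m b) ord0 ord0.
pose beta n z := (l *m cocycle n z *m b) ord0 ord0.
pose h z := (l *m G z *m b) ord0 ord0.
have fixc : \forall z \ae mu, forall m n, cocycle n (iter m S z) *m c = c.
  apply: filterS (ae_pullback_iter mpS hc) => z hz m; elim=> [|n IHn] /=.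
    by rewrite mul1mx.
  by rewrite -mulmxA IHn -iterD hz.
have alphaD z n m : cocycle n (iter m S z) *m c = c ->
    alpha (n + m)%N z = alpha n (iter m S z) * alpha m z.
  by move=> hz; rewrite /alpha cocycle_add split_mul -(mulmxA a _ c) hz ac [X in _ + X * _]mxE mul0r addr0.
have betaD z n m : cocycle n (iter m S z) *m c = c ->
    beta (n + m)%N z = beta n (iter m S z) * alpha m z + beta m z.
  move=> hz; rewrite /beta cocycle_add split_mul -(mulmxA l _ c) hz lc.
  by rewrite [X in _ + X * _]mxE eqxx mul1r.
have cvgh z : (n%:R `^ (- tau)) *: cocycle n z @[n --> \oo] --> G z ->
    kap n * beta n z @[n --> \oo] --> h z.
  move=> Gz.
  have E (M : 'M[R]_2) : (l *m M *m b) ord0 ord0 =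
      l ord0 ord0 * M ord0 ord0 * b ord0 ord0 +
      l ord0 ord_max * M ord_max ord0 * b ord0 ord0 +
      (l ord0 ord0 * M ord0 ord_max * b ord_max ord0 +
       l ord0 ord_max * M ord_max ord_max * b ord_max ord0).
    by rewrite !mulmx2E !mulrDl.
  rewrite /h E.
  have -> : (fun n => kap n * beta n z) = (fun n =>
      l ord0 ord0 * (kap n * cocycle n z ord0 ord0) * b ord0 ord0 +
      l ord0 ord_max * (kap n * cocycle n z ord_max ord0) * b ord0 ord0 +
      (l ord0 ord0 * (kap n * cocycle n z ord0 ord_max) * b ord_max ord0 +
       l ord0 ord_max * (kap n * cocycle n z ord_max ord_max) * b ord_max ord0)).
    by apply/funext => n; rewrite /beta E; ring.
  by apply: cvgD; apply: cvgD; apply: cvgMr_tmp; apply: cvgMl_tmp; exact: cvg_entry.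
have hG : \forall z \ae mu, G z = h z *: (c *m a).
  (* Otherwise a column of [G z] is independent of [c]. Almost every [D y] fixes both, hence is the
     identity, which [cocycle_not_identity] excludes. *)
  have aG : \forall z \ae mu, a *m G z = 0.
    apply: filterS cocycle_limit_fixed => z hz.
    apply: contrapT => /eqP/matrix0Pn[i [j]]; rewrite ord1 => aGj.
    apply: cocycle_not_identity; apply: filterS2 hz hc => y Gy cy.
    have Db : D y *m b = b.
      have : D y *m (b *m (a *m G z)) = b *m (a *m G z).
        have E : b *m (a *m G z) = G z - c *m (l *m G z).
          by rewrite -{2}[G z]mul1mx -ba mulmxDl -!mulmxA addrK.
        by rewrite E mulmxBr Gy (mulmxA (D y)) cy.
      rewrite mulmxA => /matrixP Eb; apply/matrixP => i' j'; rewrite ord1.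
      have := Eb i' j; rewrite mxE big_ord1 [RHS]mxE big_ord1.
      by move/(mulIf aGj).
    by rewrite -[LHS]mulmx1 -ba mulmxDr !mulmxA Db cy.
  (* The cocycle keeps [c] bounded, in fact fixed, whereas the normalization tends to 0. *)
  have Gc : \forall z \ae mu, G z *m c = 0.
    apply: filterS2 fixc cvgG => z hz Gz; apply/matrixP => i j.
    rewrite ord1 mulmx2E [RHS]mxE.
    have cv : kap n * cocycle n z i ord0 * c ord0 ord0 +
        kap n * cocycle n z i ord_max * c ord_max ord0 @[n --> \oo] -->
        G z i ord0 * c ord0 ord0 + G z i ord_max * c ord_max ord0.
      by apply: cvgD; apply: cvgMr_tmp; exact: cvg_entry.
    apply: (@cvg_unique _ (@Rhausdorff R) _ _ _ _ cv).
    have -> : (fun n => kap n * cocycle n z i ord0 * c ord0 ord0 +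
        kap n * cocycle n z i ord_max * c ord_max ord0) =
        (fun n => kap n * c i ord0).
      by apply/funext => n; rewrite -!mulrA -mulrDr -mulmx2E (hz 0%N n).
    exact: kapM0.
  apply: filterS2 aG Gc => z aGz Gcz.
  have E1 : G z = c *m (l *m G z).
    by rewrite -{1}[G z]mul1mx -ba mulmxDl -!mulmxA aGz mulmx0 add0r.
  have E2 : l *m G z = (l *m G z *m b) *m a.
    rewrite -{1}[l *m G z]mulmx1 -ba mulmxDr !mulmxA.
    by rewrite -(mulmxA l (G z) c) Gcz mulmx0 mul0mx addr0.
  by rewrite [LHS]E1 E2 [l *m G z *m b]mx11_scalar mul_scalar_mx scalemxAr.
(* Two computations of the limit of [beta] at time n + 1: after splitting off the first step, whose
   own [beta] is negligible, and directly from [z]. *)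
have hS : \forall z \ae mu, h z = h (S z) * alpha 1%N z.
  apply: filterS2 (filterI fixc cvgG) (ae_pullback mpS cvgG) => z [hz Gz] GSz.
  have l1 : kap n * beta (n + 1)%N z @[n --> \oo] --> h (S z) * alpha 1%N z + 0.
    have -> : (fun n => kap n * beta (n + 1)%N z) =
        (fun n => kap n * beta n (S z) * alpha 1%N z + kap n * beta 1%N z).
      by apply/funext => n; rewrite betaD ?hz // mulrDr mulrA.
    by apply: cvgD; [apply: cvgMr_tmp; exact: cvgh|exact: kapM0].
  rewrite addr0 in l1.
  have l2 : kap n * beta (n + 1)%N z @[n --> \oo] --> 1 * h z.
    have -> : (fun n => kap n * beta (n + 1)%N z) =
        (fun m => (m%:R / m.+1%:R) `^ (- tau) * (kap m.+1 * beta m.+1 z)).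
      by apply/funext => m; rewrite addn1 mulrA -powRN_nat_succ.
    apply: cvgM; first exact: cvg_powRN_ratio.
    by have := cvgh _ Gz; rewrite -cvg_shiftS.
  by rewrite mul1r in l2; exact: (@cvg_unique _ (@Rhausdorff R) _ _ _ _ l2 l1).
have [D0 [mD0 D00 D0P]] := ae_measurable_set (filterI (filterI fixc cvgG)
  (filterI (ae_pullback_iter mpS hS) hG)).
(* [h] is a limit only almost everywhere. Cut off outside the good set [D0], it is a limit
   everywhere of measurable functions, hence measurable. *)
pose H z := \1_D0 z * h z.
have HE z : D0 z -> H z = h z by move=> zD; rewrite /H indicE mem_set // mul1r.
have mb n : measurable_fun setT (beta n).
  rewrite (_ : beta n = fun z => \sum_j (\sum_i l ord0 i * cocycle n z i j) * b j ord0).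
    apply: measurable_sum => j; apply: measurable_funM; last exact: measurable_cst.
    apply: measurable_sum => i; apply: measurable_funM; first exact: measurable_cst.
    exact: measurable_cocycle.
  by apply/funext => z; rewrite /beta mxE; apply: eq_bigr => j _; rewrite mxE.
have mH : measurable_fun setT H.
  apply: (@measurable_fun_cvg _ _ _ _ (fun n z => \1_D0 z * (kap n * beta n z))).
    move=> n; apply: measurable_funM; first exact: measurable_indic.
    by apply: measurable_funM => //; exact: measurable_cst.
  move=> z _; have [zD|zD] := pselect (D0 z).
    by apply: cvgMl_tmp; apply: cvgh; have [[]] := D0P z zD.
  by rewrite /H indicE memNset // mul0r; under eq_cvg do rewrite mul0r; exact: cvg_cst.
pose B := [set z | H z != 0].
have mB : measurable B.
  rewrite (_ : B = H @^-1` (~` [set 0])); last by apply/seteqP; split => z /= /eqP.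
  by apply: measurable_preim => //; apply: measurableC; exact: measurable_set1.
have BD z : B z -> D0 z.
  by move=> Bz; apply: contrapT => zD; move: Bz; rewrite /B /= /H indicE memNset // mul0r eqxx.
have B0 : (0 < mu B)%E.
  rewrite lt_neqAle measure_ge0 andbT; apply/negP => /eqP muB0.
  have nB : \forall z \ae mu, ~ B z.
    by exists B; split => // z /= /contrapT.
  have [z Az [nBz zD]] := ae_ex_in mA A0 (filterI nB (ae_of_set mD0 D00 (fun _ P => P))).
  apply: nBz; rewrite /B /= HE //; apply/eqP => hz0; apply: (AG Az).
  by have [_ [_ ->]] := D0P z zD; rewrite hz0 scale0r.
apply/eqP/negPn/negP => tau1.
have t2 : 2 `^ tau != 2.
  apply: contraNneq tau1 => /(congr1 (@ln R)); rewrite ln_powR.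
  have l2 : ln 2 != 0 :> R by rewrite gt_eqF // ln_gt0 // ltr1n.
  by move=> E; apply/eqP/(mulIf l2); rewrite mul1r.
(* Half the distance between the two limits 1 and [2 ^ tau - 1]: no number is strictly within [e] of
   both. *)
pose e := `|2 `^ tau - 2| / 2.
have e0 : 0 < e by rewrite divr_gt0 // normr_gt0 subr_eq0.
(* The quotient of [f] by [H] is at distance at least [e] from [t], written without division. *)
pose far t f := [set z | e * `|H z| <= `|f z - t * H z|] : set X.
have m_far t f : measurable_fun setT f -> measurable (far t f).
  move=> mf; rewrite (_ : far t f =
      (fun z => `|f z - t * H z| - e * `|H z|) @^-1` `[0, +oo[).
    apply: measurable_preim => //; apply: measurable_funB.
      apply: measurableT_comp => //; apply: measurable_funB => //.
      by apply: measurable_funM => //; exact: measurable_cst.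
    apply: measurable_funM; first exact: measurable_cst.
    exact: measurableT_comp.
  by apply/seteqP; split => z; rewrite /far /= in_itv /= andbT subr_ge0.
have mkb n : measurable_fun setT (fun z => kap n * beta n z).
  by apply: measurable_funM => //; exact: measurable_cst.
pose H1 n := B `&` far 1 (fun z => kap n * beta n z).
pose H2 n := B `&` (iter n S @^-1` far (2 `^ tau - 1) (fun z => kap n * beta n z)).
have mH1 n : measurable (H1 n) by apply: measurableI => //; exact: m_far.
have mH2 n : measurable (H2 n).
  apply: measurableI => //; have [mSn _] := mp_iter n mpS.
  by apply: measurable_preim => //; exact: m_far.
have cH1 : mu (H1 n) @[n --> \oo] --> 0%E.
  apply: ae_cvg_measure0 => //; apply: (ae_of_set mD0 D00) => z zD.
  have [[_ Gz] _] := D0P z zD.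
  have [Bz|nBz] := pselect (B z); last by apply: nearW => n [].
  have Hz0 : 0 < e * `|H z| by rewrite mulr_gt0 // normr_gt0.
  have /cvgrPdist_lt/(_ _ Hz0) := cvgh _ Gz; apply: filterS => n.
  by rewrite -HE // distrC => hn [_]; rewrite /far /= mul1r leNgt hn.
have alphaE z : D0 z -> forall n, h z = h (iter n S z) * alpha n z.
  move=> zD; have [[fz _] [hSz _]] := D0P z zD; elim=> [|n IHn].
    by rewrite /alpha /= mulmx1 ab mxE eqxx mulr1.
  by rewrite -add1n alphaD ?fz // mulrA -hSz.
have cH2 : mu (H2 n) @[n --> \oo] --> 0%E.
  apply: ae_cvg_measure0 => //.
  apply: filterS (ae_pullback_iter mpS (ae_of_set mD0 D00 (fun _ P => P))) => z zD.
  have {}zD0 := zD 0%N; have [[fz Gz] _] := D0P z zD0.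
  have [Bz|nBz] := pselect (B z); last by apply: nearW => n [].
  have Hz0 : 0 < e * `|H z| by rewrite mulr_gt0 // normr_gt0.
  have noo : (n + n)%N @[n --> \oo] --> \oo.
    by apply/cvgnyPge => K; exists K => // k /= Kk; rewrite (leq_trans Kk) // leq_addr.
  have cv : kap n * beta n (iter n S z) * alpha n z @[n --> \oo] -->
      2 `^ tau * h z - h z.
    have -> : (fun n => kap n * beta n (iter n S z) * alpha n z) =
        (fun n => 2 `^ tau * (kap (n + n)%N * beta (n + n)%N z) - kap n * beta n z).
      apply/funext => n; rewrite betaD ?fz //.
      have -> : kap n = 2 `^ tau * kap (n + n)%N.
        rewrite /kap addnn -mul2n natrM powRM // mulrA -powRD ?subrr ?powRr0 ?mul1r //.
        by rewrite pnatr_eq0 implybT.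
      by ring.
    apply: cvgB; last exact: cvgh.
    by apply: cvgMl_tmp; exact: (cvg_comp _ _ noo (cvgh _ Gz)).
  have /cvgrPdist_lt/(_ _ Hz0) := cv; apply: filterS => n hn [_].
  rewrite /far /= HE //.
  (* Since [h z] is non-zero, so is [alpha n z]. Multiplying the inequality at [S^n z] by its
     absolute value replaces [h (S^n z)] by [h z], which does not move with n. *)
  have hz := alphaE z zD0 n.
  have hz0 : h z != 0 by rewrite -HE.
  have a0 : 0 < `|alpha n z|.
    by rewrite normr_gt0; apply: contraNneq hz0; rewrite hz => ->; rewrite mulr0.
  rewrite -(ler_pM2r a0) -(mulrA e) -!normrM mulrBl -(mulrA (2 `^ tau - 1)) -hz leNgt => /negP; apply.
  by move: hn; rewrite HE // distrC mulrBl mul1r.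
have cH12 : (mu (H1 n) + mu (H2 n))%E @[n --> \oo] --> 0%E.
  suff : (mu (H1 n) + mu (H2 n))%E @[n --> \oo] --> (0 + 0)%E by rewrite adde0.
  exact: cvgeD.
have nB : nbhs (0%E : \bar R) [set y | (y < mu B)%E].
  by apply: open_nbhs_nbhs; split => //; exact: open_ereal_lt_ereal.
have /filter_ex[n hn] : \forall n \near \oo, (mu (H1 n) + mu (H2 n) < mu B)%E.
  exact: (cH12 _ nB).
have [mSn pSn] := mp_iter n mpS.
(* By invariance the first set has the measure of [H1 n], so [K] is too small to cover [B]. A point
   of [B] outside [K] satisfies both estimates at [S^n z]. *)
pose K := (iter n S @^-1` H1 n) `|` H2 n.
have mSH1 : measurable (iter n S @^-1` H1 n) by exact: measurable_preim.
have mK : measurable K by exact: measurableU.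
have BK0 : (0 < mu (B `\` K))%E.
  rewrite lt_neqAle measure_ge0 andbT; apply/negP => /eqP BK0.
  suff : (mu B <= mu (H1 n) + mu (H2 n))%E by rewrite leNgt hn.
  rewrite -(pSn _ (mH1 n)); apply: le_trans (measureU2 mu mSH1 (mH2 n)).
  have -> : mu B = (mu (B `\` K) + mu (B `&` K))%E by exact: measureDI.
  rewrite -BK0 add0e; apply: le_measure; last exact: subIsetr.
    by rewrite inE; exact: measurableI.
  by rewrite inE.
have [z [Bz nKz] zD] := ae_ex_in (measurableD mB mK) BK0
  (ae_pullback_iter mpS (ae_of_set mD0 D00 (fun _ P => P))).
have hz0 : h z != 0 by rewrite -HE //; exact: (zD 0%N).
have Hn0 : 0 < `|H (iter n S z)|.
  rewrite normr_gt0 HE //; apply: contraNneq hz0.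
  by rewrite (alphaE z (zD 0%N) n) => ->; rewrite mul0r.
have BSn : B (iter n S z) by rewrite /B /= -normr_gt0.
have n1 : `|kap n * beta n (iter n S z) - 1 * H (iter n S z)| < e * `|H (iter n S z)|.
  by rewrite ltNge; apply/negP => f1; apply: nKz; left; split.
have n2 : `|kap n * beta n (iter n S z) - (2 `^ tau - 1) * H (iter n S z)| <
    e * `|H (iter n S z)|.
  by rewrite ltNge; apply/negP => f1; apply: nKz; right; split.
have := le_lt_trans (ler_normB _ _) (ltrD n1 n2).
rewrite (_ : _ - _ = (2 `^ tau - 2) * H (iter n S z)); last by ring.
rewrite normrM -mulrDl ltr_pM2r // /e -splitr ltxx.
by [].
Qed.

End linear_cocycle.

(** * Invariant directions *)

Lemma locally_constant (R : realType) (T : Type) (g : R -> T) :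
  (forall t : R, \forall s \near t, g s = g t) -> forall s t, g s = g t.
Proof.
move=> gl s t; pose B := [set u | g u = g t].
suff : B = setT by move/seteqP => [_ /(_ s I)].
have conn : connected [set: R] by apply/connected_intervalP => x y _ _ z _.
apply: conn; first by exists t.
  exists B; last by rewrite setTI.
  by rewrite openE => u Bu; apply: filterS (gl u) => v; rewrite /B /= => ->.
exists B; last by rewrite setTI.
rewrite -openC openE => u Bu; apply: filterS (gl u) => v.
by rewrite /B /= => ->.
Qed.

Section flows.
Variable R : realType.

Lemma derive_line (V W : normedModType R) (F : V -> W) (c : V) (s : R) :
  derivable F (s *: c) c ->
  is_derive (s : R) (1 : R) (fun t : R => F (t *: c)) ('D_c F (s *: c)).
Proof.
have E : (fun h : R => h^-1 *: (((fun t : R => F (t *: c)) \o shift s) (h *: (1 : R)) -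
    F (s *: c))) = (fun h : R => h^-1 *: ((F \o shift (s *: c)) (h *: c) - F (s *: c))).
  by apply/funext => h /=; rewrite scalerDl [h *: 1]mulr1.
by move=> dF; apply: DeriveDef; rewrite /derivable /derive E.
Qed.

Lemma is_derive_zero_near (u : R -> R) :
  (\forall s \near (0 : R), is_derive s (1 : R) u 0) ->
  \forall s \near (0 : R), u s = u 0.
Proof.
move=> /nbhs_norm0P[e /= e0 he].
suff H a b : `|a| < e -> `|b| < e -> a <= b -> u b = u a.
  apply/nbhs_norm0P; exists e => //= s se.
  have [s0|s0] := leP 0 s; first by apply: H => //; rewrite normr0.
  by apply/esym; apply: H => //; rewrite ?normr0 // ltW.
move=> ae be ab.
have d x : x \in `[a, b] -> is_derive x (1 : R) u 0.
  by move=> xab; apply: he => /=; move: xab ae be; rewrite in_itv /= !ltr_norml; lra.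
have cu : {within `[a, b], continuous u}.
  by apply: derivable_within_continuous => x /d[].
have du x : x \in `]a, b[ -> is_derive x (1 : R) u ((fun=> 0) x).
  by move=> xab; apply: d; exact: subset_itv_oo_cc.
have [x _] := MVT_segment ab du cu.
by rewrite mul0r => /eqP; rewrite subr_eq0 => /eqP.
Qed.

(** In the chart at any point of the line, [h] minus the translation has zero derivative along [c].
    So [g] is locally constant in [t], and connectedness of [R] gives all times although charts are
    only local. *)
Lemma torus_flow r (h : torus2 R -> torus2 R) (c : 'rV[R]_2) :
  le_reg 1 r -> torus_Cr r h -> (forall x, torus_D h x *m c^T = c^T) ->
  forall x t, h (x + torus_exp (t *: c)) = h x + torus_exp (t *: c).
Proof.
move=> r1 hr hc x t.
pose g t := h (x + torus_exp (t *: c)) - torus_exp (t *: c).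
suff : g t = g 0.
  by rewrite /g scale0r torus_exp0 addr0 subr0 => /eqP; rewrite subr_eq => /eqP.
apply: locally_constant => {}t.
pose y := x + torus_exp (t *: c); pose F := torus_local h y.
have Fc : {for 0, continuous F} by exact: (torus_Cr_continuous_local hr).
have dF : \forall v \near (0 : 'rV[R]_2), differentiable F v.
  by have [] := hr _ r1 y.
have DF : \forall v \near (0 : 'rV[R]_2), 'D_c F v = c.
  apply: filterS (derive_local_chart Fc) => v <-.
  apply: trmx_inj; rewrite torus_D_derive ?hc //.
  exact: (torus_Cr_differentiable _ r1 hr).
have lc : (fun s : R => s *: c) @ (0 : R) --> (0 : 'rV[R]_2).
  by rewrite -[X in _ --> X](scale0r c); exact: scalel_continuous.
pose u s := F (s *: c) - s *: c.
have du : \forall s \near (0 : R), is_derive s (1 : R) u 0.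
  have nF : nbhs (0 : R) [set s | differentiable F (s *: c) /\ 'D_c F (s *: c) = c].
    exact: lc _ (filterI dF DF).
  apply: (@filterS _ (nbhs (0 : R)) _ _ _ _ nF) => s [dFs DFs].
  have d1 := derive_line (diff_derivable (v := c) dFs).
  have d2 : is_derive s (1 : R) (fun s : R => s *: c) c.
    have did : derivable (@id 'rV[R]_2) (s *: c) c by exact: derivable_id.
    by have := derive_line did; rewrite derive_id.
  by have := is_deriveB d1 d2; rewrite DFs subrr.
(* One coordinate at a time, because the mean value theorem concerns real-valued functions. *)
have u0 i : \forall s \near (0 : R), u s ord0 i = 0.
  have z : u 0 ord0 i = 0 by rewrite /u scale0r subr0 /F torus_local0 mxE.
  suff : \forall s \near (0 : R), u s ord0 i = u 0 ord0 i by rewrite z.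
  apply: (@is_derive_zero_near (fun s => u s ord0 i)).
  apply: filterS du => s [dus us].
  apply: DeriveDef; first by move/derivable_mxP: dus.
  by have := derive_mx dus; rewrite us => /matrixP /(_ ord0 i); rewrite !mxE.
have un : \forall s \near (0 : R), F (s *: c) = s *: c.
  apply: filterS2 (u0 ord0) (u0 ord_max) => s a b.
  by apply/eqP; rewrite -subr_eq0 -/(u s); apply/eqP/rv2P; rewrite ?a ?b mxE.
apply/nbhs0P; apply: filterS un => s Fs.
have E : h (x + torus_exp ((t + s) *: c)) = h y + torus_exp (s *: c).
  by rewrite scalerDl torus_expD addrA -/y torus_local_exp -/F Fs.
by rewrite /g E scalerDl torus_expD opprD addrACA subrr addr0.
Qed.

End flows.

(** Every neighbourhood contains an open rectangle, which is measurable for the product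
    sigma-algebra and has positive mass, so it cannot lie in the null complement of [V]. *)
Lemma full_support_meets (R : realType) (m : {measure set (torus2 R) -> \bar R})
    (V B : set (torus2 R)) (x : torus2 R) :
  measure_support m = setT -> measurable V -> m (~` V) = 0%E ->
  nbhs x B -> exists2 y, V y & B y.
Proof.
move=> supp mV V0 [[B1 B2] /= [n1 n2] B12].
have mU (C : set (circle R)) : measurable C° by apply: open_circle_measurable; exact: open_interior.
have oU : open_nbhs x (B1° `*` B2°).
  split; last by split.
  by rewrite openE => -[a b] [/= a1 b2]; exists (B1°, B2°) => //=; split;
    apply: open_nbhs_nbhs; split => //; exact: open_interior.
have : measure_support m x by rewrite supp.
move=> /(_ _ oU) U0; apply: contrapT => h.
suff : (m (B1° `*` B2°) <= 0)%E by rewrite leNgt U0.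
rewrite -V0; apply: le_measure; rewrite ?inE; last first.
- move=> y [y1 y2] Vy; apply: h; exists y => //; apply: B12.
  by split; exact: interior_subset.
- exact: measurableC.
- exact: measurableX.
Qed.

(** As the derivative is continuous, the points where [c] is not fixed form a neighbourhood of each
    of them, which would meet the dense set [V]. *)
Lemma full_support_derivative (R : realType) (m : {measure set (torus2 R) -> \bar R})
    r (h : torus2 R -> torus2 R) (c : 'cV[R]_2) (V : set (torus2 R)) :
  measure_support m = setT -> measurable V -> m (~` V) = 0%E ->
  le_reg 1 r -> torus_Cr r h -> (forall y, V y -> torus_D h y *m c = c) ->
  forall x, torus_D h x *m c = c.
Proof.
move=> supp mV V0 r1 hr hV x.
have dh y : differentiable (torus_local h y) 0 by exact: (torus_Cr_differentiable _ r1 hr).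
pose G v := 'D_(c^T) (torus_local h x) v.
have DG y : ('D_(c^T) (torus_local h y) 0)^T = torus_D h y *m c.
  by rewrite torus_D_derive // trmxK.
have cG : G @ (0 : 'rV[R]_2) --> G 0.
  by have [_ /(_ c^T) /= /nbhs_singleton] := hr _ r1 x.
apply: contrapT => Dx.
have e0 : 0 < `|G 0 - c^T|.
  by rewrite normr_gt0 subr_eq0; apply/eqP => E; apply: Dx; rewrite -DG -/(G 0) E trmxK.
have nG : \forall v \near (0 : 'rV[R]_2), G v <> c^T.
  have H : \forall v \near (0 : 'rV[R]_2), `|G 0 - G v| < `|G 0 - c^T|.
    by move/cvgrPdist_lt: cG => /(_ _ e0).
  by apply: (@filterS _ (nbhs (0 : 'rV[R]_2)) _ _ _ _ H) => v + E; rewrite E ltxx.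
have chart := derive_local_chart (torus_Cr_continuous_local (x := x) hr).
have nB : nbhs x [set y | torus_D h y *m c <> c].
  rewrite nbhs_torus.
  apply: (@filterS2 _ (nbhs (0 : 'rV[R]_2)) _ _ _ _ _ nG chart) => v Gv ch /= E.
  by apply: Gv; rewrite /G -ch; apply: trmx_inj; rewrite DG trmxK.
have [y Vy] := full_support_meets supp mV V0 nB; apply; exact: hV.
Qed.

(** * The derivative cocycle of a random dynamical system *)

Section random_dynamics.
Context (R : realType) (d : measure_display) (Omega : measurableType d).
Context (P : probability Omega R) (T : automorphism P) (r : option nat).
Context (f : int -> Omega -> torus2 R -> torus2 R).
Context (mu : probability (Omega * torus2 R)%type R).

Lemma ae_fst (Q : Omega -> Prop) :
  (forall B, measurable B -> mu (B `*` setT) = P B) ->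
  (\forall omega \ae P, Q omega) -> \forall z \ae mu, Q z.1.
Proof.
move=> marg [N [mN N0 QN]]; exists (N `*` setT); split.
- exact: measurableX.
- by rewrite marg.
- by move=> z Qz; split => //; exact: QN.
Qed.

(** The sections of a null set have masses of integral 0, so almost all of these masses vanish. *)
Lemma disintegration_ae (k : R.-pker Omega ~> torus2 R)
    (Q : Omega * torus2 R -> Prop) :
  disintegration P mu k -> (\forall z \ae mu, Q z) ->
  \forall omega \ae P, exists V, [/\ measurable V, k omega (~` V) = 0%E &
    forall x, V x -> Q (omega, x)].
Proof.
move=> dk /ae_measurable_set[D [mD D0 DQ]].
have mCD := measurableC mD.
have mk : measurable_fun setT (fun omega => k omega (xsection (~` D) omega)).
  by apply: measurable_fun_xsection_finite_kernel; rewrite inE.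
have : \forall omega \ae P, k omega (xsection (~` D) omega) = 0%E.
  have : (\int[P]_omega `|k omega (xsection (~` D) omega)| = 0)%E.
    rewrite -D0 (dk _ mCD); apply: eq_integral => omega _.
    by rewrite gee0_abs.
  by move/(ae_eq_integral_abs P measurableT mk); apply: filterS => omega; exact.
apply: filterS => omega k0; exists (xsection D omega); split.
- exact: measurable_xsection.
- rewrite -k0; congr (k omega _); apply/seteqP.
  by split => x /=; rewrite /xsection /= !inE.
- by move=> x; rewrite /xsection /= inE; exact: DQ.
Qed.

Hypothesis rdsf : is_rds r T f.
Hypothesis r1 : le_reg 1 r.
Hypothesis inv : invariant_measure T f mu.

Definition rds_at omega : Prop :=
  [/\ f 0 omega = id,
      forall m n : int, f (m + n) omega = f m (aut_iter T n omega) \o f n omega &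
      forall n : int, torus_Cr r (f n omega)].

Lemma skew_iter omega x n : rds_at omega ->
  iter n (skew_map T f) (omega, x) = (iter n T omega, f n%:Z omega x).
Proof.
move=> [f0 fD _]; elim: n => [|n IHn] /=; first by rewrite f0.
by rewrite IHn /skew_map /= intS fD.
Qed.

Lemma measurable_torus_local (n : int) (v : 'rV[R]_2) i :
  measurable_fun setT
    (fun z : Omega * torus2 R => torus_local (f n z.1) z.2 v ord0 i).
Proof.
have [mf _] := rdsf; have {}mf := mf n.
have msub (g h : Omega * torus2 R -> circle R) : measurable_fun setT g ->
    measurable_fun setT h -> measurable_fun setT (fun z => circle_log (g z - h z)).
  move=> mg mh; apply: measurableT_comp; first exact: measurable_circle_log.
  rewrite (_ : (fun z => _) = fun z => g z + h z *~ -1); last first.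
    by apply/funext => z; rewrite mulrNz.
  by apply: measurable_circleD => //; exact: measurable_circleMz.
have mshift : measurable_fun setT
    (fun z : Omega * torus2 R => f n z.1 (z.2 + torus_exp v)).
  apply: (measurableT_comp mf (g := fun z : Omega * torus2 R => (z.1, z.2 + torus_exp v))).
  apply: measurable_fun_pair; first exact: measurable_fst.
  apply: measurable_fun_pair; apply: measurable_circleD; try exact: measurable_cst.
    exact: (measurableT_comp measurable_fst measurable_snd).
  exact: (measurableT_comp measurable_snd measurable_snd).
elim/ord2_ind: i; under eq_fun do rewrite mxE /=; apply: msub.
- exact: (measurableT_comp measurable_fst mshift).
- exact: (measurableT_comp measurable_fst mf).
- exact: (measurableT_comp measurable_snd mshift).
- exact: (measurableT_comp measurable_snd mf).
Qed.

Lemma rds_orbit : \forall omega \ae P, forall n, rds_at (iter n T omega).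
Proof. by have [_ h] := rdsf; exact: (ae_pullback_iter (aut_fun_mp T) h). Qed.

Lemma rds_differentiable n omega x : rds_at omega ->
  differentiable (torus_local (f n omega) x) 0.
Proof. by move=> [_ _ fr]; exact: (torus_Cr_differentiable _ r1 (fr n)). Qed.

Lemma cvg_difference_quotient (F : 'rV[R]_2 -> 'rV[R]_2) (v : 'rV[R]_2) i :
  differentiable F 0 -> F 0 = 0 ->
  k.+1%:R * F (k.+1%:R^-1 *: v) ord0 i @[k --> \oo] --> ('D_v F 0) ord0 i.
Proof.
move=> dF F0.
have harm : (fun k : nat => k.+1%:R^-1 : R) @ \oo --> (0 : R)^'.
  move=> A nA.
  have H : \forall k \near \oo, (k.+1%:R^-1 : R) != 0 -> A k.+1%:R^-1.
    exact: (@cvg_harmonic R _ nA).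
  apply: (@filterS _ (nbhs \oo) _ _ _ _ H) => k; apply.
  by rewrite invr_eq0 pnatr_eq0.
have dv := diff_derivable (v := v) dF.
have := cvg_comp _ _ harm dv; rewrite -/('D_v F 0) => c1.
have := cvg_comp _ _ c1 (@coord_continuous R 1 2 ord0 i ('D_v F 0)).
apply: cvg_trans; apply: near_eq_cvg; apply: nearW => k /=.
by rewrite addr0 F0 subr0 invrK mxE.
Qed.

(** The derivative is a limit of measurable difference quotients, with increments [1 / (k + 1)],
    only over those omega for which f is differentiable. Elsewhere it is replaced by 0. *)
Lemma rds_derivative_measurable : exists D : Omega * torus2 R -> 'M[R]_2,
  (forall i j, measurable_fun setT (fun z => D z i j)) /\
  \forall omega \ae P, forall x, D (omega, x) = torus_D (f 1 omega) x.
Proof.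
have [_ h] := rdsf; have [W [mW W0 WP]] := (ae_measurable_set h).
pose D (z : Omega * torus2 R) := \1_W z.1 *: torus_D (f 1 z.1) z.2.
exists D; split; last first.
  by apply: (ae_of_set mW W0) => omega Wo x; rewrite /D indicE mem_set // scale1r.
move=> i j.
apply: (@measurable_fun_cvg _ _ _ _ (fun k z => \1_W z.1 *
  (k.+1%:R * torus_local (f 1 z.1) z.2 (k.+1%:R^-1 *: delta_mx ord0 j) ord0 i))).
  move=> k; apply: measurable_funM.
    apply: (measurableT_comp _ measurable_fst); exact: measurable_indic.
  by apply: measurable_funM; [exact: measurable_cst|exact: measurable_torus_local].
move=> [omega x] _.
pose u k : R := k.+1%:R * torus_local (f 1 omega) x (k.+1%:R^-1 *: delta_mx ord0 j) ord0 i.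
change ((fun k => \1_W omega * u k) @ \oo --> D (omega, x) i j).
rewrite /D mxE indicE; have [Wo|nW] := pselect (W omega); last first.
  rewrite memNset //; have -> : (fun k => 0%:R * u k) = (fun=> 0).
    by apply/funext => k; rewrite mul0r.
  by rewrite mul0r; exact: cvg_cst.
have df := rds_differentiable 1 x (WP _ Wo).
rewrite mem_set // mul1r; have -> : (fun k => 1%:R * u k) = u.
  by apply/funext => k; rewrite mul1r.
have -> : torus_D (f 1 omega) x i j =
    ('D_(delta_mx ord0 j) (torus_local (f 1 omega) x) 0) ord0 i.
  by rewrite (deriveEjacobian _ df) -rowE !mxE.
exact: (cvg_difference_quotient df (torus_local0 _ _)).
Qed.

Lemma rds_fixed_direction tau :
  ergodic mu (skew_map T f) -> full_support P mu -> 0 < tau ->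
  polynomial_growth tau f mu ->
  1 <= tau /\ exists c : 'cV[R]_2, [/\ c != 0,
    \forall omega \ae P, forall x, torus_D (f 1 omega) x *m c = c &
    ~ \forall omega \ae P, forall x, torus_D (f 1 omega) x = 1%:M].
Proof.
move=> erg [k [dk sk]] tau0 [g [hg [A [mA A0 Ag]]]].
have [mpS marg] := inv.
have [D [mD DE]] := rds_derivative_measurable.
have DEz := ae_fst marg (ae_and rds_orbit (ae_pullback_iter (aut_fun_mp T) DE)).
(* The chain rule along an orbit. It needs the cocycle identities and the regularity at all
   [T^n omega], not only at omega. *)
have CE : \forall z \ae mu, forall n : nat,
    cocycle (skew_map T f) D n z = torus_D (f n%:Z z.1) z.2.
  apply: (ae_imp DEz) => -[omega x] /= [ho hD]; have r0 := ho 0%N.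
  have [f0 fD _] := r0; elim=> [|n IHn] /=; first by rewrite f0 torus_D_id.
  have fS : f n.+1%:Z omega = f 1 (iter n T omega) \o f n%:Z omega.
    by rewrite intS fD.
  rewrite IHn (skew_iter x n r0) hD fS.
  symmetry; apply: torus_D_comp; first exact: (rds_differentiable n%:Z x r0).
  exact: (rds_differentiable 1 _ (ho n)).
have cvgG : \forall z \ae mu,
    (n%:R `^ (- tau)) *: cocycle (skew_map T f) D n z @[n --> \oo] --> g z.
  by apply: (ae_imp (ae_and CE hg)) => z [Cz]; under eq_fun do rewrite -Cz.
split.
  by rewrite (growth_exponent_eq1 (G := g) mpS erg mD tau0 cvgG mA A0 Ag).
have [c c0 hc] := cocycle_fixed_vector (G := g) mpS erg mD cvgG mA A0 Ag.
have nD := cocycle_not_identity (G := g) mpS tau0 cvgG mA A0 Ag.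
have DEf := ae_fst marg DE.
exists c; split => //.
  (* The disintegration moves this to almost every point of almost every fibre, and full support
     then to every point. *)
  have hc' : \forall z \ae mu, torus_D (f 1 z.1) z.2 *m c = c.
    by apply: (ae_imp (ae_and hc DEf)) => -[omega x] /= [+ <-].
  have [_ hr] := rdsf.
  apply: filterS2 (ae_and hr sk) (disintegration_ae dk hc').
  move=> omega [[_ _ fr] ss] [V [mV V0 VP]].
  exact: (full_support_derivative ss mV V0 r1 (fr 1) VP).
move=> h; apply: nD; apply: (ae_imp (ae_and DEf (ae_fst marg h))).
move=> [omega x] /= [Dx hx]; by rewrite Dx hx.
Qed.

End random_dynamics.

(** * Rationality of the fixed direction *)

Section rational_directions.
Variable R : realType.

(** Pigeonhole principle: among the N + 1 fractional parts of the multiples of [s], two lie in the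
    same of N intervals of length [1 / N < e]. *)
Lemma dirichlet_approximation (s e : R) : 0 < e ->
  exists n m : int, n != 0 /\ `|n%:~R * s - m%:~R| < e.
Proof.
move=> e0; pose N := (Num.truncn e^-1).+1.
have Ne : e^-1 < N%:R by rewrite /N truncnS_gt.
have N0 : 0 < N%:R :> R by rewrite ltr0n.
pose fr (i : 'I_N.+1) : R := i%:R * s - (Num.floor (i%:R * s))%:~R.
have fr01 i : 0 <= fr i < 1.
  have /andP[h1 h2] := Num.Theory.floor_itv (i%:R * s : R).
  by rewrite intrD1 in h2; rewrite /fr; lra.
pose c i := Num.truncn (N%:R * fr i).
have cE i : (c i)%:R <= N%:R * fr i < (c i).+1%:R.
  by apply: truncn_itv; have /andP[h _] := fr01 i; rewrite mulr_ge0 // ltW.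
have cN i : (c i < N)%N.
  have /andP[_ h1] := fr01 i; have /andP[h2 _] := cE i.
  by rewrite -(ltr_nat R) (le_lt_trans h2) // gtr_pMr.
pose cc i : 'I_N := Ordinal (cN i).
have [i [j [ij cij]]] : exists i j, i != j /\ cc i = cc j.
  apply: contrapT => h.
  have inj : injective cc.
    move=> i j E; apply/eqP/negPn/negP => nij; apply: h.
    by exists i, j.
  by have := leq_card cc inj; rewrite !card_ord ltnn.
exists (i%:Z - j%:Z), (Num.floor (i%:R * s) - Num.floor (j%:R * s)); split.
  by rewrite subr_eq0; apply: contra ij => /eqP [E]; apply/eqP/val_inj.
rewrite !rmorphB /= mulrBl.
have -> : i%:~R * s - j%:~R * s -
    ((Num.floor (i%:R * s))%:~R - (Num.floor (j%:R * s))%:~R) = fr i - fr j.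
  by rewrite /fr; ring.
have cij' : c i = c j by have := congr1 val cij.
have /andP[hi1 hi2] := cE i; have /andP[hj1 hj2] := cE j.
rewrite cij' in hi1 hi2.
have : `|N%:R * fr i - N%:R * fr j| < 1.
  by move: hi1 hi2 hj1 hj2; rewrite -natr1 ltr_norml; lra.
rewrite -mulrBr normrM ger0_norm ?ltW // mulrC -ltr_pdivlMr // div1r => h.
by apply: (lt_trans h); rewrite invf_plt // posrE.
Qed.

(** Along a sequence of such [t] tending to 0, the difference quotients in the vertical direction
    are eventually constant. *)
Lemma small_translations_derivative r (h : torus2 R -> torus2 R) x :
  le_reg 1 r -> torus_Cr r h ->
  (forall e, 0 < e -> exists t, [/\ t != 0, `|t| < e &
    h (x + torus_exp (rv2 0 t)) = h x + torus_exp (rv2 0 t)]) ->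
  torus_D h x *m (rv2 0 1)^T = (rv2 0 1)^T.
Proof.
move=> r1 hr ht; set v := rv2 0 1; set F := torus_local h x.
have dF : differentiable F 0 by exact: (torus_Cr_differentiable _ r1 hr).
rewrite -torus_D_derive // -/F; congr trmx.
have /choice[t tP] : forall k : nat, exists t : R, t != 0 /\ `|t| < k.+1%:R^-1 /\
    (`|t| < 2^-1 -> F (t *: v) = t *: v).
  move=> k; have k0 : 0 < k.+1%:R^-1 :> R by rewrite invr_gt0.
  have [t [t0 te hx]] := ht _ k0; exists t; split => //; split => // t2.
  have -> : t *: v = rv2 0 t by apply: rv2P; rewrite !mxE /= ?mulr0 ?mulr1.
  rewrite /F /torus_local hx addrAC subrr add0r torus_expK // norm_rv2_lt ?invr_gt0 //.
  by rewrite rv2E0 rv2E1 normr0 t2 andbT.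
have t0 : t @ \oo --> (0 : R).
  apply/cvgr0Pnorm_lt => e e0.
  have := near_infty_natSinv_lt (PosNum e0); apply: filterS => k /= ke.
  by have [_ [tk _]] := tP k; exact: lt_trans ke.
have t0' : t @ \oo --> (0 : R)^'.
  move=> A nA; have H : \forall k \near \oo, t k != 0 -> A (t k) by exact: (t0 _ nA).
  apply: (@filterS _ (nbhs \oo) _ _ _ _ H) => k; apply.
  by have [] := tP k.
have dv := diff_derivable (v := v) dF.
have c1 := cvg_comp _ _ t0' dv; rewrite -/('D_v F 0) in c1.
have c2 : ((fun h : R => h^-1 *: ((F \o shift 0) (h *: v) - F 0)) \o t) @ \oo --> v.
  apply: (@cvg_trans _ ((fun=> v) @ \oo)); last exact: cvg_cst.
  apply: near_eq_cvg; near=> k.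
  have [tk0 [_ tkF]] := tP k.
  rewrite /= addr0 tkF; last first.
    near: k; have h0 : 0 < 2^-1 :> R by rewrite invr_gt0.
    by move/cvgr0Pnorm_lt: t0 => /(_ _ h0).
  by rewrite /F torus_local0 subr0 scalerA mulVf // scale1r.
exact: (@cvg_unique _ (@norm_hausdorff _ _) _ _ _ _ c1 c2).
Unshelve. all: by end_near. Qed.

Lemma two_fixed_vectors (M : 'M[R]_2) (c : 'cV[R]_2) : c ord0 ord0 != 0 ->
  M *m c = c -> M *m (rv2 0 1)^T = (rv2 0 1)^T -> M = 1%:M.
Proof.
move=> c0 Mc Me.
have E i : M i ord_max = (1%:M : 'M[R]_2) i ord_max.
  move/matrixP: Me => /(_ i ord0); rewrite mulmx2E !mxE /= mulr0 mulr1 add0r => ->.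
  by elim/ord2_ind: i.
apply/matrixP => i; apply: ord2_ind; last exact: E.
move/matrixP: Mc => /(_ i ord0); rewrite mulmx2E E => Mc.
apply: (mulIf c0); rewrite -[LHS](addrK ((1%:M : 'M[R]_2) i ord_max * c ord_max ord0)) Mc.
have : (1%:M *m c) i ord0 = c i ord0 by rewrite mul1mx.
by rewrite mulmx2E => <-; rewrite addrK.
Qed.

Lemma rational_direction r (c : 'cV[R]_2) : le_reg 1 r ->
  c != 0 ->
  (exists2 h, torus_Cr r h & (forall x, torus_D h x *m c = c) /\
    exists x, torus_D h x <> 1%:M) ->
  exists (q p : int) (s : R), [/\ coprimez q p, s != 0 &
    c^T = s *: rv2 q%:~R p%:~R].
Proof.
move=> r1 c0 [h hr [hc [x Dx]]].
have [c00|c00] := eqVneq (c ord0 ord0) 0.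
  exists 0, 1, (c ord_max ord0); split; first by rewrite /coprimez gcd0z.
    apply: contra c0 => /eqP c1; apply/eqP/matrixP => i j; rewrite ord1 mxE.
    by elim/ord2_ind: i.
  by apply: rv2P; rewrite !mxE /= ?mulr0 ?mulr1.
have [[n [m [n0 nm]]]|irr] := pselect (exists n m : int, n != 0 /\
    n%:~R * (c ord_max ord0 / c ord0 ord0) = m%:~R).
  have n0R : n%:~R != 0 :> R by rewrite intr_eq0.
  (* The slope in lowest terms: its denominator and numerator are the coprime coordinates looked
     for. *)
  pose rho : rat := m%:~R / n%:~R.
  have E : c ord_max ord0 / c ord0 ord0 = (numq rho)%:~R / (denq rho)%:~R.
    have -> : (numq rho)%:~R / (denq rho)%:~R = ratr rho :> R by [].
    by rewrite /rho fmorph_div /= !ratr_int -nm [RHS]mulrAC divff // mul1r.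
  have d0 : (denq rho)%:~R != 0 :> R by rewrite intr_eq0 denq_eq0.
  exists (denq rho); exists (numq rho); exists (c ord0 ord0 / (denq rho)%:~R); split.
  - by rewrite coprimez_sym; exact: coprime_num_den.
  - by rewrite mulf_neq0 // invr_eq0.
  - apply: rv2P; rewrite !mxE /=; first by rewrite divfK.
    by rewrite mulrAC -mulrA -E mulrC divfK.
exfalso; apply: Dx; apply: (two_fixed_vectors c00 (hc x)).
apply: (small_translations_derivative r1 hr) => e e0.
have [n [m [n0 nm]]] := dirichlet_approximation (c ord_max ord0 / c ord0 ord0) e0.
exists (n%:~R * (c ord_max ord0 / c ord0 ord0) - m%:~R); split => //.
  by rewrite subr_eq0; apply/eqP => E; apply: irr; exists n, m.
set t := _ - _.
(* Flowing along [c] for this time winds n times around the first circle and moves the second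
   coordinate by n times the slope, that is by [t] modulo 1. *)
have -> : torus_exp (rv2 0 t) = torus_exp ((n%:~R / c ord0 ord0) *: c^T).
  rewrite /torus_exp !rv2E0 !rv2E1 !mxE divfK //; congr pair.
    by rewrite circle_exp0 circle_exp_int.
  rewrite /t circle_expB circle_exp_int subr0; congr circle_exp; ring.
by apply: (torus_flow r1 hr) => y; rewrite trmxK.
Qed.

End rational_directions.

(** * Reduction to skew products *)

Section integer_torus_maps.
Variable R : realType.
Implicit Types a b c d : int.

Definition int_torus a b c d (x : torus2 R) : torus2 R :=
  (x.1 *~ a + x.2 *~ b, x.1 *~ c + x.2 *~ d).

Definition int_torus_mx a b c d : 'M[R]_2 :=
  \matrix_(i, j) (if i == ord0 then if j == ord0 then a else c
                  else if j == ord0 then b else d)%:~R.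

Lemma int_torus_linear a b c d :
  torus_linear (int_torus a b c d) (int_torus_mx a b c d).
Proof.
split=> [x y|v].
  by congr pair; rewrite /= !mulrzDl addrACA.
rewrite /int_torus /torus_exp !mulmx_rv2 !mxE /= !mulrzr.
by rewrite !circle_expD !circle_expMz.
Qed.

Lemma int_torusK a b c d : a * d - b * c = 1 ->
  cancel (int_torus a b c d) (int_torus d (- b) (- c) a).
Proof.
move=> det x; rewrite -[x]torus_logK.
have [_ ->] := int_torus_linear a b c d.
have [_ ->] := int_torus_linear d (- b) (- c) a.
rewrite -mulmxA -[X in _ *m X](_ : 1%:M = _) ?mulmx1 //.
have detR : a%:~R * d%:~R - b%:~R * c%:~R = 1 :> R.
  by rewrite -!intrM -intrB det.
apply/matrixP => i j; rewrite mulmx2E !mxE.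
by elim/ord2_ind: i; elim/ord2_ind: j; rewrite /= ?mulrNz ?mulr1n ?mulr0n;
  move: detR; lra.
Qed.

Lemma measurable_int_torus a b c d : measurable_fun setT (int_torus a b c d).
Proof.
by apply: measurable_fun_pair; apply: measurable_circleD; apply: measurable_circleMz;
  [exact: measurable_fst|exact: measurable_snd|
   exact: measurable_fst|exact: measurable_snd].
Qed.

Lemma torus_linear_homeomorphism A B (M N : 'M[R]_2) :
  torus_linear A M -> torus_linear B N -> cancel A B -> cancel B A ->
  homeomorphism A.
Proof.
move=> AM BN AB BA; exists B; split => //.
  exact: (torus_linear_continuous AM).
exact: (torus_linear_continuous BN).
Qed.

End integer_torus_maps.

Section conjugation.
Context (R : realType) (d : measure_display) (Omega : measurableType d).
Context (P : probability Omega R) (T : automorphism P) (r : option nat).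
Context (f : int -> Omega -> torus2 R -> torus2 R).
Context (A B : torus2 R -> torus2 R) (M N : 'M[R]_2).
Hypotheses (AM : torus_linear A M) (BN : torus_linear B N).
Hypotheses (AB : cancel A B) (BA : cancel B A).
Hypotheses (mA : measurable_fun setT A) (mB : measurable_fun setT B).
Hypothesis rdsf : is_rds r T f.

Definition conj_rds (n : int) (omega : Omega) : torus2 R -> torus2 R :=
  B \o f n omega \o A.

Lemma conj_rdsP : is_rds r T conj_rds.
Proof.
have [mf hf] := rdsf; split.
  move=> n; apply: (measurableT_comp mB).
  apply: (measurableT_comp (mf n) (g := fun z : Omega * torus2 R => (z.1, A z.2))).
  apply: measurable_fun_pair; first exact: measurable_fst.
  exact: measurableT_comp.
apply: filterS hf => omega [f0 fD fr]; split.
- by apply/funext => x; rewrite /conj_rds /= f0 /= AB.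
- by move=> m n; apply/funext => x; rewrite /conj_rds /= fD /= BA.
- by move=> n; exact: (torus_Cr_conj AM BN).
Qed.

Lemma conj_rds_algebraic : algebraically_conjugate P f conj_rds.
Proof.
exists A; split; first by have [] := AM.
  exact: (torus_linear_homeomorphism AM BN).
by apply: aeW => omega; apply/funext => x; rewrite /conj_rds /= BA.
Qed.

End conjugation.

Section skew_products.
Context (R : realType) (d : measure_display) (Omega : measurableType d).
Context (P : probability Omega R) (T : automorphism P) (r : option nat).
Context (f : int -> Omega -> torus2 R -> torus2 R).
Hypothesis rdsf : is_rds r T f.
Hypothesis vert : \forall omega \ae P, forall x y,
  f 1 omega (x + (0, y)) = f 1 omega x + (0, y).

(** One composition uses the cocycle identity at omega, the other the one at [T omega], where
    [aut_inv T (T omega) = omega] holds only almost surely. *)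
Lemma rds_inverse : \forall omega \ae P,
  cancel (f 1 omega) (f (- 1) (T omega)) /\ cancel (f (- 1) (T omega)) (f 1 omega).
Proof.
have [_ hf] := rdsf; have hfT := ae_pullback (aut_fun_mp T) hf.
apply: (ae_imp (ae_and (ae_and hf hfT) (aut_funK T))).
move=> omega [[[f0 fD _] [f0T fDT _]] TK]; split=> x.
  have := fD (- 1) 1; rewrite addNr f0 => /(congr1 (fun h => h x)) /=.
  by rewrite /aut_iter.
have := fDT 1 (- 1); rewrite subrr f0T => /(congr1 (fun h => h x)) /=.
by rewrite /aut_iter /= TK.
Qed.

Definition base_map omega (a : circle R) : circle R := (f 1 omega (a, 0)).1.

Definition fibre_map omega (a : circle R) : circle R := (f 1 omega (a, 0)).2.

Lemma skew_product_of_vertical : is_skew_product P f base_map fibre_map.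
Proof.
apply: filterS vert => omega h a b; rewrite addrC.
rewrite /base_map /fibre_map; have := h (a, 0) b.
have -> : (a, 0) + (0, b) = (a, b) :> torus2 R by congr pair; rewrite ?addr0 ?add0r.
move=> ->; case: (f 1 omega (a, 0)) => u v.
by congr pair; rewrite /= ?addr0 // addrC.
Qed.

Let measurable_f0 : measurable_fun setT (fun z : Omega * circle R => f 1 z.1 (z.2, 0)).
Proof.
have [mf _] := rdsf.
have mg : measurable_fun setT (fun z : Omega * circle R => (z.1, (z.2, 0 : circle R))).
  apply: measurable_fun_pair; first exact: measurable_fst.
  by apply: measurable_fun_pair; [exact: measurable_snd|exact: measurable_cst].
exact: (measurableT_comp (mf 1) mg).
Qed.

Lemma measurable_base_map : random_circle_map base_map.
Proof. exact: (measurableT_comp measurable_fst measurable_f0). Qed.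

Lemma measurable_fibre_map : random_circle_map fibre_map.
Proof. exact: (measurableT_comp measurable_snd measurable_f0). Qed.

Lemma base_map_diffeo : random_circle_diffeo P r base_map.
Proof.
split; first exact: measurable_base_map.
have [_ hf] := rdsf; have hfT := ae_pullback (aut_fun_mp T) hf.
apply: (ae_imp (ae_and (ae_and hf hfT) (ae_and rds_inverse skew_product_of_vertical))).
move=> omega [[[_ _ fr] [_ _ frT]] [[K1 K2] sk]].
pose g := f (- 1) (T omega).
exists (fun a => (g (a, 0)).1); split.
(* The height is chosen so that the image lies on the circle of height 0, where the candidate
   inverse is evaluated. *)
- move=> a; have := K1 (a, - fibre_map omega a).
  by rewrite sk addNr -/g => ->.
- move=> a; have := K2 (a, 0); rewrite -/g; case: (g (a, 0)) => u v.
  by rewrite sk => -[].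
- exact: (circle_Cr_fst (fr 1)).
- exact: (circle_Cr_fst (frT (- 1))).
Qed.

End skew_products.

(** * Circle homeomorphisms and their invariant measures *)

Section image_measure.
Context d d' (X : measurableType d) (Y : measurableType d') (R : realType).

Definition image_measure (m : {measure set X -> \bar R}) (f : X -> Y)
    (mf : measurable_fun setT f) : {measure set Y -> \bar R} :=
  measure_function_pushforward__canonical__measure_function_Measure m mf.

Lemma image_measureE m f mf A : @image_measure m f mf A = m (f @^-1` A).
Proof. by []. Qed.

End image_measure.

Section circle_position.
Variable R : realType.
Implicit Types (x y : circle R) (t : R).

(** The representative in [[0, 1[]. It cuts the circle at 0, as a distribution function requires,
    whereas [circle_log] is a chart around 0. *)
Definition circle_pos x : R :=
  if 0 <= circle_log x then circle_log x else circle_log x + 1.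

Lemma circle_exp1 : circle_exp 1 = 0 :> circle R.
Proof. by rewrite -[1]/(1%:~R) circle_exp_int. Qed.

Lemma circle_posK x : circle_exp (circle_pos x) = x.
Proof.
rewrite /circle_pos; case: ifP => _; last rewrite circle_expD circle_exp1 addr0;
exact: circle_logK.
Qed.

Lemma circle_pos_itv x : 0 <= circle_pos x < 1.
Proof.
by have h := circle_log_itv x; rewrite /circle_pos; have [h0|h0] := leP 0 (circle_log x); lra.
Qed.

Lemma circle_expK01 t : 0 <= t < 1 -> circle_pos (circle_exp t) = t.
Proof.
move=> ht; have := circle_pos_itv (circle_exp t).
have /circle_exp_eq[n ->] := circle_posK (circle_exp t).
move=> hn; suff -> : n = 0 by rewrite addr0.
have : (n%:~R : R) < 1 by lra.
have : (- 1 : R) < n%:~R by lra.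
by rewrite -(intrN _ 1) !ltr_int ltrz1; lia.
Qed.

Lemma measurable_circle_pos : measurable_fun setT (circle_pos).
Proof.
rewrite (_ : circle_pos = fun x => circle_log x +
    \1_(`]-oo, 0[%classic : set R) (circle_log x)); last first.
  apply/funext => x; rewrite /circle_pos indicE /=.
  have [x0|x0] := leP 0 (circle_log x).
    by rewrite memNset ?addr0 //= in_itv /= ltNge x0.
  by rewrite mem_set //= in_itv.
apply: measurable_funD; first exact: measurable_circle_log.
apply: measurableT_comp; last exact: measurable_circle_log.
exact: measurable_indic.
Qed.

(** [circle_pos] jumps at 0, but the values at both ends agree. The preimage of a closed set is
    therefore the image of a compact part of [[0, 1]], hence closed. *)
Lemma continuous_circle_pos_lift (u : R -> R) :
  continuous u -> circle_exp (u 0) = circle_exp (u 1) ->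
  continuous (fun x : circle R => circle_exp (u (circle_pos x))).
Proof.
move=> cu u01; set h := (fun x => _).
have hE t : 0 <= t <= 1 -> h (circle_exp t) = circle_exp (u t).
  move=> /andP[t0]; rewrite le_eqVlt => /orP[/eqP ->|t1].
    by rewrite /h circle_exp1 -circle_exp0 circle_expK01 ?lexx ?ltr01.
  by rewrite /h circle_expK01 // t0.
apply/continuous_closedP => C cC.
have cpt : compact (`[0, 1]%classic `&` (fun t => circle_exp (u t)) @^-1` C).
  apply: compact_closedI; first exact: segment_compact.
  apply: closed_comp => // t _.
  by apply: continuous_comp; [exact: cu|exact: continuous_circle_exp].
have -> : h @^-1` C = @circle_exp R @`
    (`[0, 1]%classic `&` (fun t => circle_exp (u t)) @^-1` C).
  apply/seteqP; split => [x Cx|_ [t [t01 Ct] <-]].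
    exists (circle_pos x); last exact: circle_posK.
    by split => //=; have := circle_pos_itv x; rewrite in_itv /=; lra.
  by rewrite /= hE //; move: t01; rewrite /= in_itv.
apply: (compact_closed (@circle_hausdorff R)); apply: continuous_compact => //.
by apply: continuous_subspaceT; exact: continuous_circle_exp.
Qed.

(** A continuous bijection from a compact space to a Hausdorff one is closed. *)
Lemma circle_homeomorphism (h h' : circle R -> circle R) :
  continuous h -> cancel h h' -> cancel h' h -> homeomorphism h.
Proof.
move=> ch hK h'K; exists h'; split => //; apply/continuous_closedP => C cC.
have -> : h' @^-1` C = h @` C.
  apply/seteqP; split => [x Cx|_ [y Cy <-]] /=; last by rewrite hK.
  by exists (h' x) => //; rewrite h'K.
apply: (compact_closed (@circle_hausdorff R)); apply: continuous_compact.
  exact: continuous_subspaceT.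
by rewrite -[C]setTI; apply: compact_closedI => //; exact: circle_compact.
Qed.

End circle_position.

(** * Distribution functions of measures on the circle *)

Section circle_distribution.
Variables (R : realType) (m : {measure set (circle R) -> \bar R}).
Hypothesis m1 : m setT = 1%E.
Implicit Types (x y : circle R) (s t : R).

Let mpos t : measurable [set y : circle R | circle_pos y < t].
Proof.
rewrite (_ : [set _ | _] = @circle_pos R @^-1` `]-oo, t[).
  by apply: measurable_preim => //; exact: measurable_circle_pos.
by apply/seteqP; split => y; rewrite /= in_itv.
Qed.

Let mposI s t : measurable [set y : circle R | s <= circle_pos y < t].
Proof.
rewrite (_ : [set _ | _] = @circle_pos R @^-1` `[s, t[).
  by apply: measurable_preim => //; exact: measurable_circle_pos.
by apply/seteqP; split => y; rewrite /= in_itv.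
Qed.

Lemma circle_fin (A : set (circle R)) : measurable A -> m A \is a fin_num.
Proof.
move=> mA; rewrite ge0_fin_numE ?measure_ge0 //.
apply: (@le_lt_trans _ _ (m setT)); last by rewrite m1 ltry.
by apply: le_measure; rewrite ?inE.
Qed.

Definition circle_cdf t : R := fine (m [set y | circle_pos y < t]).
Local Notation G := circle_cdf.

Lemma circle_cdfB s t : s <= t ->
  (G t - G s)%:E = m [set y | s <= circle_pos y < t].
Proof.
move=> st; rewrite EFinB !fineK ?circle_fin //.
have -> : m [set y | circle_pos y < t] = (m [set y : circle R | (circle_pos y < s)%R] +
    m [set y : circle R | (s <= circle_pos y < t)%R])%E.
  rewrite -measureU //.
    congr (m _); apply/seteqP; split => y /=.
      by move=> yt; have [ys|ys] := ltP (circle_pos y) s; [left|right; apply/andP].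
    by case => [ys|/andP[]//]; exact: lt_le_trans st.
  apply/seteqP; split => y //= -[ys /andP[sy _]].
  by move: ys; rewrite ltNge sy.
by rewrite addeAC subee ?add0e ?circle_fin.
Qed.

Lemma circle_cdf_homo s t : s <= t -> G s <= G t.
Proof. by move=> st; rewrite -subr_ge0 -lee_fin circle_cdfB. Qed.

Lemma circle_cdf_le0 t : t <= 0 -> G t = 0.
Proof.
move=> t0; rewrite /G (_ : [set _ | _] = set0) ?measure0 //.
apply/seteqP; split => y //= yt; have /andP[y0 _] := circle_pos_itv y.
by move: (lt_le_trans yt t0); rewrite ltNge y0.
Qed.

Lemma circle_cdf_ge1 t : 1 <= t -> G t = 1.
Proof.
move=> t1; rewrite /G (_ : [set _ | _] = setT) ?m1 //.
apply/seteqP; split => y //= _; have /andP[_ y1] := circle_pos_itv y.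
exact: lt_le_trans t1.
Qed.

Hypothesis full : forall U : set (circle R), open U -> U !=set0 -> (0 < m U)%E.
Hypothesis nonatomic : forall y, m [set y] = 0%E.

Lemma circle_cdf_lt s t : 0 <= s -> s < t -> t <= 1 -> G s < G t.
Proof.
move=> s0 st t1; rewrite -subr_gt0 -lte_fin circle_cdfB ?ltW //.
have oU : open (@circle_exp R @` `]s, t[) by apply: open_circle_exp; exact: interval_open.
apply: (@lt_le_trans _ _ (m (@circle_exp R @` `]s, t[))).
  apply: full => //; exists (circle_exp ((s + t) / 2)); exists ((s + t) / 2) => //.
  by rewrite /= in_itv /=; lra.
apply: le_measure; rewrite ?inE //; first exact: open_circle_measurable.
move=> _ [u + <-]; rewrite /= in_itv /= => ut.
by rewrite circle_expK01; lra.
Qed.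

(** An increment near [t] is at most the mass of a window around [t]. The windows shrink to at most
    one point, which is not an atom. *)
Lemma circle_cdf_continuous : continuous G.
Proof.
move=> t; apply/cvgrPdist_lt => e e0.
pose E n := [set y | t - n.+1%:R^-1 <= circle_pos y < t + n.+1%:R^-1].
have mE n : measurable (E n) by exact: mposI.
(* Only an inclusion: for [t] outside [[0, 1[] the intersection is empty. *)
have capE : \bigcap_n E n `<=` [set circle_exp t].
  move=> y hy; rewrite /= -[y]circle_posK; congr circle_exp.
  apply/eqP/negPn/negP => yt.
  have d0 : 0 < `|circle_pos y - t| by rewrite normr_gt0 subr_eq0.
  have [n _ hn] := near_infty_natSinv_lt (PosNum d0).
  have := hn n (leqnn n) => /=; have := hy n I; rewrite /E /=.
  move: n.+1%:R^-1 => a; have [ty|ty] := leP t (circle_pos y).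
    by rewrite ger0_norm ?subr_ge0 //; lra.
  by rewrite ltr0_norm ?subr_lt0 //; lra.
have mcap : measurable (\bigcap_n E n) by exact: bigcap_measurable.
have mc0 : m (\bigcap_n E n) = 0%E.
  apply/eqP; rewrite eq_le measure_ge0 andbT -(nonatomic (circle_exp t)).
  apply: le_measure; rewrite ?inE //.
  have -> : [set circle_exp t] = @circle_pos R @^-1` [set circle_pos (circle_exp t)].
    apply/seteqP; split => [y ->|y /= yt] //=.
    by rewrite -[y]circle_posK yt circle_posK.
  by apply: measurable_preim => //; exact: measurable_circle_pos.
have cE : m (E n) @[n --> \oo] --> 0%E.
  rewrite -mc0; apply: nonincreasing_cvg_mu => //.
    by rewrite ltey_eq circle_fin.
  move=> i j ij; apply/subsetPset => y; rewrite /E /=.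
  have : j.+1%:R^-1 <= i.+1%:R^-1 :> R by rewrite lef_pV2 ?posrE // ler_nat.
  by move: j.+1%:R^-1 i.+1%:R^-1 => a b; lra.
have nB : nbhs (0%E : \bar R) [set y | (y < e%:E)%E].
  by apply: open_nbhs_nbhs; split; [exact: open_ereal_lt_ereal|rewrite /= lte_fin].
have /filter_ex[n hn] : \forall n \near \oo, (m (E n) < e%:E)%E by exact: (cE _ nB).
have n0 : 0 < n.+1%:R^-1 :> R by rewrite invr_gt0.
have key s u : t - n.+1%:R^-1 <= s -> s <= u -> u <= t + n.+1%:R^-1 -> G u - G s < e.
  move=> ts su ut; rewrite -lte_fin circle_cdfB //; apply: le_lt_trans hn.
  apply: le_measure; rewrite ?inE // => y; rewrite /E /=.
  by move: n.+1%:R^-1 ts ut => a; lra.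
apply/nbhs_normP; exists n.+1%:R^-1 => //= s hs; rewrite /= ltr_norml in hs.
have [st|ts] := leP s t.
  rewrite ger0_norm ?subr_ge0 ?circle_cdf_homo //; apply: key => //.
    by move: n.+1%:R^-1 hs n0 => a; lra.
  by move: n.+1%:R^-1 hs n0 => a; lra.
rewrite distrC ger0_norm ?subr_ge0 ?circle_cdf_homo ?ltW //; apply: key; rewrite ?ltW //.
  by move: n.+1%:R^-1 hs n0 => a; lra.
by move: n.+1%:R^-1 hs n0 => a; lra.
Qed.

Lemma circle_cdf_itv x : 0 <= G (circle_pos x) < 1.
Proof.
have /andP[x0 x1] := circle_pos_itv x.
rewrite -(circle_cdf_le0 (lexx 0)) circle_cdf_homo //=.
by rewrite -(circle_cdf_ge1 (lexx 1)) circle_cdf_lt.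
Qed.

(** The distribution function read as a circle map. With full support and no atoms it is a
    homeomorphism taking [m] to arc length. *)
Definition circle_uniformize x : circle R := circle_exp (G (circle_pos x)).
Local Notation xi := circle_uniformize.

Lemma circle_uniformize_pos x : circle_pos (xi x) = G (circle_pos x).
Proof. by rewrite circle_expK01 // circle_cdf_itv. Qed.

Lemma circle_uniformize_inv : exists xi', cancel xi xi' /\ cancel xi' xi.
Proof.
have inj : injective xi.
  move=> x y /(congr1 (@circle_pos R)); rewrite !circle_uniformize_pos => E.
  have /andP[x0 x1] := circle_pos_itv x; have /andP[y0 y1] := circle_pos_itv y.
  rewrite -[x]circle_posK -[y]circle_posK; congr circle_exp; apply/eqP.
  rewrite eq_le !leNgt; apply/andP; split; apply/negP => lt.
    by have := circle_cdf_lt y0 lt (ltW x1); rewrite E ltxx.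
  by have := circle_cdf_lt x0 lt (ltW y1); rewrite E ltxx.
have /choice[xi' xi'K] : forall y, exists x, xi x = y.
  move=> y; have /andP[y0 y1] := circle_pos_itv y.
  have [t] : exists2 t, t \in `[0, 1] & G t = circle_pos y.
    apply: IVT => //; first by apply: continuous_subspaceT; exact: circle_cdf_continuous.
    rewrite (circle_cdf_le0 (lexx 0)) (circle_cdf_ge1 (lexx 1)).
    by rewrite (min_idPl _) // (max_idPr _) // y0 ltW.
  rewrite in_itv /= => /andP[t0 t1] Gt.
  have lt1 : t < 1.
    by rewrite lt_neqAle t1 andbT; apply: contraTneq y1 => E; rewrite -Gt E
      circle_cdf_ge1 // ltxx.
  by exists (circle_exp t); rewrite /xi circle_expK01 ?t0 // Gt circle_posK.
by exists xi'; split => // x; apply: inj; rewrite xi'K.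
Qed.

Lemma circle_uniformize_homeomorphism : homeomorphism xi.
Proof.
have [xi' [K1 K2]] := circle_uniformize_inv.
apply: (circle_homeomorphism _ K1 K2); apply: continuous_circle_pos_lift.
  exact: circle_cdf_continuous.
rewrite (circle_cdf_le0 (lexx 0)) (circle_cdf_ge1 (lexx 1)).
by rewrite circle_exp1 circle_exp0.
Qed.

(** Describes the sublevel sets of the inverse through the distribution function alone, which yields
    the joint measurability of a family of inverses. *)
Lemma circle_uniformize_inv_lt xi' y t : cancel xi' xi ->
  (circle_pos (xi' y) < t) = (circle_pos y < G t).
Proof.
move=> K; set a := circle_pos (xi' y).
have -> : circle_pos y = G a by rewrite -circle_uniformize_pos K.
have /andP[a0 a1] : 0 <= a < 1 by exact: circle_pos_itv.
have [t1|t1] := ltP 1 t.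
  rewrite (lt_trans a1 t1) (circle_cdf_ge1 (ltW t1)).
  by have /andP[_ ->] := circle_cdf_itv (xi' y).
have [t0|t0] := ltP t 0.
  rewrite (circle_cdf_le0 (ltW t0)) ltNge (ltW (lt_le_trans t0 a0)) /=.
  by have /andP[h _] := circle_cdf_itv (xi' y); rewrite ltNge h.
have [lt|ge] := ltP a t; first by rewrite circle_cdf_lt.
by apply/esym/negbTE; rewrite -leNgt; exact: circle_cdf_homo.
Qed.

Definition circle_arc x t : set (circle R) :=
  [set y | exists2 s, 0 <= s < t & y = x + circle_exp s].

(** If the arc passes through 0, it splits into a final and an initial segment of mass [1 - G a] and
    [G (a + t - 1)]. The extra 1 disappears modulo integers. *)
Lemma circle_arcE x t : 0 <= t < 1 ->
  [/\ measurable (circle_arc x t), m (circle_arc x t) \is a fin_num &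
      xi (x + circle_exp t) = xi x + circle_exp (fine (m (circle_arc x t)))].
Proof.
move=> /andP[t0 t1]; set a := circle_pos x.
have /andP[a0 a1] : 0 <= a < 1 by exact: circle_pos_itv.
have xE : x = circle_exp a by rewrite circle_posK.
have xiE : xi x = circle_exp (G a) by [].
have [at1|at1] := ltP (a + t) 1.
  have arcE : circle_arc x t = [set y | a <= circle_pos y < a + t].
    apply/seteqP; split => [_ [s /andP[s0 st] ->]|y /= /andP[ya yt]] /=.
      by rewrite xE -circle_expD circle_expK01; lra.
    exists (circle_pos y - a); first by lra.
    by rewrite xE -circle_expD subrKC circle_posK.
  have aat : a <= a + t by rewrite lerDl.
  rewrite arcE; split => //; first exact: circle_fin.
  rewrite -(circle_cdfB aat) /= xiE -circle_expD subrKC.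
  by rewrite /xi xE -circle_expD circle_expK01 // addr_ge0.
have aa1 : a <= 1 by exact: ltW.
have at0 : 0 <= a + t - 1 by rewrite subr_ge0.
have arcE : circle_arc x t =
    [set y | a <= circle_pos y < 1] `|` [set y | 0 <= circle_pos y < a + t - 1].
  apply/seteqP; split => [_ [s /andP[s0 st] ->]|y /= h] /=.
    rewrite xE -circle_expD; have [as1|as1] := ltP (a + s) 1.
      by left; rewrite circle_expK01; lra.
    right; rewrite (_ : circle_exp (a + s) = circle_exp (a + s - 1)).
      by rewrite circle_expK01; lra.
    by rewrite circle_expB circle_exp1 subr0.
  have /andP[y0 y1] := circle_pos_itv y.
  have [ay|ya] := leP a (circle_pos y).
    exists (circle_pos y - a); first by lra.
    by rewrite xE -circle_expD subrKC circle_posK.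
  have {h}/andP[_ yt] : 0 <= circle_pos y < a + t - 1.
    by case: h => // /andP[]; rewrite leNgt ya.
  exists (circle_pos y - a + 1); first by lra.
  by rewrite circle_expD circle_exp1 addr0 xE -circle_expD subrKC circle_posK.
have marc : measurable (circle_arc x t) by rewrite arcE; exact: measurableU.
split => //; first exact: circle_fin.
have -> : m (circle_arc x t) = ((1 - G a) + G (a + t - 1))%:E.
  transitivity (m [set y : circle R | (a <= circle_pos y < 1)%R] +
      m [set y : circle R | (0 <= circle_pos y < a + t - 1)%R])%E.
    rewrite arcE; apply: measureU => //.
    by apply/seteqP; split => y //= -[/andP[h1 h2] /andP[h3 h4]]; lra.
  rewrite -(circle_cdfB aa1) -(circle_cdfB at0) (circle_cdf_ge1 (lexx 1)).
  by rewrite (circle_cdf_le0 (lexx 0)) subr0.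
rewrite /= xiE -circle_expD [G a + _](_ : _ = G (a + t - 1) + 1); last by ring.
rewrite circle_expD circle_exp1 addr0 xE -circle_expD /xi.
have -> : circle_exp (a + t) = circle_exp (a + t - 1) :> circle R.
  by rewrite circle_expB circle_exp1 subr0.
by rewrite circle_expK01 //; lra.
Qed.

End circle_distribution.

(** * Increasing circle maps and the transport of arcs *)

Section circle_lifts.
Variable R : realType.
Implicit Types (F : circle R -> circle R) (x y : circle R) (s t : R).

Lemma circle_local_exp F x t :
  F (x + circle_exp t) = F x + circle_exp (circle_local F x t).
Proof. by rewrite /circle_local circle_logK subrKC. Qed.

Lemma circle_local0 F x : circle_local F x 0 = 0.
Proof. by rewrite /circle_local circle_exp0 addr0 subrr circle_log0. Qed.

(** Continuity and injectivity already make the chart map monotone. The derivative at 0 only decides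
    the sense, through one positive difference quotient. *)
Lemma circle_local_increasing r F x : le_reg 1 r -> circle_Cr r F -> injective F ->
  0 < 'D_1 (circle_local F x) 0 ->
  exists2 e, 0 < e <= 2^-1 &
    {in `]- e, e[, continuous (circle_local F x)} /\
    {in `]- e, e[ &, {mono circle_local F x : s t / s <= t}}.
Proof.
move=> r1 Fr Fi D0; set l := circle_local F x.
have /nbhs_norm0P[e1 /= e10 cl] := Fr _ (le_reg0 r) x.
(* With [e] at most 1/2, two parameters in []- e, e[] differ by less than 1, so [circle_exp] is
   injective there. *)
pose e := Num.min e1 2^-1.
have e0 : 0 < e by rewrite lt_min e10 /=; lra.
have ee1 : e <= e1 by rewrite ge_min lexx.
have e12 : e <= 2^-1 by rewrite ge_min lexx orbT.
exists e; first by rewrite e0.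
have cont : {in `]- e, e[, continuous l}.
  move=> t; rewrite in_itv /= -ltr_norml => te; apply: cl => /=.
  exact: lt_le_trans ee1.
split => //; apply: itv_continuous_inj_le.
- have dl : derivable l 0 1.
    apply: diff_derivable; have [/nbhs_singleton] := Fr _ r1 x; exact.
  have /cvgr_gt/(_ _ D0) : (fun h : R => h^-1 *: ((l \o shift 0) (h *: (1 : R)) - l 0))
      @ (0 : R)^' --> 'D_1 l 0 by exact: dl.
  move=> /nbhs_norm0P[e2 /= e20 q].
  pose h := Num.min e e2 / 2.
  have me : 0 < Num.min e e2 by rewrite lt_min e0.
  have h0 : 0 < h by rewrite divr_gt0.
  have me1 : Num.min e e2 <= e by rewrite ge_min lexx.
  have me2 : Num.min e e2 <= e2 by rewrite ge_min lexx orbT.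
  have he : h < e by rewrite /h; move: (Num.min e e2) me me1 => a; lra.
  have he2 : h < e2 by rewrite /h; move: (Num.min e e2) me me2 => a; lra.
  exists 0, h; split; rewrite ?in_itv //=; try by lra.
  have hne : h != 0 by rewrite gt_eqF.
  have habs : `|h| < e2 by rewrite ger0_norm // ltW.
  have := q h habs hne; rewrite /= addr0 /l circle_local0 subr0 [h *: 1]mulr1 /GRing.scale /=.
  by rewrite pmulr_rgt0 ?invr_gt0 // => /ltW.
- exact: continuous_subspace_itv.
- move=> s t; rewrite !in_itv /= => hs ht st.
  have : x + circle_exp s = x + circle_exp t.
    by apply: Fi; rewrite !circle_local_exp -/l st.
  move=> /addrI/circle_exp_eq[n stn].
  have : (n%:~R : R) < 1 by lra.
  have : (- 1 : R) < n%:~R by lra.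
  rewrite -(intrN _ 1) !ltr_int ltrz1 => n1 n2.
  by rewrite stn (_ : n = 0) ?addr0 //; lia.
Qed.

Variables (m m' : {measure set (circle R) -> \bar R}).
Hypotheses (m1 : m setT = 1%E) (m1' : m' setT = 1%E).

(* [circle_uniformize m] maps an arc to one whose length is its m-mass, and F,
   being increasing in the charts, maps short arcs to arcs. *)
Lemma circle_uniformize_equivariant r F : le_reg 1 r -> circle_Cr r F ->
  injective F -> (forall x, 0 < 'D_1 (circle_local F x) 0) ->
  (forall B, measurable B -> m' B = m (F @^-1` B)) ->
  forall x y, circle_uniformize m' (F x) - circle_uniformize m x =
              circle_uniformize m' (F y) - circle_uniformize m y.
Proof.
move=> r1 Fr Fi D0 mF; pose d x := circle_uniformize m' (F x) - circle_uniformize m x.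
suff H s t : d (circle_exp s) = d (circle_exp t).
  by move=> x y; have := H (circle_log x) (circle_log y); rewrite !circle_logK.
apply: (@locally_constant _ _ (fun s => d (circle_exp s))) => {s}{}t.
set x := circle_exp t; pose l := circle_local F x.
have [e /andP[e0 e2] [cl ml]] := circle_local_increasing r1 Fr Fi (D0 x).
suff loc s u : s \in `]- e, e[ -> u \in `]- e, e[ -> s <= u ->
    d (x + circle_exp s) = d (x + circle_exp u).
  apply/nbhs0P/nbhs_norm0P; exists e => //= s; rewrite /= ltr_norml => se.
  rewrite circle_expD -/x -[RHS](_ : d (x + circle_exp 0) = _); last first.
    by rewrite circle_exp0 addr0.
  have [s0|s0] := leP 0 s; first by apply/esym/loc; rewrite ?in_itv //=; lra.
  by apply: loc; rewrite ?in_itv //=; lra.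
move=> se ue su.
have lsu : l s <= l u by rewrite ml.
have lb v : - 2^-1 <= l v < 2^-1 by exact: circle_log_itv.
have h1 : 0 <= u - s < 1 by move: se ue; rewrite !in_itv /=; lra.
have h2 : 0 <= l u - l s < 1 by have := lb u; have := lb s; lra.
have [_ _ E1] := circle_arcE m1 (x + circle_exp s) h1.
have [mA _ E2] := circle_arcE m1' (F (x + circle_exp s)) h2.
have xu : x + circle_exp u = x + circle_exp s + circle_exp (u - s).
  by rewrite circle_expB -addrA subrKC.
have Fxu : F (x + circle_exp u) = F (x + circle_exp s) + circle_exp (l u - l s).
  by rewrite !circle_local_exp circle_expB -addrA subrKC.
(* The intermediate value theorem provides a preimage inside the arc, and injectivity of [F] makes
   it the only one. *)
have arcs : F @^-1` circle_arc (F (x + circle_exp s)) (l u - l s) =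
    circle_arc (x + circle_exp s) (u - s).
  apply/seteqP; split => y /=.
  - move=> [w /andP[w0 wu] Fy].
    have [v vsu lv] : exists2 v, v \in `[s, u] & l v = l s + w.
      apply: IVT => //; last by rewrite (min_idPl lsu) (max_idPr lsu); lra.
      apply: continuous_subspace_itv => v vsu; apply: cl.
      by move: se ue vsu; rewrite !in_itv /=; lra.
    have ve : v \in `]- e, e[ by move: se ue vsu; rewrite !in_itv /=; lra.
    exists (v - s).
      have : v < u by rewrite ltNge -ml // -/l leNgt lv; apply/negP/negPn; lra.
      by move: vsu; rewrite in_itv /=; lra.
    rewrite circle_expB -addrA subrKC; apply: Fi.
    by rewrite Fy !circle_local_exp -/l lv circle_expD addrA.
  - move=> [w /andP[w0 wu] ->].
    have we : s + w \in `]- e, e[ by move: se ue; rewrite !in_itv /=; lra.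
    exists (l (s + w) - l s).
      have : l s <= l (s + w) by rewrite ml // lerDl.
      have : l (s + w) < l u by rewrite ltNge /l ml // -ltNge; lra.
      lra.
    by rewrite -(addrA x) -(circle_expD s) !circle_local_exp circle_expB -addrA subrKC.
rewrite /d Fxu xu E1 E2 (mF _ mA) arcs.
by rewrite opprD addrACA subrr addr0.
Qed.

End circle_lifts.

(** * The measures on the base circle *)

Section kernel_fst.
Context d1 d2 d3 (X : measurableType d1) (Z : measurableType d2)
  (Y : measurableType d3) (R : realType) (k : R.-pker X ~> Y).

(** The kernel gets a second parameter so that it can be applied to sections depending on a point of
    the fibre as well as on omega. *)
Definition kernel_fst (z : X * Z) : {measure set Y -> \bar R} := k z.1.

Let measurable_kernel_fst U : measurable U -> measurable_fun setT (kernel_fst ^~ U).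
Proof.
by move=> mU; exact: (measurableT_comp (measurable_kernel k U mU) measurable_fst).
Qed.

HB.instance Definition _ :=
  @isKernel.Build _ _ (X * Z)%type Y R kernel_fst measurable_kernel_fst.

Let kernel_fst_prob z : kernel_fst z setT = 1%E.
Proof. exact: prob_kernel. Qed.

HB.instance Definition _ :=
  @Kernel_isProbability.Build _ _ (X * Z)%type Y R kernel_fst kernel_fst_prob.

Definition kernel_fst_pker : R.-pker (X * Z)%type ~> Y := kernel_fst.

End kernel_fst.

(** A countable generating class stable under intersections. Equalities proved almost surely for
    each fixed set can then be imposed on one common set of full measure. *)
Lemma measure_unique_rat_rays (R : realType) (m1 m2 : {measure set R -> \bar R}) :
  (m1 setT < +oo)%E ->
  (forall q : rat, m1 `]-oo, (ratr q : R)[%classic = m2 `]-oo, (ratr q : R)[%classic) ->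
  forall A, measurable A -> m1 A = m2 A.
Proof.
move=> fin1 m12; pose C : set (set R) := [set A | exists q : rat, A = `]-oo, (ratr q : R)[%classic].
have mC : (@measurable _ R) = <<s C >>.
  apply/seteqP; split; last first.
    by apply: smallest_sub; [exact: sigma_algebra_measurable|move=> _ [q ->]].
  move=> A mA; have : (@RGenInftyO.G R).-sigma.-measurable A.
    by rewrite -RGenInftyO.measurableE.
  change (<<s @RGenInftyO.G R >> A -> <<s C >> A).
  move: A {mA}; change (<<s @RGenInftyO.G R >> `<=` <<s C >>).
  apply: smallest_sub; first exact: smallest_sigma_algebra.
  move=> _ [x ->].
  have -> : `]-oo, x[%classic = \bigcup_(q : rat)
      (if (ratr q : R) < x then `]-oo, (ratr q : R)[%classic else set0).
    apply/seteqP; split => [y|y [q _]] /=.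
      rewrite in_itv /= => yx; have [q] := rat_in_itvoo yx.
      by rewrite in_itv /= => /andP[yq qx]; exists q => //; rewrite qx /= in_itv.
    by case: ifP => // qx; rewrite /= !in_itv /= => yq; exact: lt_trans qx.
  apply: (@bigcupT_measurable_rat _ (g_sigma_algebraType C)) => q.
  by case: ifP => // _; apply: sub_sigma_algebra; exists q.
apply: (measure_unique C (fun n => `]-oo, (ratr (n%:R : rat) : R)[%classic)) => //.
- move=> _ _ [p ->] [q ->]; exists (Num.min p q).
  apply/seteqP; split => y /=; rewrite !in_itv /=; have [pq|pq] := leP p q.
  + by case.
  + by case.
  + by move=> yp; split => //; apply: lt_le_trans yp _; rewrite ler_rat.
  + by move=> yq; split => //; apply: lt_le_trans yq _; rewrite ler_rat ltW.
- by move=> n; exists n%:R.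
- apply/seteqP; split => // y _; exists (Num.truncn `|y|).+1 => //=.
  rewrite in_itv /= ratr_nat; apply: (le_lt_trans (ler_norm y)).
  by rewrite truncnS_gt.
- by move=> A [q ->].
- by move=> n; apply: (le_lt_trans _ fin1); apply: le_measure; rewrite ?inE.
Qed.

(** * Equivariance and absence of atoms for the base measures *)

Section equivariance.
Context (R : realType) (d : measure_display) (Omega : measurableType d).
Context (P : probability Omega R) (T : automorphism P) (r : option nat).
Context (f : int -> Omega -> torus2 R -> torus2 R).
Context (mu : probability (Omega * torus2 R)%type R).
Context (k : R.-pker Omega ~> torus2 R).
Hypothesis rdsf : is_rds r T f.
Hypothesis inv : invariant_measure T f mu.
Hypothesis dk : disintegration P mu k.

Lemma disintegration_rect E W : measurable E -> measurable W ->
  mu (E `*` W) = (\int[P]_(omega in E) k omega W)%E.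
Proof.
move=> mE mW; rewrite (dk (measurableX mE mW)) [RHS]integral_mkcond.
apply: eq_integral => omega _; rewrite patchE; case: ifP => h.
  by rewrite in_xsectionX.
by rewrite notin_xsectionX ?h // measure0.
Qed.

(** Invariance of [mu] on the rectangle [E * W] says that both sides have the same integral over
    [T @^-1 E]. As [T] is invertible mod 0, these preimages exhaust the measurable sets up to null
    sets. *)
Lemma disintegration_equivariant W : measurable W ->
  \forall omega \ae P, k (T omega) W = k omega (f 1 omega @^-1` W).
Proof.
move=> mW; have [mf _] := rdsf; have [[mS pS] _] := inv.
have [mT pT] := aut_fun_mp T; have [mTi _] := aut_inv_mp T.
pose Q := (fun z : Omega * torus2 R => f 1 z.1 z.2) @^-1` W.
have mQ : measurable Q by exact: (measurable_preim (mf 1)).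
pose phi omega := k (T omega) W.
pose psi omega := k omega (xsection Q omega).
have mkW : measurable_fun setT (k ^~ W) by exact: measurable_kernel.
have mphi : measurable_fun setT phi by exact: (measurableT_comp mkW mT).
have mpsi : measurable_fun setT psi.
  by apply: measurable_fun_xsection_finite_kernel; rewrite inE.
have k1 omega V : measurable V -> (k omega V <= 1)%E.
  move=> mV; have <- : k omega setT = 1%E by exact: prob_kernel.
  by apply: le_measure; rewrite ?inE.
have eqT E : measurable E ->
    (\int[P]_(omega in T @^-1` E) phi omega = \int[P]_(omega in T @^-1` E) psi omega)%E.
  move=> mE; have mTE : measurable (T @^-1` E) by exact: measurable_preim.
  transitivity (mu (E `*` W)).
    rewrite disintegration_rect //.
    transitivity (\int[image_measure P mT]_(omega in E) k omega W)%E.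
      have mkE : measurable_fun E (k ^~ W) by exact: measurable_funTS.
      have k0 : {in E, forall omega, (0 <= k omega W)%E} by move=> omega _.
      exact: esym (ge0_integral_pushforward mT P mE mkE k0).
    by apply: eq_measure_integral => A mA _; exact: pT.
  rewrite -(pS _ (measurableX mE mW)).
  have mSEW : measurable (skew_map T f @^-1` (E `*` W)).
    by apply: measurable_preim => //; exact: measurableX.
  rewrite (dk mSEW) [RHS]integral_mkcond; apply: eq_integral => omega _.
  rewrite patchE /psi; case: ifP => h.
    congr (k omega _); apply/seteqP; split => x; rewrite /xsection /= !inE.
      by case.
    by split => //=; rewrite inE in h.
  rewrite (_ : xsection _ _ = set0) ?measure0 //.
  apply/seteqP; split => x //; rewrite /xsection /= inE => -[/= TE _].
  by rewrite mem_set in h.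
have : ae_eq P setT phi psi.
  apply: integral_ae_eq => //.
    apply: (le_integrable measurableT mphi (g := cst 1%E)).
      by move=> omega _ /=; rewrite gee0_abs // normr1 k1.
    exact: (finite_measure_integrable_cst P 1).
  (* The set [T @^-1 E'] agrees with [E] only almost everywhere, so the integrals over the two sets
     have to be identified. *)
  move=> E _ mE; pose E' := aut_inv T @^-1` E.
  have mE' : measurable E' by exact: measurable_preim.
  have mTE' : measurable (T @^-1` E') by exact: measurable_preim.
  have aeE (g : Omega -> \bar R) : measurable_fun setT g -> (forall omega, (0 <= g omega)%E) ->
      (\int[P]_(omega in E) g omega = \int[P]_(omega in T @^-1` E') g omega)%E.
    move=> mg g0; rewrite integral_mkcond [RHS]integral_mkcond.
    apply: ge0_ae_eq_integral => //.
    - by apply/(measurable_restrictT g mE); exact: measurable_funTS.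
    - by apply/(measurable_restrictT g mTE'); exact: measurable_funTS.
    - by move=> omega _; rewrite patchE; case: ifP.
    - by move=> omega _; rewrite patchE; case: ifP.
    - apply: (ae_imp (aut_funK T)) => omega TK _; rewrite !patchE.
      suff -> : (omega \in T @^-1` E') = (omega \in E) by [].
      by apply/idP/idP; rewrite !inE /E' /= TK.
  by rewrite !aeE //; exact: eqT.
move/ae_imp; apply => omega /(_ I); rewrite /phi /psi => ->.
by congr (k omega _); apply/seteqP; split => x; rewrite /xsection /= inE.
Qed.

Context (pi : torus2 R -> circle R) (F : Omega -> circle R -> circle R).
Hypothesis mpi : measurable_fun setT pi.
Hypothesis mF : random_circle_map F.
Hypothesis semiconj : \forall omega \ae P, forall x, pi (f 1 omega x) = F omega (pi x).

Let mFo omega : measurable_fun setT (F omega).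
Proof. exact: (measurable_fun_pair2 omega mF). Qed.

Definition base_measure omega : {measure set (circle R) -> \bar R} :=
  image_measure (k omega) mpi.

Lemma base_measureT omega : base_measure omega setT = 1%E.
Proof. by rewrite image_measureE preimage_setT prob_kernel. Qed.

Lemma base_measure_equivariant : \forall omega \ae P, forall B, measurable B ->
  base_measure (T omega) B = base_measure omega (F omega @^-1` B).
Proof.
have mpos : measurable_fun setT (@circle_pos R) by exact: measurable_circle_pos.
pose W (q : rat) := pi @^-1` (@circle_pos R @^-1` `]-oo, (ratr q : R)[%classic).
have mW q : measurable (W q) by do 2![apply: measurable_preim => //].
have hq : \forall omega \ae P, forall q : rat,
    k (T omega) (W q) = k omega (f 1 omega @^-1` W q).
  by apply: ae_forall_count => q; exact: disintegration_equivariant.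
apply: (ae_imp (ae_and hq semiconj)) => omega [{}hq sc] B mB.
pose m1 := image_measure (base_measure (T omega)) mpos.
pose m2 := image_measure (image_measure (base_measure omega) (mFo omega)) mpos.
have BE : B = @circle_pos R @^-1` (@circle_exp R @^-1` B).
  by apply/seteqP; split => x /=; rewrite circle_posK.
have meB : measurable (@circle_exp R @^-1` B).
  by apply: measurable_preim => //; exact: measurable_circle_exp.
suff : m1 (@circle_exp R @^-1` B) = m2 (@circle_exp R @^-1` B).
  change (base_measure (T omega) (@circle_pos R @^-1` (@circle_exp R @^-1` B)) =
    base_measure omega (F omega @^-1` (@circle_pos R @^-1` (@circle_exp R @^-1` B))) ->
    base_measure (T omega) B = base_measure omega (F omega @^-1` B)).
  by rewrite -BE.
apply: measure_unique_rat_rays => //.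
  change (base_measure (T omega) setT < +oo)%E.
  by rewrite base_measureT ltry.
move=> q; change (k (T omega) (W q) = k omega (pi @^-1` (F omega @^-1`
  (@circle_pos R @^-1` `]-oo, (ratr q : R)[%classic)))).
rewrite hq; congr (k omega _); apply/seteqP.
by split => x /=; rewrite /W /= sc.
Qed.

Hypothesis erg : ergodic mu (skew_map T f).
Hypothesis supp : \forall omega \ae P, measure_support (k omega) = setT.
Hypothesis cpi : continuous pi.
Context (sg : circle R -> torus2 R).
Hypothesis sgK : cancel sg pi.
Hypothesis Finj : \forall omega \ae P, injective (F omega).

Lemma base_measure_full : \forall omega \ae P, forall U : set (circle R),
  open U -> U !=set0 -> (0 < base_measure omega U)%E.
Proof.
apply: (ae_imp supp) => omega so U oU [y Uy].
have : measure_support (k omega) (sg y) by rewrite so.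
apply; split; first by apply: open_comp => // x _; exact: cpi.
by rewrite /= sgK.
Qed.

Lemma measurable_circle1 (y : circle R) : measurable [set y].
Proof.
rewrite (_ : [set y] = @circle_pos R @^-1` [set circle_pos y]).
  by apply: measurable_preim; [exact: measurable_circle_pos|exact: measurable_set1].
apply/seteqP; split => [x ->|x /= xy] //=.
by rewrite -[x]circle_posK xy circle_posK.
Qed.

Let heavy n := [set z : Omega * torus2 R |
  ((n.+1%:R^-1)%:E < base_measure z.1 [set pi z.2])%E].

(** The mass of the atom below a moving point is the kernel measure of a section of the set of pairs
    with equal projection, hence measurable in that point. *)
Let measurable_heavy n : measurable (heavy n).
Proof.
have mpos := @measurable_circle_pos R.
pose D := (fun w : (Omega * torus2 R) * torus2 R =>
  circle_pos (pi w.1.2) - circle_pos (pi w.2)) @^-1` [set 0].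
have mD : measurable D.
  apply: measurable_preim; last exact: measurable_set1.
  have m12 : measurable_fun setT (fun w : (Omega * torus2 R) * torus2 R => w.1.2).
    exact: (measurableT_comp measurable_snd measurable_fst).
  apply: measurable_funB.
    exact: (measurableT_comp mpos (measurableT_comp mpi m12)).
  exact: (measurableT_comp mpos (measurableT_comp mpi measurable_snd)).
pose kf : R.-pker (Omega * torus2 R)%type ~> torus2 R := kernel_fst_pker (torus2 R) k.
have mJ : measurable_fun setT (fun z => kf z (xsection D z)).
  by apply: measurable_fun_xsection_finite_kernel; rewrite inE.
have JE z : base_measure z.1 [set pi z.2] = kf z (xsection D z).
  rewrite image_measureE; congr (k z.1 _); apply/seteqP.
  split => x; rewrite /xsection /D /= inE /=.
    by move=> ->; rewrite subrr.
  by move=> /eqP; rewrite subr_eq0 => /eqP E; rewrite -[LHS]circle_posK -E circle_posK.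
rewrite (_ : heavy n = (fun z => kf z (xsection D z)) @^-1` `](n.+1%:R^-1)%:E, +oo[).
  by apply: measurable_preim => //; exact: emeasurable_itv.
by apply/seteqP; split => z; rewrite /heavy /= in_itv /= andbT JE.
Qed.

(* If [heavy n] had full measure, each of the n + 2 arcs of length 1 / (n + 2)
   would contain an atom of mass more than 1 / (n + 1). *)
Lemma base_measure_nonatomic :
  \forall omega \ae P, forall y, base_measure omega [set y] = 0%E.
Proof.
have [mpS marg] := inv.
(* By injectivity, F_omega carries an atom to an atom of the same mass. *)
have heavy_inv n : \forall z \ae mu, heavy n z <-> heavy n (skew_map T f z).
  have h := ae_fst marg (ae_and (ae_and base_measure_equivariant semiconj) Finj).
  apply: (ae_imp h) => -[omega x] /= [[eqv sc] inj].
  rewrite /heavy /= (eqv _ (measurable_circle1 _)) sc.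
  suff -> : F omega @^-1` [set F omega (pi x)] = [set pi x] by [].
  by apply/seteqP; split => y /= => [/inj|->].
have heavy0 n : mu (heavy n) = 0%E.
  have [//|] := ergodic_zero_one mpS erg (measurable_heavy n) (heavy_inv n).
  move=> /(ae_set1 (measurable_heavy n)) /(disintegration_ae dk) hV; exfalso.
  have [omega [[V [mV V0 VP]] so]] := ae_ex (ae_and hV supp).
  pose G := circle_cdf (base_measure omega).
  have m1 := base_measureT omega.
  have N0 : 0 < n.+2%:R :> R by rewrite ltr0n.
  have n0 : 0 < n.+1%:R :> R by rewrite ltr0n.
  have step i : (i < n.+2)%N -> G (i%:R / n.+2%:R) + n.+1%:R^-1 <= G (i.+1%:R / n.+2%:R).
    move=> iN; have lt : i%:R / n.+2%:R < i.+1%:R / n.+2%:R :> R.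
      by rewrite ltr_pM2r ?invr_gt0 // ltr_nat.
    rewrite addrC -lerBrDr -lee_fin (circle_cdfB m1 (ltW lt)).
    have i0 : 0 <= i%:R / n.+2%:R :> R by rewrite divr_ge0.
    have i1 : i.+1%:R / n.+2%:R <= 1 :> R by rewrite ler_pdivrMr // mul1r ler_nat.
    pose I : set R := `](i%:R / n.+2%:R), (i.+1%:R / n.+2%:R)[%classic.
    have oI : open (@circle_exp R @` I) by apply: open_circle_exp; exact: interval_open.
    pose c : R := (i%:R / n.+2%:R + i.+1%:R / n.+2%:R) / 2.
    have nU : nbhs (sg (circle_exp c)) (pi @^-1` (@circle_exp R @` I)).
      apply: open_nbhs_nbhs; split; first by apply: open_comp => // x _; exact: cpi.
      rewrite /= sgK; exists c => //; rewrite /I /= in_itv /= /c.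
      by move: (i%:R / _) (i.+1%:R / _) lt => a b ab; lra.
    have [x Vx [t It tx]] := full_support_meets so mV V0 nU.
    have := VP x Vx; rewrite /heavy /= => /ltW /le_trans; apply.
    have mI : measurable [set y : circle R | i%:R / n.+2%:R <= circle_pos y < i.+1%:R / n.+2%:R].
      rewrite (_ : [set y | _] = @circle_pos R @^-1` `[i%:R / n.+2%:R, i.+1%:R / n.+2%:R[).
        by apply: measurable_preim => //; exact: measurable_circle_pos.
      by apply/seteqP; split => y; rewrite /= in_itv.
    apply: le_measure; rewrite ?inE //; first exact: measurable_circle1.
    move=> _ ->; rewrite /= -tx; move: It; rewrite /I /= in_itv /= => It.
    rewrite circle_expK01; move: (i%:R / _) (i.+1%:R / _) It i0 i1 => a b; lra.
  (* At [i = n + 2] this bounds the total mass 1 from below by [(n + 2) / (n + 1)]. *)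
  have lb i : (i <= n.+2)%N -> i%:R / n.+1%:R <= G (i%:R / n.+2%:R).
    elim: i => [_|i IHi iN]; first by rewrite !mul0r /G circle_cdf_le0.
    apply: (le_trans _ (step i iN)); rewrite -natr1 mulrDl mul1r lerD2r.
    by apply: IHi; exact: ltnW.
  have := lb n.+2 (leqnn _); rewrite divff ?gt_eqF // /G (circle_cdf_ge1 m1 (lexx 1)).
  by rewrite ler_pdivrMr // mul1r ler_nat ltnn.
have light : \forall z \ae mu, forall n, ~ heavy n z.
  apply: ae_foralln => n; exists (heavy n); split.
  - exact: measurable_heavy.
  - exact: heavy0.
  - by move=> z /= /contrapT.
apply: (ae_imp (disintegration_ae dk light)) => omega [V [mV V0 VP]] y.
have my := measurable_circle1 y.
have mpy : measurable (pi @^-1` [set y]) by exact: measurable_preim.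
(* Either some point over [y] lies in no [heavy n], which bounds the mass of [y] by every
   [1 / (n + 1)], or the fibre over [y] lies in the null complement of [V]. *)
have [[x [Vx xy]]|nx] := pselect (exists x, V x /\ pi x = y).
  apply/eqP; rewrite eq_le measure_ge0 andbT leNgt; apply/negP => y0.
  have fin : base_measure omega [set y] \is a fin_num.
    exact: (circle_fin (base_measureT omega)).
  move: y0; rewrite -(fineK fin) lte_fin => y0.
  have [n _ hn] := near_infty_natSinv_lt (PosNum y0).
  apply: (VP x Vx n); rewrite /heavy /= xy -(fineK fin) lte_fin.
  exact: (hn n (leqnn n)).
apply: (subset_measure0 mpy (measurableC mV) _ V0).
by move=> x xy Vx; apply: nx; exists x.
Qed.

End equivariance.

(** * Powers of an automorphism mod 0 *)

Section automorphism_powers.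
Context (R : realType) (d : measure_display) (Omega : measurableType d).
Context (P : probability Omega R) (T : automorphism P).

Lemma aut_iter_mp n : measure_preserving P (aut_iter T n).
Proof.
by case: n => m; [exact: (mp_iter m (aut_fun_mp T))|exact: (mp_iter m.+1 (aut_inv_mp T))].
Qed.

Lemma aut_iter_succ : \forall omega \ae P, forall n : int,
  aut_iter T (n + 1) omega = T (aut_iter T n omega) /\
  aut_iter T (n - 1) omega = aut_inv T (aut_iter T n omega).
Proof.
have h1 := ae_pullback_iter (aut_fun_mp T) (aut_funK T).
have h2 := ae_pullback_iter (aut_inv_mp T) (aut_invK T).
apply: (ae_imp (ae_and h1 h2)) => omega [K1 K2] [m|m].
  split; first by rewrite -PoszD addn1.
  case: m => [//|m]; have -> : (m.+1%:Z - 1 = m)%R by lia.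
  by rewrite /= K1.
split; last by have -> : (Negz m - 1 = Negz m.+1)%R by lia.
rewrite [aut_iter _ (Negz m) _]/= K2.
by case: m => [//|m]; have -> : (Negz m.+1 + 1 = Negz m)%R by lia.
Qed.

(** [aut_inv T] inverts [T] only almost surely, so the group law needs the inversion along the whole
    two-sided orbit: countably many null sets are removed. *)
Lemma aut_iterD : \forall omega \ae P, forall m n : int,
  aut_iter T (m + n) omega = aut_iter T m (aut_iter T n omega).
Proof.
have h : \forall omega \ae P, forall n : int, forall m : int,
    aut_iter T (m + 1) (aut_iter T n omega) = T (aut_iter T m (aut_iter T n omega)) /\
    aut_iter T (m - 1) (aut_iter T n omega) = aut_inv T (aut_iter T m (aut_iter T n omega)).
  by apply: ae_forall_count => n; exact: (ae_pullback (aut_iter_mp n) aut_iter_succ).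
apply: (ae_imp (ae_and aut_iter_succ h)) => omega [h1 h2] m n; move: m.
apply: int_ind => [|m IH|m IH]; first by rewrite add0r.
  have -> : (m.+1%:Z = m%:Z + 1)%R by lia.
  by rewrite addrAC (h1 _).1 (h2 _ _).1 IH.
have -> : (- (m.+1)%:Z = - m%:Z - 1)%R by lia.
by rewrite addrAC (h1 _).2 (h2 _ _).2 IH.
Qed.

End automorphism_powers.

(** * Measurable dependence of the uniformization on omega *)

Section random_uniformization.
Context (R : realType) (d : measure_display) (Omega : measurableType d).
Context (P : probability Omega R) (m : Omega -> {measure set (circle R) -> \bar R}).
Hypothesis m1 : forall omega, m omega setT = 1%E.
Hypothesis mm : forall B, measurable B -> measurable_fun setT (fun omega => m omega B).
Hypothesis full : \forall omega \ae P,
  forall U : set (circle R), open U -> U !=set0 -> (0 < m omega U)%E.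
Hypothesis nonatomic : \forall omega \ae P, forall y, m omega [set y] = 0%E.

Lemma random_circle_uniformize : exists xi xi' : Omega -> circle R -> circle R,
  [/\ random_circle_map xi, random_circle_map xi',
      forall omega, [/\ cancel (xi omega) (xi' omega), cancel (xi' omega) (xi omega),
        continuous (xi omega) & continuous (xi' omega)] &
      \forall omega \ae P, xi omega = circle_uniformize (m omega)].
Proof.
have [D [mD D0 Dgood]] := ae_measurable_set (ae_and full nonatomic).
have mpos := @measurable_circle_pos R.
(* The identity outside of D, so that xi omega is a homeomorphism for all omega. *)
pose H omega t : R := if omega \in D then circle_cdf (m omega) t else t.
pose xi omega x := circle_exp (H omega (circle_pos x)).
have xiD omega : D omega -> xi omega = circle_uniformize (m omega).
  by move=> Do; apply/funext => x; rewrite /xi /H mem_set.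
have xiN omega : ~ D omega -> xi omega = id.
  by move=> Do; apply/funext => x; rewrite /xi /H memNset //= circle_posK.
have /choice[xi' xi'P] : forall omega, exists x' : circle R -> circle R,
    [/\ cancel (xi omega) x', cancel x' (xi omega), continuous (xi omega), continuous x' &
      forall y t, (circle_pos (x' y) < t) = (circle_pos y < H omega t)].
  move=> omega; have [Do|Do] := pselect (D omega).
    have [fu na] := Dgood _ Do; rewrite xiD //.
    have [x' [K1 K2 c1 c2]] := circle_uniformize_homeomorphism (m1 omega) fu na.
    exists x'; split => // y t; rewrite /H mem_set //.
    exact: (circle_uniformize_inv_lt (m1 omega) fu y t K2).
  rewrite xiN //; exists id; split => //; try by move=> x; exact: cvg_id.
  by move=> y t; rewrite /H memNset.
have mH t : measurable_fun setT (H ^~ t).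
  have mb : measurable_fun setT (fun omega => omega \in D).
    apply: (measurable_fun_bool true); rewrite setTI (_ : _ @^-1` _ = D) //.
    by apply/seteqP; split => omega /= h; [exact: (set_mem h)|exact: (mem_set h)].
  have mc : measurable_fun setT (fun omega => circle_cdf (m omega) t).
    apply: (measurableT_comp (@fine_measurable R setT measurableT)).
    apply: mm; rewrite (_ : [set y | _] = @circle_pos R @^-1` `]-oo, t[).
      by apply: measurable_preim => //; exact: mpos.
    by apply/seteqP; split => y; rewrite /= in_itv.
  exact: (measurable_fun_ifT mb mc (measurable_cst t)).
have Hhomo omega s t : s <= t -> H omega s <= H omega t.
  by rewrite /H; case: ifP => // _; exact: (circle_cdf_homo (m1 omega)).
have Hcont omega : continuous (H omega).
  have [Do|Do] := pselect (D omega); last first.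
    rewrite (_ : H omega = id); first by move=> x; exact: cvg_id.
    by apply/funext => t; rewrite /H memNset.
  have [_ na] := Dgood _ Do.
  rewrite (_ : H omega = circle_cdf (m omega)); first exact: (circle_cdf_continuous (m1 omega) na).
  by apply/funext => t; rewrite /H mem_set.
(* Since [H] is increasing and continuous in [t], it exceeds [a] at [t] exactly when it does so at
   some rational below [t]. This gives a countable union of rectangles. *)
have mHH : measurable_fun setT (fun z : Omega * R => H z.1 z.2).
  apply: (measurability _ (RGenOInfty.measurableE R)) => _ [_ [a ->] <-].
  rewrite setTI (_ : _ @^-1` _ = \bigcup_(q : rat)
      (((H ^~ (ratr q : R)) @^-1` `]a, +oo[) `*` `](ratr q : R), +oo[%classic)).
    apply: bigcupT_measurable_rat => q; apply: measurableX => //.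
    exact: measurable_preim.
  apply/seteqP; split => [[omega t]|[omega t] [q _]] /=; rewrite !in_itv /= !andbT.
    move=> aH; have /cvgrPdist_lt/(_ (H omega t - a)) := Hcont omega t.
    rewrite subr_gt0 => /(_ aH) [e /= e0 he].
    have [q] : exists q : rat, (ratr q : R) \in `]t - e, t[.
      by apply: rat_in_itvoo; rewrite ltrBlDr ltrDl.
    rewrite in_itv /= => /andP[q1 q2]; exists q => //=.
    rewrite !in_itv /= !andbT; split => //.
    have := he (ratr q : R); rewrite /ball_ /= ger0_norm; last lra.
    by rewrite ltr_norml => h; have /h/andP[_] : t - ratr q < e; lra.
  by move=> [h1 h2]; apply: lt_le_trans h1 _; exact: Hhomo (ltW h2).
exists xi, xi'; split.
- have mg : measurable_fun setT (fun z : Omega * circle R => (z.1, circle_pos z.2)).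
    apply: measurable_fun_pair; first exact: measurable_fst.
    exact: (measurableT_comp mpos measurable_snd).
  exact: (measurableT_comp (@measurable_circle_exp R) (measurableT_comp mHH mg)).
(* The inverses were chosen separately for each omega. Their measurability comes from the last
   property in [xi'P], which expresses their sublevel sets by [H]. *)
- rewrite /random_circle_map (_ : (fun z => _) =
    @circle_exp R \o (fun z : Omega * circle R => circle_pos (xi' z.1 z.2))); last first.
    by apply/funext => z /=; rewrite circle_posK.
  apply: (measurableT_comp (@measurable_circle_exp R)).
  apply: (measurability _ (RGenCInfty.measurableE R)) => _ [_ [a ->] <-].
  rewrite setTI (_ : _ @^-1` _ = ~` ((fun z : Omega * circle R => circle_pos z.2 - H z.1 a) @^-1` `]-oo, 0[)).
    apply: measurableC; apply: measurable_preim => //.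
    apply: measurable_funB; first exact: (measurableT_comp mpos measurable_snd).
    exact: (measurableT_comp (mH a) measurable_fst).
  apply/seteqP; split => -[omega y] /=; rewrite !in_itv /= ?andbT subr_lt0;
    have [_ _ _ _ <-] := xi'P omega; rewrite ?andbT leNgt.
    by move=> /negP.
  by move=> h; apply/negP.
- by move=> omega; have [] := xi'P omega.
- exists (~` D); split; [exact: measurableC|exact: D0|].
  by move=> omega /=; apply: contra_not; exact: xiD.
Qed.

End random_uniformization.

(** * Orientation and the derivative of the base map *)

Section oriented_skew_products.
Context (R : realType) (r : option nat) (h : torus2 R -> torus2 R).
Hypotheses (r1 : le_reg 1 r) (hr : torus_Cr r h).

Lemma torus_D_vertical x : (forall y, h (x + (0, y)) = h x + (0, y)) ->
  torus_D h x *m (rv2 0 1)^T = (rv2 0 1)^T.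
Proof.
move=> hv; have dh := torus_Cr_differentiable x r1 hr; pose c : 'rV[R]_2 := rv2 0 1.
rewrite -(torus_D_derive _ dh); congr trmx.
have dh0 : differentiable (torus_local h x) (0 *: c) by rewrite scale0r.
have d1 := derive_line (diff_derivable (v := c) dh0).
have d2 : is_derive (0 : R) (1 : R) (fun s : R => s *: c) c.
  have did : derivable (@id 'rV[R]_2) (0 *: c) c by exact: derivable_id.
  by have := derive_line did; rewrite derive_id.
have lc (w : 'rV[R]_2) : (fun s : R => s *: w) @ (0 : R) --> (0 : 'rV[R]_2).
  by rewrite -[X in _ --> X](scale0r w); exact: scalel_continuous.
have h0 : 0 < 2^-1 :> R by rewrite invr_gt0.
have E : \forall s \near (0 : R), torus_local h x (s *: c) = s *: c.
  have hn : \forall s \near (0 : R), `|s *: c| < 2^-1 by exact: (lc c _ (@near0_norm_lt R 'rV[R]_2 _ h0)).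
  apply: (@filterS _ (nbhs (0 : R)) _ _ _ _ hn) => s /= hs.
  rewrite -[RHS](torus_expK hs) /torus_local; congr torus_log.
  have -> : torus_exp (s *: c) = (0, circle_exp s).
    by rewrite /torus_exp !mxE /= mulr0 mulr1 circle_exp0.
  by rewrite hv addrAC subrr add0r.
rewrite -[LHS](_ : 'D_c (torus_local h x) (0 *: c) = _); last by rewrite scale0r.
by rewrite -[LHS](@derive_val _ _ _ _ _ _ _ d1) (near_eq_derive _ E) (@derive_val _ _ _ _ _ _ _ d2).
Qed.

(** The derivative of [h] fixes the vertical vector, so it is lower triangular with last diagonal
    entry 1. Its determinant is the derivative of [F]. *)
Lemma circle_local_derivative_gt0 (F phi : circle R -> circle R) :
  (forall x1 x2, h (x1, x2) = (F x1, x2 + phi x1)) ->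
  orientation_preserving h -> forall x, 0 < 'D_1 (circle_local F x) 0.
Proof.
move=> hF oh x; pose y : torus2 R := (x, 0).
have hv z : h (y + (0, z)) = h y + (0, z).
  have -> : y + (0, z) = (x + 0, 0 + z) by [].
  rewrite !hF addr0 add0r.
  have -> : (F x, 0 + phi x) + (0, z) = (F x + 0, 0 + phi x + z) by [].
  by rewrite addr0 add0r addrC.
have Mv := torus_D_vertical hv.
have dh := torus_Cr_differentiable y r1 hr; pose c : 'rV[R]_2 := rv2 1 0.
have dh0 : differentiable (torus_local h y) (0 *: c) by rewrite scale0r.
have dc := diff_derivable (v := c) dh0.
have dc0 := diff_derivable (v := c) dh.
have Fx : 'D_1 (circle_local F x) 0 = torus_D h y ord0 ord0.
  have -> : torus_D h y ord0 ord0 = (torus_D h y *m c^T) ord0 ord0.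
    by rewrite mulmx2E !mxE /= mulr1 mulr0 addr0.
  rewrite -(torus_D_derive _ dh) mxE (derive_mx dc0) mxE.
  have /derivable_mxP/(_ ord0 ord0) dL := dc.
  have [_ dF] := derive_line dL.
  rewrite scale0r in dF.
  suff -> : circle_local F x = (fun t : R => torus_local h y (t *: c) ord0 ord0) by [].
  apply/funext => t; rewrite /circle_local /torus_local /torus_log mxE /=.
  have -> : y + torus_exp (t *: c) = (x + circle_exp t, 0).
    by rewrite /torus_exp !mxE /= mulr1 mulr0 circle_exp0; congr pair; rewrite /= ?addr0.
  by rewrite !hF.
have := oh y; rewrite det_trig.
  rewrite !big_ord_recl big_ord0 /= mulr1 Fx.
  have := congr1 (fun A : 'cV[R]_2 => A ord_max ord0) Mv.
  rewrite mulmx2E !mxE /= mulr0 add0r mulr1.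
  have -> : lift ord0 ord0 = ord_max :> 'I_2 by apply/val_inj.
  by rewrite -/y => ->; rewrite mulr1.
apply/is_trig_mxP; apply: ord2_ind; apply: ord2_ind => //= _.
have := congr1 (fun A : 'cV[R]_2 => A ord0 ord0) Mv.
by rewrite mulmx2E !mxE /= mulr0 add0r mulr1.
Qed.

End oriented_skew_products.

(** * Conjugation by a random homeomorphism *)

Section random_conjugation.
Context (R : realType) (d : measure_display) (Omega : measurableType d).
Context (P : probability Omega R) (T : automorphism P) (r : option nat).
Context (f : int -> Omega -> torus2 R -> torus2 R).
Context (Theta Theta' : Omega -> torus2 R -> torus2 R).
Hypothesis rdsf : is_rds r T f.
Hypothesis mTheta : measurable_fun setT (fun z : Omega * torus2 R => Theta z.1 z.2).
Hypothesis mTheta' : measurable_fun setT (fun z : Omega * torus2 R => Theta' z.1 z.2).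
Hypothesis ThetaK : forall omega, cancel (Theta omega) (Theta' omega).
Hypothesis Theta'K : forall omega, cancel (Theta' omega) (Theta omega).
Hypothesis cTheta : forall omega, continuous (Theta omega).
Hypothesis cTheta' : forall omega, continuous (Theta' omega).

Definition random_conj (n : int) (omega : Omega) : torus2 R -> torus2 R :=
  Theta (aut_iter T n omega) \o f n omega \o Theta' omega.

Lemma random_conjP : is_rds (Some 0%N) T random_conj.
Proof.
have [mf hf] := rdsf; split.
  move=> n; have [mTn _] := aut_iter_mp T n.
  have mg1 : measurable_fun setT (fun z : Omega * torus2 R => (z.1, Theta' z.1 z.2)).
    by apply: measurable_fun_pair; [exact: measurable_fst|exact: mTheta'].
  have mg2 : measurable_fun setT (fun z : Omega * torus2 R =>
      (aut_iter T n z.1, f n z.1 (Theta' z.1 z.2))).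
    apply: measurable_fun_pair; first exact: (measurableT_comp mTn measurable_fst).
    exact: (measurableT_comp (mf n) mg1).
  exact: (measurableT_comp mTheta mg2).
apply: (ae_imp (ae_and hf (aut_iterD T))) => omega [[f0 fD fr] TD]; split.
- by apply/funext => x; rewrite /random_conj /= f0 /= Theta'K.
- by move=> m n; apply/funext => x; rewrite /random_conj /= fD /= TD ThetaK.
- move=> n; apply: continuous_torus_Cr0 => x; rewrite /random_conj.
  apply: (@continuous_comp _ _ _ (f n omega \o Theta' omega)); last exact: cTheta.
  apply: continuous_comp; first exact: cTheta'.
  exact: (torus_Cr_continuous (fr n)).
Qed.

Lemma random_conj_topological : topologically_conjugate T f random_conj.
Proof.
exists Theta; split.
  by split => //; apply: aeW => omega; exists (Theta' omega); split.
by apply: aeW => omega; apply/funext => x; rewrite /random_conj /= ThetaK.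
Qed.

End random_conjugation.

(** Differentiating [B \o A = id] shows that the determinants of the two linear maps are inverse to
    each other, so they cancel even if both are negative. *)
Lemma conj_orientation_preserving (R : realType) (d : measure_display)
    (Omega : measurableType d) (P : probability Omega R) (T : automorphism P)
    (r : option nat) (f : int -> Omega -> torus2 R -> torus2 R)
    (A B : torus2 R -> torus2 R) (M N : 'M[R]_2) :
  is_rds r T f -> le_reg 1 r ->
  torus_linear A M -> torus_linear B N -> cancel A B ->
  (\forall omega \ae P, orientation_preserving (f 1 omega)) ->
  \forall omega \ae P, orientation_preserving (conj_rds f A B 1 omega).
Proof.
move=> [_ hf] r1 AM BN AB of1.
apply: (ae_imp (ae_and hf of1)) => omega [[_ _ fr] o1] x.
have [dA DA] := torus_linear_D x AM.
have [dB DB] := torus_linear_D (f 1 omega (A x)) BN.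
have df := torus_Cr_differentiable (A x) r1 (fr 1).
have NM : \det N^T * \det M^T = 1.
  have [dB' DB'] := torus_linear_D (A x) BN.
  rewrite -det_mulmx -DB' -DA -(torus_D_comp dA dB').
  rewrite (_ : B \o A = id) ?torus_D_id ?det1 //.
  by apply/funext => y /=; rewrite AB.
rewrite /conj_rds.
have dfA : differentiable (torus_local (f 1 omega \o A) x) 0.
  rewrite torus_local_comp; apply: differentiable_comp => //.
  by rewrite torus_local0.
rewrite (torus_D_comp (h1 := f 1 omega \o A) dfA dB) (torus_D_comp dA df) DA DB.
rewrite !det_mulmx [\det (torus_D _ _) * _]mulrC mulrA NM mul1r.
exact: o1.
Qed.

(** * Conjugation of the base to rotations *)

Section rotation.
Context (R : realType) (d : measure_display) (Omega : measurableType d).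
Context (P : probability Omega R) (T : automorphism P) (r : option nat).
Context (f : int -> Omega -> torus2 R -> torus2 R).
Context (mu : probability (Omega * torus2 R)%type R).
Context (A B : torus2 R -> torus2 R) (M N : 'M[R]_2).
Hypotheses (AM : torus_linear A M) (BN : torus_linear B N).
Hypotheses (AB : cancel A B) (BA : cancel B A).
Hypotheses (mA : measurable_fun setT A) (mB : measurable_fun setT B).
Hypotheses (rdsf : is_rds r T f) (r1 : le_reg 1 r).
Hypothesis inv : invariant_measure T f mu.
Hypothesis erg : ergodic mu (skew_map T f).
Hypothesis supp : full_support P mu.
Let fhat := conj_rds f A B.
Let F := base_map fhat.
Let phi := fibre_map fhat.
Hypothesis vert : \forall omega \ae P, forall x y,
  fhat 1 omega (x + (0, y)) = fhat 1 omega x + (0, y).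

Lemma oriented_skew_product_rotation :
  (\forall omega \ae P, orientation_preserving (f 1 omega)) ->
  exists (xi : Omega -> circle R -> circle R) (alpha : Omega -> circle R),
    [/\ random_circle_homeo P xi,
        measurable_fun setT alpha,
        {ae P, forall omega, forall x : circle R,
           xi (T omega) (F omega x) = xi omega x + alpha omega} &
        exists g : int -> Omega -> torus2 R -> torus2 R,
          [/\ is_rds (Some 0%N) T g,
              is_skew_product P g
                (fun omega x1 => x1 + alpha omega)
                (fun omega x1 => phi omega ('pinv_(fun=> 0) setT (xi omega) x1)) &
              topologically_conjugate T f g]].
Proof.
move=> of1; have [k [dk sk]] := supp.
have rdsh : is_rds r T fhat := conj_rdsP AM BN AB BA mA mB rdsf.
have skew : is_skew_product P fhat F phi := skew_product_of_vertical vert.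
have [mF diffF] := base_map_diffeo rdsh vert.
have cA : continuous A by exact: (torus_linear_continuous AM).
have cB : continuous B by exact: (torus_linear_continuous BN).
(* The map [pi] semiconjugates f itself to F, so [mu] and its disintegration are projected directly,
   without being transported to [fhat]. *)
pose pi x : circle R := (B x).1.
have mpi : measurable_fun setT pi := measurableT_comp measurable_fst mB.
have cpi : continuous pi.
  by move=> x; apply: (@continuous_comp _ _ _ B fst); [exact: cB|exact: cvg_fst].
have sgK : cancel (fun y : circle R => A (y, 0)) pi by move=> y; rewrite /pi AB.
have semiconj : \forall omega \ae P, forall x, pi (f 1 omega x) = F omega (pi x).
  apply: (ae_imp skew) => omega hs x; have := hs (B x).1 (B x).2.
  by rewrite -surjective_pairing /fhat /conj_rds /= BA /pi => ->.
have Finj : \forall omega \ae P, injective (F omega).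
  by apply: (ae_imp diffF) => omega [F' [K _ _ _]]; exact: can_inj K.
pose m := base_measure k mpi.
have m1 : forall omega, m omega setT = 1%E by move=> omega; exact: base_measureT.
have mm W : measurable W -> measurable_fun setT (fun omega => m omega W).
  by move=> mW; apply: (measurable_kernel k); exact: measurable_preim.
have full := base_measure_full mpi sk cpi sgK.
have nonatomic := base_measure_nonatomic rdsf inv dk mpi mF semiconj erg sk cpi sgK Finj.
have eqv := base_measure_equivariant rdsf inv dk mpi mF semiconj.
have [xi [xi' [mxi mxi' hxi xiE]]] := random_circle_uniformize m1 mm full nonatomic.
have [mT _] := aut_fun_mp T.
(* By equivariance the base point 0 does not matter; fixing it makes [alpha] visibly measurable. *)
pose alpha omega := xi (T omega) (F omega 0) - xi omega 0.
have malpha : measurable_fun setT alpha.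
  have m0 : measurable_fun setT (fun omega : Omega => (omega, 0 : circle R)).
    by apply: measurable_fun_pair; [exact: measurable_id|exact: measurable_cst].
  have mF0 : measurable_fun setT (fun omega => (T omega, F omega 0)).
    by apply: measurable_fun_pair => //; exact: (measurableT_comp mF m0).
  rewrite (_ : alpha = (fun omega => xi (T omega) (F omega 0) + xi omega 0 *~ (- 1))).
    apply: measurable_circleD; first exact: (measurableT_comp mxi mF0).
    by apply: measurable_circleMz; exact: (measurableT_comp mxi m0).
  by apply/funext => omega; rewrite mulrNz mulr1z.
have rot : \forall omega \ae P, forall x,
    xi (T omega) (F omega x) = xi omega x + alpha omega.
  have ofh := conj_orientation_preserving rdsf r1 AM BN AB of1.
  have [_ hh] := rdsh; have xiET := ae_pullback (aut_fun_mp T) xiE.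
  have h := ae_and (ae_and eqv (ae_and skew ofh)) (ae_and hh (ae_and diffF (ae_and xiE xiET))).
  apply: (ae_imp h) => omega [[eq1 [sk1 o1]] [[_ _ fr] [dF [xE xET]]]] x.
  have [F' [K _ Fr _]] := dF.
  have F0 := circle_local_derivative_gt0 r1 (fr 1) sk1 o1.
  have := circle_uniformize_equivariant (m1 omega) (m1 (T omega)) r1 Fr (can_inj K) F0 eq1 x 0.
  rewrite -xE -xET /alpha => /eqP; rewrite subr_eq => /eqP ->.
  by rewrite addrC.
exists xi, alpha; split => //.
  split => //; apply: aeW => omega; have [h1 h2 h3 h4] := hxi omega.
  by exists (xi' omega).
pose Theta omega (x : torus2 R) : torus2 R := (xi omega (B x).1, (B x).2).
pose Theta' omega (x : torus2 R) : torus2 R := A (xi' omega x.1, x.2).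
have mB2 : measurable_fun setT (fun z : Omega * torus2 R => B z.2).
  exact: (measurableT_comp mB measurable_snd).
have mTheta : measurable_fun setT (fun z : Omega * torus2 R => Theta z.1 z.2).
  apply: measurable_fun_pair; last exact: (measurableT_comp measurable_snd mB2).
  have mg : measurable_fun setT (fun z : Omega * torus2 R => (z.1, (B z.2).1)).
    apply: measurable_fun_pair; first exact: measurable_fst.
    exact: (measurableT_comp measurable_fst mB2).
  exact: (measurableT_comp mxi mg).
have mTheta' : measurable_fun setT (fun z : Omega * torus2 R => Theta' z.1 z.2).
  apply: (measurableT_comp mA).
  have ms : measurable_fun setT (fun z : Omega * torus2 R => z.2) by exact: measurable_snd.
  apply: measurable_fun_pair; last exact: (measurableT_comp measurable_snd ms).
  have mg : measurable_fun setT (fun z : Omega * torus2 R => (z.1, z.2.1)).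
    apply: measurable_fun_pair; first exact: measurable_fst.
    exact: (measurableT_comp measurable_fst ms).
  exact: (measurableT_comp mxi' mg).
have ThetaK omega : cancel (Theta omega) (Theta' omega).
  move=> x; have [h1 _ _ _] := hxi omega.
  by rewrite /Theta' /= h1 -surjective_pairing BA.
have Theta'K omega : cancel (Theta' omega) (Theta omega).
  move=> x; have [_ h2 _ _] := hxi omega.
  by rewrite /Theta AB /= h2 -surjective_pairing.
have cprod (u : circle R -> circle R) : continuous u ->
    continuous (fun x : torus2 R => (u x.1, x.2)).
  move=> cu x.
  have c1 : {for x, continuous (fun x : torus2 R => u x.1)}.
    by apply: (@continuous_comp _ _ _ fst u); [exact: cvg_fst|exact: cu].
  have c2 : {for x, continuous (fun x : torus2 R => x.2)} by exact: cvg_snd.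
  exact: (cvg_pair c1 c2).
have cTheta omega : continuous (Theta omega).
  have [_ _ h3 _] := hxi omega.
  move=> x; apply: (@continuous_comp _ _ _ B (fun x => (xi omega x.1, x.2))).
    exact: cB.
  exact: (cprod _ h3).
have cTheta' omega : continuous (Theta' omega).
  have [_ _ _ h4] := hxi omega.
  move=> x; apply: (@continuous_comp _ _ _ (fun x => (xi' omega x.1, x.2)) A).
    exact: (cprod _ h4).
  exact: cA.
exists (random_conj T f Theta Theta'); split.
- exact: (random_conjP rdsf).
- apply: (ae_imp (ae_and skew rot)) => omega [hs ro] x1 x2.
  have [h1 h2 _ _] := hxi omega.
  have -> : 'pinv_(fun=> 0) setT (xi omega) x1 = xi' omega x1.
    apply: (can_inj h1); rewrite h2 pinvK //; apply/mem_set.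
    by exists (xi' omega x1) => //; rewrite h2.
  rewrite /random_conj /Theta /Theta' /=.
  have := hs (xi' omega x1) x2; rewrite /fhat /conj_rds /= => ->.
  by rewrite ro h2.
- exact: (random_conj_topological).
Qed.

End rotation.

(** A single good omega decides: one whose map fixes [c] everywhere and has a derivative different
    from the identity somewhere. *)
Lemma rds_rational_direction (R : realType) (d : measure_display)
    (Omega : measurableType d) (P : probability Omega R) (T : automorphism P)
    (r : option nat) (f : int -> Omega -> torus2 R -> torus2 R) (c : 'cV[R]_2) :
  is_rds r T f -> le_reg 1 r -> c != 0 ->
  (\forall omega \ae P, forall x, torus_D (f 1 omega) x *m c = c) ->
  ~ (\forall omega \ae P, forall x, torus_D (f 1 omega) x = 1%:M) ->
  exists (q p : int) (s : R),
    [/\ coprimez q p, s != 0 & c^T = s *: rv2 q%:~R p%:~R].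
Proof.
move=> [_ hf] r1 c0 hc nI; apply: (rational_direction r1 c0).
apply: contrapT => no; apply: nI.
apply: (ae_imp (ae_and hf hc)) => omega [[_ _ fr] fc] x.
apply: contrapT => Dx; apply: no.
by exists (f 1 omega) => //; split => //; exists x.
Qed.

(** [A] sends vertical translations to translations along the line of [c], with which f_omega
    commutes by [torus_flow]. *)
Lemma conj_rds_vertical (R : realType) (d : measure_display)
    (Omega : measurableType d) (P : probability Omega R) (T : automorphism P)
    (r : option nat) (f : int -> Omega -> torus2 R -> torus2 R)
    (A B : torus2 R -> torus2 R) (M N : 'M[R]_2) (c : 'cV[R]_2) (s : R) :
  torus_linear A M -> torus_linear B N -> cancel A B -> is_rds r T f ->
  le_reg 1 r -> (\forall omega \ae P, forall x, torus_D (f 1 omega) x *m c = c) ->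
  s != 0 -> c^T = s *: (rv2 0 1 *m M) ->
  \forall omega \ae P, forall x y,
    conj_rds f A B 1 omega (x + (0, y)) = conj_rds f A B 1 omega x + (0, y).
Proof.
move=> [AD AM] [BD _] AB [_ hf] r1 hc s0 cE.
apply: (ae_imp (ae_and hf hc)) => omega [[_ _ fr] fc] x y.
have Ay : A (0, y) = torus_exp ((circle_log y / s) *: c^T).
  rewrite cE scalerA divfK // scalemxAl -AM; congr A.
  by rewrite /torus_exp !mxE /= mulr0 mulr1 circle_exp0 circle_logK.
have fl := torus_flow r1 (fr 1) (c := c^T).
rewrite trmxK in fl; rewrite /conj_rds /= AD Ay (fl fc) -Ay BD.
by rewrite AB.
Qed.

Theorem theorem2 (R : realType) (d : measure_display)
    (Omega : measurableType d) (P : probability Omega R)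
    (T : automorphism P) (r : option nat)
    (f : int -> Omega -> torus2 R -> torus2 R)
    (mu : probability (Omega * torus2 R)%type R) (tau : R) :
  lebesgue_space P ->
  ergodic P T ->
  le_reg 1 r ->
  is_rds r T f ->
  invariant_measure T f mu ->
  ergodic mu (skew_map T f) ->
  full_support P mu ->
  0 < tau ->
  polynomial_growth tau f mu ->
  1 <= tau /\
  exists (fhat : int -> Omega -> torus2 R -> torus2 R)
         (F phi : Omega -> circle R -> circle R),
    [/\ is_rds r T fhat,
        algebraically_conjugate P f fhat,
        random_circle_diffeo P r F /\ random_circle_map phi,
        is_skew_product P fhat F phi &
        {ae P, forall omega, orientation_preserving (f 1 omega)} ->
        exists (xi : Omega -> circle R -> circle R) (alpha : Omega -> circle R),
          [/\ random_circle_homeo P xi,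
              measurable_fun setT alpha,
              {ae P, forall omega, forall x : circle R,
                 xi (T omega) (F omega x) = xi omega x + alpha omega} &
              exists g : int -> Omega -> torus2 R -> torus2 R,
                [/\ is_rds (Some 0%N) T g,
                    is_skew_product P g
                      (fun omega x1 => x1 + alpha omega)
                      (fun omega x1 => phi omega
                         ('pinv_(fun=> 0) setT (xi omega) x1)) &
                    topologically_conjugate T f g]]].
Proof.
move=> _ _ r1 rdsf inv erg supp tau0 growth.
have [tau1 [c [c0 hc nI]]] := rds_fixed_direction rdsf r1 inv erg supp tau0 growth.
split=> //.
have [q [p [s [cop s0 cE]]]] := rds_rational_direction rdsf r1 c0 hc nI.
have [u [v uv]] : exists u v : int, u * q + v * p = 1.
  by have /coprimezP[[u v] /= uv] := cop; exists u, v.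
(* The second column of [A] is the primitive direction [(q, p)]. Its first column [(v, - u)] comes
   from the Bezout relation, which makes the determinant 1. *)
pose A := @int_torus R v q (- u) p; pose B := @int_torus R p (- q) u v.
have AM : torus_linear A _ := int_torus_linear R v q (- u) p.
have BN : torus_linear B _ := int_torus_linear R p (- q) u v.
have AB : cancel A B.
  have det : v * p - q * (- u) = 1 by rewrite -uv; ring.
  by have := @int_torusK R _ _ _ _ det; rewrite opprK.
have BA : cancel B A.
  have det : p * v - (- q) * u = 1 by rewrite -uv; ring.
  by have := @int_torusK R _ _ _ _ det; rewrite opprK.
have mA : measurable_fun setT A by exact: measurable_int_torus.
have mB : measurable_fun setT B by exact: measurable_int_torus.
have rdsh := conj_rdsP AM BN AB BA mA mB rdsf.
have vert : \forall omega \ae P, forall x y,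
    conj_rds f A B 1 omega (x + (0, y)) = conj_rds f A B 1 omega x + (0, y).
  apply: (conj_rds_vertical AM BN AB rdsf r1 hc s0); rewrite cE; congr (_ *: _).
  by apply: rv2P; rewrite mulmx2E !mxE /= mul0r mul1r add0r.
exists (conj_rds f A B), (base_map (conj_rds f A B)), (fibre_map (conj_rds f A B)).
split.
- exact: rdsh.
- exact: (conj_rds_algebraic P f AM BN AB BA).
- by split; [exact: (base_map_diffeo rdsh vert)|exact: (measurable_fibre_map rdsh)].
- exact: (skew_product_of_vertical vert).
- exact: (oriented_skew_product_rotation AM BN AB BA mA mB rdsf r1 inv erg supp vert).
Qed.
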